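(* Let $n\ge 2$, let $0<p<1$ and let $K\subset\mathbb{R}^n$ be an origin-symmetric convex body. Then for every linear subspace $\xi$ of $\mathbb{R}^n$ with $0<\dim\xi<n$, the $p$-affine dual curvature measure $\mathcal{I}_p(K,\cdot)$ satisfies $$\frac{\mathcal{I}_p(K,\xi\cap S^{n-1})}{\mathcal{I}_p(K,S^{n-1})}<\frac{\dim\xi}{n-p}.$$
   Context: A convex body is a compact convex subset of $\mathbb{R}^n$ with nonempty interior; $\mathcal{K}_o^n$ is the set of convex bodies containing the origin in their interiors. For $K\in\mathcal{K}_o^n$, the support function is $h_K(v)=\max\{x\cdot v: x\in K\}$, $v\in S^{n-1}$, and for a compact set $K$ star-shaped with respect to the origin the radial function is $\rho_K(x)=\max\{t\ge 0: tx\in K\}$, $x\in\mathbb{R}^n\setminus\{o\}$. A star body is a compact star-shaped set (with respect to the origin) whose radial function is continuous and positive on $S^{n-1}$. Spherical Lebesgue measure is denoted $du$, $dv$. $L_p$ intersection body: for $p\in(-\infty,0)\cup(0,1)$ and a body $K$ (star body, in particular $K\in\mathcal{K}_o^n$), $\mathrm{I}_pK$ is the star body with radial function $$\rho_{\mathrm{I}_pK}(x)=\Big(\frac{1-p}{2}\int_K|x\cdot y|^{-p}\,dy\Big)^{1/p},\qquad x\in\mathbb{R}^n\setminus\{o\}.$$ $q$-cosine transform: for $q>-1$ and $f\in C(S^{n-1})$, $T_qf(u)=\int_{S^{n-1}}f(v)|u\cdot v|^q\,dv$, $u\in S^{n-1}$. Reverse radial Gauss image: for $K\in\mathcal{K}_o^n$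 and $\eta\subset S^{n-1}$, $\boldsymbol{\alpha}_K^*(\eta)=\bigcup_{v\in\eta}\{u\in S^{n-1}:\rho_K(u)\,u\cdot v=h_K(v)\}$. $p$-affine dual curvature measure: for $K\in\mathcal{K}_o^n$ and Borel $\eta\subset S^{n-1}$, $$\mathcal{I}_p(K,\eta)=\frac{1-p}{2|p|}\int_{\boldsymbol{\alpha}_K^*(\eta)}\rho_K^{n-p}(v)\,T_{-p}\rho_{\mathrm{I}_pK}^{n-p}(v)\,dv .$$ *)

(* Defs.v *)
(* R^n is 'rV[R]_n, whose library topology is the usual one; all metric notions
   below refer to the Euclidean norm enorm, not to the library norm `|x| of
   'rV[R]_n, which is the sup norm. *)
From HB Require Import structures.
From mathcomp Require Import all_boot all_order all_algebra.
From mathcomp Require Import all_classical all_reals all_analysis.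
From mathcomp Require Import measurable_realfun.

Set Implicit Arguments.
Unset Strict Implicit.
Unset Printing Implicit Defensive.

Import Order.TTheory GRing.Theory Num.Theory.
Import numFieldNormedType.Exports.

Local Open Scope classical_set_scope.
Local Open Scope ring_scope.

Section euclidean.
Context {R : realType} {n : nat}.
Implicit Types x y : 'rV[R]_n.

Definition dotp x y : R := \sum_(i < n) x 0 i * y 0 i.

Definition enorm x : R := Num.sqrt (dotp x x).

Definition sphere : set 'rV[R]_n := [set u | enorm u = 1].

End euclidean.

(* The product sigma-algebra on 'rV[R]_n, transported from n.-tuple R; it is
   the Borel sigma-algebra. *)
Section row_measurable.
Context {R : realType} {n : nat}.

Definition tuple_of_row (x : 'rV[R]_n) : n.-tuple R := [tuple x 0 i | i < n].

Definition row_of_tuple (t : n.-tuple R) : 'rV[R]_n := \row_i tnth t i.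

Lemma row_of_tupleK : cancel row_of_tuple tuple_of_row.
Proof. by move=> t; apply: eq_from_tnth => i; rewrite tnth_mktuple mxE. Qed.

Lemma tuple_of_rowK : cancel tuple_of_row row_of_tuple.
Proof. by move=> x; apply/rowP => i; rewrite mxE tnth_mktuple. Qed.

HB.instance Definition _ :=
  @isMeasurable.Build (preimage_display tuple_of_row) 'rV[R]_n
    (g_sigma_algebra_preimage tuple_of_row)
    (@measurable0 _ (g_sigma_algebra_preimageType tuple_of_row))
    (@measurableC _ (g_sigma_algebra_preimageType tuple_of_row))
    (@bigcupT_measurable _ (g_sigma_algebra_preimageType tuple_of_row)).

Lemma measurable_tuple_of_row : measurable_fun setT tuple_of_row.
Proof. by move=> _ B mB; exists B. Qed.

Lemma measurable_row_of_tuple : measurable_fun setT row_of_tuple.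
Proof.
move=> _ _ [B mB <-]; rewrite !setTI -comp_preimage.
by rewrite (_ : tuple_of_row \o row_of_tuple = id) //; apply/funext/row_of_tupleK.
Qed.

Lemma measurable_coord (i : 'I_n) :
  measurable_fun setT (fun x : 'rV[R]_n => x 0 i).
Proof.
rewrite (_ : (fun _ => _) = (fun t : n.-tuple R => tnth t i) \o tuple_of_row).
  exact: measurableT_comp (measurable_tnth i) measurable_tuple_of_row.
by apply/funext => x /=; rewrite tnth_mktuple.
Qed.

Lemma measurable_rowP d (T : measurableType d) (f : T -> 'rV[R]_n) :
  (forall i, measurable_fun setT (fun t => f t 0 i)) -> measurable_fun setT f.
Proof.
move=> mf; rewrite (_ : f = row_of_tuple \o (tuple_of_row \o f)); last first.
  by apply/funext => t /=; rewrite tuple_of_rowK.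
apply: measurableT_comp; first exact: measurable_row_of_tuple.
apply/measurable_fun_tnthP => i.
by apply: eq_measurable_fun (mf i) => t _ /=; rewrite tnth_mktuple.
Qed.

Lemma measurable_dotp : measurable_fun setT (fun x : 'rV[R]_n => dotp x x).
Proof.
apply: measurable_sum => i.
by apply: measurable_funM; exact: measurable_coord.
Qed.

Lemma dotp_ge0 (x : 'rV[R]_n) : 0 <= dotp x x.
Proof. by apply: sumr_ge0 => i _; rewrite -expr2 sqr_ge0. Qed.

Lemma measurable_enorm : measurable_fun setT (@enorm R n).
Proof.
rewrite (_ : @enorm R n = (@powR R ^~ 2^-1) \o (fun x => dotp x x)).
  exact: measurableT_comp (measurable_powR _) measurable_dotp.
by apply/funext => x; rewrite /= powR12_sqrt// dotp_ge0.
Qed.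

Definition normalize (x : 'rV[R]_n) : 'rV[R]_n := (enorm x)^-1 *: x.

Lemma measurable_normalize : measurable_fun setT normalize.
Proof.
apply: measurable_rowP => i.
rewrite (_ : (fun _ => _) =
    (fun x : 'rV[R]_n => enorm x `^ (- 1)) \* (fun x => x 0 i)).
  apply: measurable_funM (measurable_coord i).
  exact: measurableT_comp (measurable_powR _) measurable_enorm.
by apply/funext => x; rewrite /= mxE powR_inv1// sqrtr_ge0.
Qed.

Definition punctured_ball : set 'rV[R]_n := [set x | 0 < enorm x <= 1].

Lemma measurable_punctured_ball : measurable punctured_ball.
Proof.
rewrite (_ : punctured_ball = setT `&` @enorm R n @^-1` `]0, 1]).
  exact: measurable_enorm.
by rewrite setTI; apply/seteqP; split => x /=; rewrite in_itv.
Qed.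

End row_measurable.

Section image_measure.
Context d d' (T : measurableType d) (T' : measurableType d') {R : realType}.
Variables (m : {measure set T -> \bar R}) (f : T -> T').
Variable mf : measurable_fun setT f.

(* The library's measure structure on pushforward m f, with the measurability
   proof, which canonical inference cannot supply, given explicitly. *)
Definition image_measure : {measure set T' -> \bar R} :=
  measure_function_pushforward__canonical__measure_function_Measure m mf.

End image_measure.

Section lebesgue_rn.
Context {R : realType}.

Definition tuple_cons n (z : n.-tuple R * R) : n.+1.-tuple R :=
  [tuple of z.2 :: z.1].

Lemma measurable_tuple_cons n : measurable_fun setT (@tuple_cons n).
Proof. exact: measurable_cons. Qed.

Fixpoint lebesgue_tuple n : {measure set (n.-tuple R) -> \bar R} :=
  match n with
  | 0 => \d_([tuple] : 0.-tuple R)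
  | n'.+1 =>
      image_measure (lebesgue_tuple n' \x @lebesgue_measure R)%E
        (@measurable_tuple_cons n')
  end.

Definition lebesgue_row n : {measure set 'rV[R]_n -> \bar R} :=
  image_measure (lebesgue_tuple n) measurable_row_of_tuple.

(* Spherical Lebesgue measure, as the cone measure: sigma(A) is n times the
   volume of {t u | 0 < t <= 1, u in A}, for A a Borel subset of the sphere. *)
Definition sphere_measure n : {measure set 'rV[R]_n -> \bar R} :=
  mscale (n%:R : R)%:nng
    (image_measure
      (mrestr (@lebesgue_row n) measurable_punctured_ball)
      measurable_normalize).

End lebesgue_rn.

Section convex_geometry.
Context {R : realType} {n : nat}.
Implicit Types (K eta : set 'rV[R]_n) (f : 'rV[R]_n -> R) (p q : R).

Definition convex_body K := [/\ compact K, convex_set K & interior K !=set0].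

Definition origin_symmetric K := forall x, K x -> K (- x).

Definition support_fun K (v : 'rV[R]_n) : R := sup [set dotp x v | x in K].

Definition radial_fun K (x : 'rV[R]_n) : R :=
  sup [set t | 0 <= t /\ K (t *: x)].

Definition star_body_of f : set 'rV[R]_n :=
  \bigcup_(u in sphere) [set t *: u | t in `[0, f u]].

(* powR sets 0 `^ (- p) to 0 for p != 0; below, this affects the integrands
   only on a null set (a hyperplane, resp. a great subsphere). *)
Definition Lp_intersection_radial p K (x : 'rV[R]_n) : R :=
  ((1 - p) / 2 *
    \int[lebesgue_row n]_(y in K) (`|dotp x y| `^ (- p))) `^ p^-1.

Definition Lp_intersection_body p K : set 'rV[R]_n :=
  star_body_of (Lp_intersection_radial p K).

Definition cosine_transform q f (u : 'rV[R]_n) : R :=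
  \int[sphere_measure n]_(v in sphere) (f v * `|dotp u v| `^ q).

Definition reverse_radial_gauss_image K eta : set 'rV[R]_n :=
  \bigcup_(v in eta)
    [set u | sphere u /\ dotp (radial_fun K u *: u) v = support_fun K v].

(* For eta Borel the domain of integration is Lebesgue measurable but need not
   be Borel; the library integral of a nonnegative function is then the
   supremum over Borel simple functions, which is the Lebesgue integral. *)
Definition affine_dual_curvature_measure p K eta : R :=
  (1 - p) / (2 * `|p|) *
    \int[sphere_measure n]_(v in reverse_radial_gauss_image K eta)
      (radial_fun K v `^ (n%:R - p) *
       cosine_transform (- p)
         (fun w => radial_fun (Lp_intersection_body p K) w `^ (n%:R - p)) v).

End convex_geometry.

(* Main.v *)
(* Put k = dim xi, let W(x) be the integral over the sphere of g(w) |x.w|^-p with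
   g = rho_{I_p K}^(n-p), and let mu(A) be the integral of W over A. Since W is
   homogeneous of degree -p, polar coordinates turn the curvature measure of eta
   into a constant times mu of the cone in K over the reverse radial Gauss image
   of eta. For eta = xi /\ S this cone lies in a set C of points of K which leave K
   and the cylinder P over the projection of K to xi simultaneously, so that
   C /\ sP is contained in sC for 0 < s < 1. It remains to prove
   (n - p) mu(C) < k mu(K).

   Let D_s multiply the component along xi by s and fix the complement. By
   Steiner symmetrization along the fibres of the projection to xi, the volume of
   Q /\ L is at most that of Q /\ D_s^-1 L whenever L is convex and symmetric, Q is
   a union of fibres and 0 < s <= 1. As |t|^-p is even and unimodal, slicing by
   its level sets extends this from volume to the weight W. Hence
     mu(K /\ tP) - mu(K /\ tlP) >= t^k (mu(K) - mu(K /\ lP))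
                                >= t^k (1 - l^(n-p)) mu(C).
   Summing over t = l^j, j < m, with l^m = d fixed, and letting l tend to 1 gives
     mu(K) >= mu(K /\ dP) + (1 - d^k) (n - p) / k mu(C),
   and mu(K /\ dP) > d^k mu(K) for small d, because W o D_d blows up. *)

Require Import Defs.
From HB Require Import structures.
From mathcomp Require Import all_boot all_order all_algebra.
From mathcomp Require Import all_classical all_reals all_analysis.
From mathcomp Require Import measurable_realfun ring lra.

Set Implicit Arguments.
Unset Strict Implicit.
Unset Printing Implicit Defensive.

Import Order.TTheory GRing.Theory Num.Theory.
Import numFieldNormedType.Exports.

Local Open Scope classical_set_scope.
Local Open Scope ring_scope.

(** * Lebesgue measure on [R^n] *)

(** The slicing by level sets is done for one [w] at a time, where these sets are slabs; integration
    against [g] comes afterwards, by Tonelli. All integrands are nonnegative and extended-valued, so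
    finiteness of [mu(K)], which rests on [p < 1], is called for only where masses are subtracted or
    compared strictly. The geometric sum stands in for the derivative of [t -> mu(K /\ tP)]; in the
    limit it yields a weak inequality, and the strict sign comes from the innermost set [K /\ dP]. A
    pair of dual bases [E], [B] adapted to [xi] replaces orthonormal coordinates: symmetrization,
    scaling and Jacobians are computed along one [E i] at a time, with [x . B i] as coordinate. The
    reverse radial Gauss image need not be Borel, so its mass is bounded by that of a Borel set of
    directions, where polar coordinates apply. *)

Section lebesgue_line.
Context {R : realType}.
Local Notation mu := (@lebesgue_measure R).

Lemma measurable_affine (s c : R) :
  measurable_fun setT (fun t : measurableTypeR R => s * t + c : measurableTypeR R).
Proof. by apply: measurable_funD => //; apply: measurable_funM. Qed.

(** Uniqueness of Lebesgue measure: the rescaled image measure agrees with it on half-open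
    intervals. *)
Lemma lebesgue_measure_affine (s c : R) (A : set R) : 0 < s -> measurable A ->
  (s%:E * mu ((fun t => s * t + c)%R @^-1` A) = mu A)%E.
Proof.
move=> s0 mA.
pose nu : {measure set (measurableTypeR R) -> \bar R} :=
  mscale (NngNum (ltW s0)) (image_measure mu (measurable_affine s c)).
have -> : (s%:E * mu ((fun t => s * t + c)%R @^-1` A) = nu A)%E by [].
apply/esym/lebesgue_measure_unique => //= _ [[a b]] _ <- /=.
rewrite /nu /mscale/= /pushforward.
rewrite (_ : _ @^-1` _ = `](a - c) / s, (b - c) / s]%classic); last first.
  apply/seteqP; split => t /=; rewrite !in_itv/=;
    by rewrite ltr_pdivrMr// ler_pdivlMr// ltrBlDr lerBrDr [t * s]mulrC.
rewrite !lebesgue_measure_itv/= !lte_fin.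
rewrite ltr_pM2r ?invr_gt0// ltrD2r.
case: ifPn => ab; last by rewrite mule0.
by rewrite -!EFinB -EFinM -mulrBl mulrCA divff ?gt_eqF// mulr1 opprB addrA addrNK.
Qed.

Lemma ge0_integral_affine (s c : R) (f : R -> \bar R) : 0 < s ->
  measurable_fun setT f -> (forall x, 0 <= f x)%E ->
  (s%:E * \int[mu]_t f (s * t + c)%R = \int[mu]_t f t)%E.
Proof.
move=> s0 mf f0.
pose nu : {measure set (measurableTypeR R) -> \bar R} :=
  mscale (NngNum (ltW s0)) (image_measure mu (measurable_affine s c)).
transitivity (\int[nu]_t f t)%E; last first.
  by apply: eq_measure_integral => A mA _; exact: lebesgue_measure_affine.
rewrite ge0_integral_mscale//=; congr (_ * _)%E.
by rewrite ge0_integral_pushforward//; exact: measurable_affine.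
Qed.

Lemma ge0_integral_shift (c : R) (f : R -> \bar R) :
  measurable_fun setT f -> (forall x, 0 <= f x)%E ->
  (\int[mu]_t f (t + c)%R = \int[mu]_t f t)%E.
Proof.
move=> mf f0; rewrite -[RHS](@ge0_integral_affine 1 c)// mul1e.
by under [RHS]eq_integral do rewrite mul1r.
Qed.

End lebesgue_line.

Section lebesgue_tuple_theory.
Context {R : realType}.
Implicit Types n : nat.

Lemma lebesgue_tupleS n (A : set (n.+1.-tuple R)) : lebesgue_tuple n.+1 A =
  (lebesgue_tuple n \x @lebesgue_measure R)%E (@tuple_cons R n @^-1` A).
Proof. by []. Qed.

Definition tuple_box n (a b : R) : set (n.-tuple R) :=
  [set t | forall i, a < tnth t i <= b].

Lemma measurable_tuple_box n a b : measurable (@tuple_box n a b).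
Proof.
rewrite (_ : tuple_box a b =
    \bigcap_(i in @setT 'I_n) ((fun t => tnth t i) @^-1` `]a, b])); last first.
  by apply/seteqP; split => t /= tab i; have := tab i; rewrite /= in_itv//; exact.
apply: fin_bigcap_measurable => // i _; rewrite -[X in measurable X]setTI.
exact: (measurable_tnth i).
Qed.

Lemma lebesgue_tuple_box n (a b : R) : a <= b ->
  lebesgue_tuple n (tuple_box a b) = ((b - a) ^+ n)%:E.
Proof.
move=> ab; elim: n => [|n IH].
  by rewrite /= diracE mem_set//; case.
rewrite lebesgue_tupleS (_ : _ @^-1` _ = tuple_box a b `*` `]a, b]%classic).
  rewrite product_measure1E//; last exact: measurable_tuple_box.
  rewrite IH [X in (_ * X)%E](lebesgue_measure_itv `]a, b]) /= lte_fin exprSr EFinM.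
  congr (_ * _)%E.
  by case: ltP => // ba; rewrite (@le_anti _ _ a b) ?subrr// ab.
apply/seteqP; split => [[z x] /= h|[z x] /= [hz hx] i].
  split=> /=; last by rewrite in_itv/=; have := h ord0; rewrite tnth0.
  by move=> i; have := h (lift ord0 i); rewrite tnthS.
case: (unliftP ord0 i) => [j ->|->]; first by rewrite tnthS; exact: hz.
by rewrite tnth0; move: hx; rewrite in_itv.
Qed.

Lemma sigma_finite_lebesgue_tuple n : sigma_finite setT (@lebesgue_tuple R n).
Proof.
exists (fun k => @tuple_box n (- k%:R) k%:R).
  apply/seteqP; split => // t _.
  pose M := \sum_(i < n) (`|tnth t i| + 1).
  have Mt i : `|tnth t i| < M.
    rewrite /M (bigD1 i)//= -addrA ltrDl ltr_wpDr//.
    by apply: sumr_ge0 => j _; rewrite addr_ge0.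
  exists (Num.truncn M).+1 => //= i.
  have h : `|tnth t i| < (Num.truncn M).+1%:R.
    exact: lt_trans (Mt i) (truncnS_gt M).
  by move: h; rewrite ltr_norml => /andP[-> /ltW].
move=> k; split; first exact: measurable_tuple_box.
rewrite lebesgue_tuple_box ?ltry//.
by rewrite (@le_trans _ _ 0)// oppr_le0.
Qed.

(* Unlike [lebesgue_tuple] and [lebesgue_row], the aliases [lebt] and [lebrow]
   carry the sigma-finite structure that Tonelli's theorem requires. *)
Definition lebt n (A : set (n.-tuple R)) := lebesgue_tuple n A.
HB.instance Definition _ n := Measure.copy (@lebt n) (@lebesgue_tuple R n).
HB.instance Definition _ n := Measure_isSigmaFinite.Build _ _ _ (@lebt n)
  (sigma_finite_lebesgue_tuple n).

Lemma ge0_integral_lebtS n (f : n.+1.-tuple R -> \bar R) :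
  measurable_fun setT f -> (forall t, 0 <= f t)%E ->
  (\int[@lebt n.+1]_t f t =
   \int[@lebt n]_z \int[@lebesgue_measure R]_x f (tuple_cons (z, x)))%E.
Proof.
move=> mf f0.
transitivity (\int[pushforward (lebesgue_tuple n \x @lebesgue_measure R)
    (@tuple_cons R n)]_t f t)%E => //.
rewrite ge0_integral_pushforward//; last exact: measurable_tuple_cons.
rewrite preimage_setT (@fubini_tonelli1 _ _ _ _ _ (@lebt n))//.
  exact: (measurableT_comp mf (@measurable_tuple_cons R n)).
by move=> x; exact: f0.
Qed.

Definition tuple_shift n (c t : n.-tuple R) : n.-tuple R :=
  [tuple tnth t i + tnth c i | i < n].

Lemma measurable_tuple_shift n (c : n.-tuple R) :
  measurable_fun setT (tuple_shift c).
Proof.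
apply/measurable_fun_tnthP => i.
rewrite (_ : _ \o _ = fun t => tnth t i + tnth c i).
  by apply: measurable_funD => //; exact: measurable_tnth.
by apply/funext => t /=; rewrite tnth_mktuple.
Qed.

Lemma ge0_integral_tuple_shift n (c : n.-tuple R) (f : n.-tuple R -> \bar R) :
  measurable_fun setT f -> (forall t, 0 <= f t)%E ->
  (\int[@lebt n]_t f (tuple_shift c t) = \int[@lebt n]_t f t)%E.
Proof.
elim: n c f => [c f _ _|n IH c f mf f0].
  by congr integral; apply/funext => t; congr f; apply: eq_from_tnth => -[].
have mcons := @measurable_tuple_cons R.
pose c' := [tuple tnth c (lift ord0 i) | i < n].
rewrite !ge0_integral_lebtS//; last first.
  by apply: measurableT_comp => //; exact: measurable_tuple_shift.
transitivity (\int[@lebt n]_z \int[@lebesgue_measure R]_x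
    f (tuple_cons (tuple_shift c' z, x)))%E.
  apply: eq_integral => z _.
  rewrite -[RHS](ge0_integral_shift (tnth c ord0))//.
    apply: eq_integral => x _; congr f; apply: eq_from_tnth => i.
    rewrite tnth_mktuple; case: (unliftP ord0 i) => [j ->|->].
      by rewrite !tnthS !tnth_mktuple.
    by rewrite !tnth0.
  exact: (measurableT_comp (measurableT_comp mf (mcons n)) (pair1_measurable _)).
apply: (IH c'
  (fun z => \int[@lebesgue_measure R]_x f (tuple_cons (z, x)))%E).
- apply: (@measurable_fun_fubini_tonelli_F _ _ _ _ _ (@lebesgue_measure R)
    (f \o @tuple_cons R n)); last by move=> x; exact: f0.
  exact: (measurableT_comp mf (mcons n)).
- by move=> z; apply: integral_ge0.
Qed.

End lebesgue_tuple_theory.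

(** * The Euclidean inner product and norm *)

Section dotp_theory.
Context {R : realType} {n : nat}.
Implicit Types x y z : 'rV[R]_n.

Lemma dotpC x y : dotp x y = dotp y x.
Proof. by apply: eq_bigr => i _; rewrite mulrC. Qed.

Lemma dotpDl x y z : dotp (x + y) z = dotp x z + dotp y z.
Proof. by rewrite -big_split; apply: eq_bigr => i _; rewrite mxE mulrDl. Qed.

Lemma dotpZl (a : R) x z : dotp (a *: x) z = a * dotp x z.
Proof. by rewrite mulr_sumr; apply: eq_bigr => i _; rewrite mxE mulrA. Qed.

Lemma dotpNl x z : dotp (- x) z = - dotp x z.
Proof. by rewrite -scaleN1r dotpZl mulN1r. Qed.

Lemma dotpBl x y z : dotp (x - y) z = dotp x z - dotp y z.
Proof. by rewrite dotpDl dotpNl. Qed.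

Lemma dotp0l z : dotp 0 z = 0.
Proof. by rewrite -(scale0r 0) dotpZl mul0r. Qed.

Lemma dotpDr x y z : dotp z (x + y) = dotp z x + dotp z y.
Proof. by rewrite dotpC dotpDl !(dotpC z). Qed.

Lemma dotpZr (a : R) x z : dotp z (a *: x) = a * dotp z x.
Proof. by rewrite dotpC dotpZl (dotpC z). Qed.

Lemma dotpNr x z : dotp z (- x) = - dotp z x.
Proof. by rewrite dotpC dotpNl (dotpC z). Qed.

Lemma dotpBr x y z : dotp z (x - y) = dotp z x - dotp z y.
Proof. by rewrite dotpDr dotpNr. Qed.

Lemma dotp0r z : dotp z 0 = 0.
Proof. by rewrite dotpC dotp0l. Qed.

Lemma dotp_suml (I : Type) (r : seq I) (P : pred I) (F : I -> 'rV[R]_n) z :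
  dotp (\sum_(i <- r | P i) F i) z = \sum_(i <- r | P i) dotp (F i) z.
Proof.
elim/big_rec2: _ => [|i y1 y2 _ <-]; first by rewrite dotp0l.
by rewrite dotpDl.
Qed.

Lemma dotp_eq0 x : (dotp x x == 0) = (x == 0).
Proof.
apply/eqP/eqP => [|->]; last by rewrite dotp0l.
move=> /eqP; rewrite psumr_eq0; last by move=> i _; rewrite -expr2 sqr_ge0.
move=> /allP h; apply/rowP => i; rewrite mxE.
by have /= := h i (mem_index_enum i); rewrite mulf_eq0 orbb => /eqP.
Qed.

Lemma enorm_ge0 x : 0 <= enorm x.
Proof. exact: sqrtr_ge0. Qed.

Lemma enorm_sqr x : enorm x ^+ 2 = dotp x x.
Proof. by rewrite sqr_sqrtr// dotp_ge0. Qed.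

Lemma enorm_eq0 x : (enorm x == 0) = (x == 0).
Proof. by rewrite -dotp_eq0 -enorm_sqr sqrf_eq0. Qed.

Lemma enorm_gt0 x : (0 < enorm x) = (x != 0).
Proof. by rewrite lt_neqAle enorm_ge0 andbT eq_sym enorm_eq0. Qed.

Lemma enormZ (a : R) x : enorm (a *: x) = `|a| * enorm x.
Proof.
by rewrite /enorm dotpZl dotpZr mulrA -expr2 sqrtrM ?sqr_ge0// sqrtr_sqr.
Qed.

Lemma enormN x : enorm (- x) = enorm x.
Proof. by rewrite -scaleN1r enormZ normrN1 mul1r. Qed.

(** Cauchy-Schwarz, from [0 <= |(y . y) x - (x . y) y|^2 = (y . y) ((x . x) (y . y) - (x .
    y)^2)]. *)
Lemma ler_dotp x y : `|dotp x y| <= enorm x * enorm y.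
Proof.
have [->|y0] := eqVneq y 0.
  by rewrite dotp0r normr0 mulr_ge0// enorm_ge0.
have Y0 : 0 < dotp y y by rewrite lt_neqAle dotp_ge0 eq_sym dotp_eq0 y0.
rewrite -[leLHS]ger0_norm// -(ler_sqr (x := `| _ |)) ?nnegrE ?mulr_ge0 ?enorm_ge0//.
rewrite normr_id exprMn !enorm_sqr real_normK ?num_real//.
have := dotp_ge0 (dotp y y *: x - dotp x y *: y).
rewrite !(dotpBl, dotpBr, dotpZl, dotpZr) (dotpC y x).
set a := dotp x x; set b := dotp x y; set c := dotp y y.
rewrite (_ : _ - _ = c * (a * c - b ^+ 2)); last by ring.
by rewrite pmulr_rge0// subr_ge0.
Qed.

Lemma ler_enormD x y : enorm (x + y) <= enorm x + enorm y.
Proof.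
rewrite -ler_sqr ?nnegrE ?addr_ge0 ?enorm_ge0// sqrrD !enorm_sqr.
rewrite dotpDl !dotpDr (dotpC y x) addrA -[leLHS]addrA -[leRHS]addrA.
rewrite -addrA lerD2l addrA lerD2r -mulr2n lerMn2r/=.
by rewrite (le_trans (ler_norm _))// ler_dotp.
Qed.

End dotp_theory.

Section row_measure.
Context {R : realType}.
Implicit Types n : nat.

Definition lebrow n (A : set 'rV[R]_n) := lebesgue_row n A.
HB.instance Definition _ n := Measure.copy (@lebrow n) (@lebesgue_row R n).

Lemma measurable_dotpl n (w : 'rV[R]_n) : measurable_fun setT (fun x => dotp x w).
Proof.
apply: measurable_sum => i.
by apply: measurable_funM => //; exact: measurable_coord.
Qed.

Definition row_box n (a b : R) : set 'rV[R]_n :=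
  [set x | forall i, a < x 0 i <= b].

Lemma row_boxE n (a b : R) :
  row_box a b = @tuple_of_row R n @^-1` (tuple_box a b).
Proof.
by apply/seteqP; split => x /= h i; have := h i; rewrite tnth_mktuple.
Qed.

Lemma measurable_row_box n (a b : R) : measurable (@row_box n a b).
Proof.
rewrite row_boxE -[X in measurable X]setTI.
by apply: measurable_tuple_of_row => //; exact: measurable_tuple_box.
Qed.

Lemma lebrow_box n (a b : R) : a <= b -> lebrow (@row_box n a b) = ((b - a) ^+ n)%:E.
Proof.
move=> ab; rewrite -lebesgue_tuple_box// row_boxE.
rewrite /lebrow/= /pushforward; congr (lebesgue_tuple n _).
by apply/seteqP; split => x /=; rewrite row_of_tupleK.
Qed.

Lemma row_box_cover n : [set: 'rV[R]_n] = \bigcup_k row_box (- k%:R) k%:R.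
Proof.
apply/seteqP; split => // t _.
pose M := \sum_(i < n) (`|t 0 i| + 1).
have Mt i : `|t 0 i| < M.
  rewrite /M (bigD1 i)//= -addrA ltrDl ltr_wpDr//.
  by apply: sumr_ge0 => j _; rewrite addr_ge0.
exists (Num.truncn M).+1 => //= i.
have h : `|t 0 i| < (Num.truncn M).+1%:R.
  exact: lt_trans (Mt i) (truncnS_gt M).
by move: h; rewrite ltr_norml => /andP[-> /ltW].
Qed.

Lemma sigma_finite_lebrow n : sigma_finite setT (@lebrow n).
Proof.
exists (fun k => @row_box n (- k%:R) k%:R); first exact: row_box_cover.
move=> k; split; first exact: measurable_row_box.
rewrite lebrow_box ?ltry//.
by rewrite (@le_trans _ _ 0)// oppr_le0.
Qed.

HB.instance Definition _ n := Measure_isSigmaFinite.Build _ _ _ (@lebrow n)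
  (@sigma_finite_lebrow n).

Lemma ge0_integral_lebrow n (f : 'rV[R]_n -> \bar R) :
  measurable_fun setT f -> (forall x, 0 <= f x)%E ->
  (\int[@lebrow n]_x f x = \int[@lebt R n]_t f (row_of_tuple t))%E.
Proof.
move=> mf f0.
transitivity (\int[pushforward (@lebt R n) (@row_of_tuple R n)]_x f x)%E => //.
rewrite ge0_integral_pushforward//; exact: measurable_row_of_tuple.
Qed.

Lemma measurable_shift n (c : 'rV[R]_n) : measurable_fun setT (fun x : 'rV[R]_n => x + c).
Proof.
apply: measurable_rowP => i.
rewrite (_ : (fun _ => _) = fun x : 'rV[R]_n => x 0 i + c 0 i).
  by apply: measurable_funD => //; exact: measurable_coord.
by apply/funext => x; rewrite mxE.
Qed.

Lemma ge0_integral_row_shift n (c : 'rV[R]_n) (f : 'rV[R]_n -> \bar R) :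
  measurable_fun setT f -> (forall t, 0 <= f t)%E ->
  (\int[@lebrow n]_t f (t + c)%R = \int[@lebrow n]_t f t)%E.
Proof.
move=> mf f0; rewrite !ge0_integral_lebrow//; last first.
  exact: (measurableT_comp mf (measurable_shift c)).
rewrite -[RHS](ge0_integral_tuple_shift (tuple_of_row c))//.
  apply: eq_integral => t _; congr f; apply/rowP => i.
  by rewrite !mxE !tnth_mktuple.
exact: (measurableT_comp mf (@measurable_row_of_tuple R n)).
Qed.

Lemma measurable_move n (e : 'rV[R]_n) d (T : measurableType d) (f : T -> R)
    (g : T -> 'rV[R]_n) : measurable_fun setT f -> measurable_fun setT g ->
  measurable_fun setT (fun t => g t + f t *: e).
Proof.
move=> mf mg; apply: measurable_rowP => i.
rewrite (_ : (fun _ => _) = fun t => g t 0 i + f t * e 0 i).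
  apply: measurable_funD => //; first exact: (measurableT_comp (measurable_coord i) mg).
  by apply: measurable_funM.
by apply/funext => x; rewrite !mxE.
Qed.

Lemma tonelli_row n (f : 'rV[R]_n * measurableTypeR R -> \bar R) :
  measurable_fun setT f -> (forall z, 0 <= f z)%E ->
  (\int[@lebrow n]_x \int[@lebesgue_measure R]_t f (x, t) =
   \int[@lebesgue_measure R]_t \int[@lebrow n]_x f (x, t))%E.
Proof. by move=> mf f0; exact: fubini_tonelli. Qed.

(* Insert [int_t 1_[0,1](x . b - t) dt = 1], exchange the integrals, and
   translate [x] by [t e]. *)
Lemma ge0_integral_direction n (e b : 'rV[R]_n) (f : 'rV[R]_n -> \bar R) :
  dotp e b = 1 -> measurable_fun setT f -> (forall t, 0 <= f t)%E ->
  (\int[@lebrow n]_x f x = \int[@lebrow n]_x (\int[@lebesgue_measure R]_t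
     (f (x + t *: e)%R * (\1_(`[0, 1]%classic : set R) (dotp x b))%:E)))%E.
Proof.
move=> eb mf f0; set I := \1_ _.
have mI : measurable_fun setT I by exact: measurable_indic.
have I1 c : (\int[@lebesgue_measure R]_t (I (c - t))%:E = 1)%E.
  transitivity (\int[@lebesgue_measure R]_t (\1_(`[c - 1, c]%classic : set R) t)%:E)%E; last first.
    rewrite integral_indic// setIT [LHS](lebesgue_measure_itv `[c - 1, c])/= lte_fin.
    rewrite ltrBlDr ltrDl ltr01.
    by rewrite -EFinB subKr.
  apply: eq_integral => t _; rewrite /I !indicE; congr ((nat_of_bool _)%:R%:E).
  apply/idP/idP => /set_mem/=; rewrite in_itv/= => tc; apply/mem_set => /=;
    rewrite in_itv/=; move: tc; lra.
transitivity (\int[@lebrow n]_x \int[@lebesgue_measure R]_t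
    (f x * (I (dotp x b - t))%:E))%E.
  apply: eq_integral => x _; rewrite ge0_integralZl ?I1 ?mule1//.
  - apply/measurable_EFinP; apply: measurableT_comp => //.
    exact: measurable_funB.
  - by move=> t _; rewrite lee_fin /I indicE.
have mF1 : measurable_fun setT (fun z : 'rV[R]_n * measurableTypeR R =>
    f z.1 * (I (dotp z.1 b - z.2))%:E)%E.
  apply: emeasurable_funM; first exact: measurableT_comp.
  apply/measurable_EFinP; apply: (measurableT_comp mI); apply: measurable_funB => //.
  exact: (measurableT_comp (measurable_dotpl b) measurable_fst).
have F1_ge0 z : (0 <= f z.1 * (I (dotp z.1 b - z.2))%:E)%E.
  by rewrite mule_ge0// lee_fin /I indicE.
rewrite (tonelli_row mF1 F1_ge0).
have mF2 : measurable_fun setT (fun z : 'rV[R]_n * measurableTypeR R =>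
    f (z.1 + z.2 *: e)%R * (I (dotp z.1 b))%:E)%E.
  apply: emeasurable_funM; first by apply: (measurableT_comp mf); exact: measurable_move.
  apply/measurable_EFinP; apply: (measurableT_comp mI).
  exact: (measurableT_comp (measurable_dotpl b) measurable_fst).
have F2_ge0 z : (0 <= f (z.1 + z.2 *: e)%R * (I (dotp z.1 b))%:E)%E.
  by rewrite mule_ge0// lee_fin /I indicE.
rewrite (tonelli_row mF2 F2_ge0).
apply: eq_integral => t _; rewrite /=.
rewrite -(ge0_integral_row_shift (t *: e)).
- by apply: eq_integral => x _; rewrite dotpDl dotpZl eb mulr1 addrK.
- exact: (measurableT_comp mF1 (pair2_measurable t)).
- by move=> x; rewrite mule_ge0// lee_fin /I indicE.
Qed.

End row_measure.

(** * Linear changes of variables, one direction at a time *)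

Section directions.
Context {R : realType} {n : nat}.
Implicit Types (e b x w : 'rV[R]_n) (f g : 'rV[R]_n -> \bar R).

Lemma measurable_line f x e : measurable_fun setT f ->
  measurable_fun setT (fun t : measurableTypeR R => f (x + t *: e)).
Proof. by move=> mf; apply: (measurableT_comp mf); exact: measurable_move. Qed.

(** Reduces an identity of integrals over the space to lines parallel to [e]: the cut-off in
    [ge0_integral_direction] depends on [x] but not on [t], so it leaves the line integral as a
    factor. *)
Lemma eq_integral_direction (c : R) e b f g : 0 <= c ->
  dotp e b = 1 -> measurable_fun setT f -> (forall t, 0 <= f t)%E ->
  measurable_fun setT g -> (forall t, 0 <= g t)%E ->
  (forall x, c%:E * \int[@lebesgue_measure R]_t f (x + t *: e)%R =
             \int[@lebesgue_measure R]_t g (x + t *: e)%R)%E ->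
  (c%:E * \int[@lebrow R n]_x f x = \int[@lebrow R n]_x g x)%E.
Proof.
move=> c0 eb mf f0 mg g0 fg.
have chi0 x : (0 <= (\1_(`[0, 1]%classic : set R) (dotp x b) : R)%:E)%E.
  by rewrite lee_fin indicE.
have mF (h : 'rV[R]_n -> \bar R) : measurable_fun setT h -> measurable_fun setT
    (fun z : 'rV[R]_n * measurableTypeR R =>
    h (z.1 + z.2 *: e)%R * (\1_(`[0, 1]%classic : set R) (dotp z.1 b))%:E)%E.
  move=> mh; apply: emeasurable_funM.
    by apply: (measurableT_comp mh); exact: measurable_move.
  apply/measurable_EFinP.
  apply: (measurableT_comp (@measurable_indic _ _ _ _ _ _)) => //.
  exact: (measurableT_comp (measurable_dotpl b) measurable_fst).
rewrite (ge0_integral_direction eb mf f0) (ge0_integral_direction eb mg g0).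
rewrite -ge0_integralZl//; last 2 first.
- have F0 (z : 'rV[R]_n * measurableTypeR R) : (0 <= f (z.1 + z.2 *: e)%R *
      (\1_(`[0, 1]%classic : set R) (dotp z.1 b))%:E)%E by rewrite mule_ge0.
  exact: (@measurable_fun_fubini_tonelli_F _ _ _ _ _ (@lebesgue_measure R)
    _ (mF f mf) F0).
- by move=> x _; apply: integral_ge0 => t _; rewrite mule_ge0.
apply: eq_integral => x _.
rewrite !ge0_integralZr//.
- by rewrite muleA fg.
- exact: measurable_line.
- exact: measurable_line.
Qed.

(** When [e . b = 1], the linear map fixing [b^⊥] and multiplying [e] by [s]; for [s = -1] an
    oblique reflection. *)
Definition dirscale e b (s : R) x := x + ((s - 1) * dotp x b) *: e.

Lemma measurable_dirscale e b s : measurable_fun setT (dirscale e b s).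
Proof.
apply: (measurable_move e (f := fun x => (s - 1) * dotp x b) (g := id)) => //.
by apply: measurable_funM => //; exact: measurable_dotpl.
Qed.

(** On the line [x + t e] the map acts as [t -> s t + (s - 1) (x . b)], whence the Jacobian [s]. *)
Lemma ge0_integral_dirscale e b (s : R) f : 0 < s -> dotp e b = 1 ->
  measurable_fun setT f -> (forall t, 0 <= f t)%E ->
  (s%:E * \int[@lebrow R n]_x f (dirscale e b s x) = \int[@lebrow R n]_x f x)%E.
Proof.
move=> s0 eb mf f0.
apply: (@eq_integral_direction _ e b _ _ (ltW s0) eb) => //.
  exact: (measurableT_comp mf (measurable_dirscale e b s)).
move=> x.
rewrite -[RHS](ge0_integral_affine ((s - 1) * dotp x b) s0)//; last exact: measurable_line.
congr (_ * _)%E; apply: eq_integral => t _; congr f.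
rewrite /dirscale dotpDl dotpZl eb -!addrA -!scalerDl; congr (_ + _ *: _); ring.
Qed.

(** A line in the direction [w] meets the hyperplane in one point; [eq_integral_direction] with
    [c = 0] carries nullity from the lines to the space. *)
Lemma negligible_hyperplane w : w != 0 ->
  @lebrow R n [set x | dotp x w = 0] = 0%E.
Proof.
move=> w0.
have mH : measurable [set x | dotp x w = 0].
  rewrite -[X in measurable X]setTI; have := @measurable_dotpl R n w.
  by move=> /(_ measurableT [set 0]); apply.
have W : dotp ((dotp w w)^-1 *: w) w = 1 by rewrite dotpZl mulVf// dotp_eq0.
transitivity (\int[@lebrow R n]_x (\1_[set x | dotp x w = 0] x)%:E)%E.
  by rewrite integral_indic// setIT.
rewrite -(@eq_integral_direction 0 _ _ (cst 0%E) _ _ W) ?mul0e//.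
  exact/measurable_EFinP/measurable_indic.
move=> x; rewrite mul0e; apply/esym.
transitivity (\int[@lebesgue_measure R]_t (\1_[set - dotp x w] t)%:E)%E.
  apply: eq_integral => t _; rewrite !indicE; congr ((nat_of_bool _)%:R%:E).
  apply/idP/idP => /set_mem/= h; apply/mem_set => /=; move: h;
    rewrite dotpDl dotpZl W mulr1.
    by move/eqP; rewrite addrC addr_eq0 => /eqP.
  by move=> ->; rewrite subrr.
by rewrite integral_indic// setIT; exact: lebesgue_measure_set1.
Qed.

Variables (E B : 'I_n -> 'rV[R]_n).
Hypothesis dual : forall i j, dotp (E i) (B j) = (i == j)%:R.

(** For dual bases this multiplies the coordinates [x . B i], [i] in [r], by [s] and keeps the
    others; with [r] from [dual_basis] it plays the role of [D_s]. *)
Definition partscale (r : seq 'I_n) (s : R) x :=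
  x + \sum_(i <- r) ((s - 1) * dotp x (B i)) *: E i.

Lemma dotp_partscale r s x j :
  uniq r -> dotp (partscale r s x) (B j) = (if j \in r then s else 1) * dotp x (B j).
Proof.
move=> ur; rewrite dotpDl dotp_suml.
under eq_bigr do rewrite dotpZl dual.
case: ifPn => jr.
  rewrite (bigD1_seq j)//= eqxx big1 ?addr0; last first.
    by move=> i /negbTE ->; rewrite mulr0.
  by rewrite mulr1; ring.
rewrite big_seq big1 ?addr0 ?mul1r// => i ir.
by rewrite (_ : (i == j) = false) ?mulr0//; apply: contraNF jr => /eqP <-.
Qed.

Lemma measurable_partscale r s : measurable_fun setT (partscale r s).
Proof.
apply: measurable_rowP => i.
rewrite (_ : (fun _ => _) = fun x => x 0 i +
   \sum_(j <- r) (s - 1) * dotp x (B j) * E j 0 i).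
  apply: measurable_funD; first exact: measurable_coord.
  apply: measurable_sum => j; apply: measurable_funM => //.
  apply: measurable_funM => //; exact: measurable_dotpl.
by apply/funext => x; rewrite !mxE summxE; under eq_bigr do rewrite mxE.
Qed.

Lemma ge0_integral_partscale r (s : R) f : 0 < s -> uniq r ->
  measurable_fun setT f -> (forall t, 0 <= f t)%E ->
  ((s ^+ size r)%:E * \int[@lebrow R n]_x f (partscale r s x) =
   \int[@lebrow R n]_x f x)%E.
Proof.
move=> s0; elim: r f => [|i r IH] f /=.
  move=> _ mf f0; rewrite mul1e; apply: eq_integral => x _.
  by rewrite /partscale big_nil addr0.
move=> /andP[ir ur] mf f0; rewrite -[RHS](@ge0_integral_dirscale (E i) (B i) s)//; last first.
  by rewrite dual eqxx.
rewrite -[in RHS]IH//; last first.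
  exact: (measurableT_comp mf (measurable_dirscale _ _ s)).
rewrite muleA -EFinM -exprS; congr (_ * _)%E; apply: eq_integral => x _.
congr f; rewrite {1}/dirscale dotp_partscale// (negbTE ir) mul1r /partscale big_cons.
by rewrite -!addrA; congr (_ + _); rewrite addrC.
Qed.

End directions.

Section homothety.
Context {R : realType} {n : nat}.
Implicit Types f : 'rV[R]_n -> \bar R.

Lemma dotp_delta (i j : 'I_n) :
  dotp (delta_mx 0 i : 'rV[R]_n) (delta_mx 0 j) = (i == j)%:R.
Proof.
rewrite /dotp (bigD1 i)//= big1 ?addr0; last first.
  by move=> k /negbTE ki; rewrite !mxE eqxx ki mul0r.
by rewrite !mxE !eqxx mul1r.
Qed.

Lemma dotp_deltar (x : 'rV[R]_n) i : dotp x (delta_mx 0 i) = x 0 i.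
Proof.
rewrite /dotp (bigD1 i)//= big1 ?addr0; last first.
  by move=> k /negbTE ki; rewrite !mxE eqxx ki mulr0.
by rewrite !mxE !eqxx mulr1.
Qed.

Lemma ge0_integral_homothety (s : R) f : 0 < s ->
  measurable_fun setT f -> (forall t, 0 <= f t)%E ->
  ((s ^+ n)%:E * \int[@lebrow R n]_x f (s *: x) = \int[@lebrow R n]_x f x)%E.
Proof.
move=> s0 mf f0.
rewrite -(ge0_integral_partscale dotp_delta s0 (enum_uniq 'I_n) mf f0).
rewrite size_enum_ord; congr (_ * _)%E.
apply: eq_integral => x _; congr f; apply/rowP => i.
rewrite /partscale !mxE summxE big_enum/= (bigD1 i)//= big1 ?addr0; last first.
  by move=> j /negbTE ji; rewrite !mxE eqxx/= eq_sym ji mulr0.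
by rewrite !mxE !eqxx mulr1 dotp_deltar; ring.
Qed.

End homothety.

(** * Measurability of open and closed sets *)

Section borel.
Context {R : realType} {n : nat}.

Definition rat_box (qk : 'rV[rat]_n * nat) : set 'rV[R]_n :=
  [set x | forall i, `|x 0 i - ratr (qk.1 0 i)| < qk.2.+1%:R^-1].

Lemma measurable_rat_box qk : measurable (rat_box qk).
Proof.
rewrite (_ : rat_box qk = \bigcap_(i in @setT 'I_n)
    ((fun x : 'rV[R]_n => x 0 i) @^-1`
      [set t : R | `|t - ratr (qk.1 0 i)| < qk.2.+1%:R^-1])); last first.
  by apply/seteqP; split => x /= h i; have := h i; rewrite /=; exact.
apply: fin_bigcap_measurable => // i _; rewrite -[X in measurable X]setTI.
apply: measurable_coord => //.
rewrite (_ : mkset _ = ball (ratr (qk.1 0 i) : R) (qk.2.+1%:R^-1 : R)).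
  exact: measurable_ball.
by apply/seteqP; split => t; rewrite /ball/= distrC.
Qed.

(** An open set is the union of the countably many rational cubes inside it. *)
Lemma row_open_measurable (U : set 'rV[R]_n) : open U -> measurable U.
Proof.
move=> oU.
rewrite (_ : U = \bigcup_qk (if `[< rat_box qk `<=` U >] then rat_box qk else set0)).
  apply: countable_bigcupT_measurable; first exact: countableP.
  by move=> qk; case: ifPn => // _; exact: measurable_rat_box.
apply/seteqP; split=> [x Ux|x [qk _]]; last first.
  by case: ifPn => // /asboolP; exact.
have /nbhs_ballP[e /= e0 xeU] : nbhs x U by exact: open_nbhs_nbhs.
(* A cube of half-side [1/(k+1) < e/2] whose centre is within [1/(k+1)] of [x] in each coordinate
   contains [x] and stays in the [e]-ball. *)
pose k := Num.truncn (2 / e).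
have k1 : k.+1%:R^-1 < e / 2 :> R.
  by rewrite -[e / 2]invrK invf_div ltf_pV2 ?posrE// ?divr_gt0// truncnS_gt.
have q_ i : {q : rat | `|x 0 i - ratr q| < k.+1%:R^-1 }.
  apply: cid.
  have [q] : exists q : rat, ratr q \in `]x 0 i - k.+1%:R^-1, x 0 i + k.+1%:R^-1[.
    apply: rat_in_itvoo; rewrite ltrD2l; apply: (@lt_trans _ _ 0).
      by rewrite oppr_lt0 invr_gt0.
    by rewrite invr_gt0.
  rewrite in_itv/= => q1; exists q.
  by rewrite distrC ltr_distl.
pose q : 'rV[rat]_n := \row_i sval (q_ i).
exists (q, k) => //; rewrite ifT.
  by move=> i /=; rewrite mxE; exact: (svalP (q_ i)).
apply/asboolP => y yq; apply: xeU; split => // i j; rewrite ord1 /ball/=.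
have := yq j; rewrite /= mxE => yj; have := svalP (q_ j); set r := ratr _ in yj * => xj.
rewrite -(subrK r (x 0 j)) -addrA (le_lt_trans (ler_normD _ _))// [ltRHS]splitr.
by apply: ltrD; [exact: lt_trans k1|rewrite distrC; exact: lt_trans k1].
Qed.

Lemma row_closed_measurable (U : set 'rV[R]_n) : closed U -> measurable U.
Proof.
by move=> cU; rewrite -[U]setCK; apply: measurableC; apply: row_open_measurable; exact: closed_openC.
Qed.
End borel.

(** * Steiner symmetrization along the fibres of a projection *)

Section intervals.
Context {R : realType}.

Definition rconvex (F : set R) := forall a b t, F a -> F b -> 0 <= t <= 1 ->
  F (t * a + (1 - t) * b).

Lemma rconvex_itv (F : set R) a b c : rconvex F -> F a -> F b -> a <= c <= b -> F c.
Proof.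
move=> cF Fa Fb /andP[ac cb].
have [ab|] := ltP a b; last first.
  by move=> ba; rewrite (_ : c = a)//; apply/le_anti; rewrite ac (le_trans cb).
have ba0 : b - a != 0 by rewrite subr_eq0 gt_eqF.
rewrite (_ : c = (b - c) / (b - a) * a + (1 - (b - c) / (b - a)) * b); last first.
  by field.
apply: cF => //; rewrite divr_ge0 ?subr_ge0 ?(ltW ab)//=.
by rewrite ler_pdivrMr ?subr_gt0// mul1r lerD2l lerN2.
Qed.

(** Pairs of points replace chord lengths, which makes Steiner symmetrals algebraic: a convex [F]
    contains the interval between two of its points, and lies in [[inf F, inf F + d]] if no two of
    its points are further apart than [d]. *)
Lemma lt_lebesgue_convex (F : set R) d : measurable F -> rconvex F -> 0 <= d ->
  (d%:E < @lebesgue_measure R F)%E <-> exists a b, [/\ F a, F b & d < b - a].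
Proof.
move=> mF cF d0; split => [dF|[a [b [Fa Fb ab]]]]; last first.
  apply: (@lt_le_trans _ _ (@lebesgue_measure R `[a, b]%classic)).
    rewrite [ltRHS](lebesgue_measure_itv `[a, b]) /= lte_fin ifT ?lte_fin//.
    by rewrite -subr_gt0 (le_lt_trans d0).
  apply: le_measure; rewrite ?inE//.
  by move=> c /=; rewrite in_itv/=; exact: rconvex_itv.
apply/not_existsP => h.
have {}h a b : F a -> F b -> b - a <= d.
  by move=> Fa Fb; rewrite leNgt; apply/negP => dab; apply: (h a); exists b.
have [x Fx] : F !=set0.
  apply/set0P/eqP => F0; move: dF; rewrite F0 measure0 lte_fin.
  by rewrite ltNge d0.
have Fi : has_inf F.
  by split; [exists x|exists (x - d) => y Fy; rewrite lerBlDr -lerBlDl; exact: h].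
have : (@lebesgue_measure R F <= @lebesgue_measure R `[inf F, (inf F + d)%R]%classic)%E.
  apply: le_measure; rewrite ?inE// => y Fy /=; rewrite in_itv/= ge_inf//=; last by case: Fi.
  rewrite -lerBlDr; apply: lb_le_inf; first by exists x.
  by move=> z Fz; rewrite lerBlDr -lerBlDl; exact: h.
rewrite [X in (_ <= X)%E](lebesgue_measure_itv `[inf F, inf F + d]) /= lte_fin.
move=> /(lt_le_trans dF); case: ifPn => _; last by rewrite lte_fin ltNge d0.
by rewrite -EFinB lte_fin addrAC subrr add0r ltxx.
Qed.

(** With [c = x . b] and [m] the length of the chord through [x], possibly infinite: the symmetrized
    chord is as long as the original one. *)
Lemma lebesgue_measure_sym (c : R) (m : \bar R) : (0 <= m)%E ->
  @lebesgue_measure R [set t | ((2 * `|c + t|)%:E < m)%E] = m.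
Proof.
case: m => [m||//]; last first.
  move=> _; rewrite (_ : mkset _ = `]-oo, +oo[%classic); last first.
    apply/seteqP; split => t //= _; exact: ltry.
  by rewrite [LHS](lebesgue_measure_itv `]-oo, +oo[).
rewrite lee_fin => m0.
rewrite (_ : mkset _ = `](- (m / 2) - c), (m / 2 - c)[%classic); last first.
  apply/seteqP; split => t /=; rewrite lte_fin in_itv/= (mulrC 2) -ltr_pdivlMr// ltr_norml;
    move=> /andP[] *; apply/andP; split; lra.
rewrite [LHS](lebesgue_measure_itv `](- (m / 2) - c), (m / 2 - c)[)/= lte_fin.
case: ltP => [_|h].
  by rewrite -EFinB; congr EFin; lra.
by congr EFin; move: h; lra.
Qed.

End intervals.

Section steiner.
Context {R : realType} {n : nat}.
Implicit Types (e b x : 'rV[R]_n) (L C : set 'rV[R]_n).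

Definition vconvex L := forall x y t, L x -> L y -> 0 <= t <= 1 ->
  L (t *: x + (1 - t) *: y).

Lemma eindic_eq (T : Type) (U : Type) (A : set T) (B : set U) u v : (A u <-> B v) ->
  (\1_A u)%:E = (\1_B v)%:E :> \bar R.
Proof.
move=> h; rewrite !indicE; congr ((nat_of_bool _)%:R%:E).
by apply/idP/idP => /set_mem /h /mem_set.
Qed.

Lemma measure_integral_indic d (T : measurableType d)
    (mu : {measure set T -> \bar R}) (A : set T) :
  measurable A -> (mu A = \int[mu]_u (\1_A u)%:E)%E.
Proof. by move=> mA; rewrite integral_indic// setIT. Qed.

Lemma measurable_eindic d (T : measurableType d) (A : set T) :
  measurable A -> measurable_fun setT (fun u => (\1_A u : R)%:E).
Proof. by move=> mA; exact/measurable_EFinP/measurable_indic. Qed.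

Lemma eindic_ge0 (T : Type) (A : set T) u : (0 <= (\1_A u : R)%:E)%E.
Proof. by rewrite lee_fin indicE. Qed.

Lemma measurable_preimage d d' (T : measurableType d) (T' : measurableType d')
    (f : T -> T') (A : set T') : measurable_fun setT f -> measurable A ->
  measurable (f @^-1` A).
Proof. by move=> mf mA; rewrite -[X in measurable X]setTI; exact: mf. Qed.

Definition linesection L x e : set R := [set t | L (x + t *: e)].

Lemma measurable_linesection L x e : measurable L -> measurable (linesection L x e).
Proof.
move=> mL; apply: (@measurable_preimage _ _ (measurableTypeR R) _ (fun t => x + t *: e)) => //.
exact: measurable_move.
Qed.

Lemma rconvex_linesection L x e : vconvex L -> rconvex (linesection L x e).
Proof.
move=> cL s t r Ls Lt r01; have := cL _ _ r Ls Lt r01.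
rewrite /linesection/=; congr L; rewrite !scalerDr !scalerA addrACA -!scalerDl.
by rewrite (_ : r + (1 - r) = 1) ?scale1r//; ring.
Qed.

(* Steiner symmetral of [L] along [e] about the hyperplane [b^⊥], where
   [e . b = 1] but [e] need not be parallel to [b]; chords become open. *)
Definition steiner e b L : set 'rV[R]_n :=
  [set x | ((2 * `|dotp x b|)%:E < @lebesgue_measure R (linesection L x e))%E].

Lemma measurable_steiner e b L : measurable L -> measurable (steiner e b L).
Proof.
move=> mL; rewrite -[steiner _ _ _]setTI; apply: measurable_lte => //.
  apply/measurable_EFinP; apply: measurable_funM => //.
  by apply: measurableT_comp => //; exact: measurable_dotpl.
rewrite (_ : (fun x => _) = fun x => (\int[@lebesgue_measure R]_t
    (\1_L (x + t *: e))%:E)%E); last first.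
  apply/funext => x; rewrite measure_integral_indic//; last exact: measurable_linesection.
apply: (@measurable_fun_fubini_tonelli_F _ _ _ _ _ (@lebesgue_measure R)
    (fun z : 'rV[R]_n * measurableTypeR R => (\1_L (z.1 + z.2 *: e))%:E)).
  by apply: (measurableT_comp (measurable_eindic mL)); exact: measurable_move.
by move=> z; exact: eindic_ge0.
Qed.

Lemma steinerP e b L x : measurable L -> vconvex L ->
  steiner e b L x <-> exists s t,
    [/\ L (x + s *: e), L (x + t *: e) & 2 * `|dotp x b| < t - s].
Proof.
move=> mL cL; apply: lt_lebesgue_convex.
- exact: measurable_linesection.
- exact: rconvex_linesection.
- by rewrite mulr_ge0.
Qed.

(** Convex combinations of the end points of two chords lie on the combined line, at the same
    combination of the two lengths. *)
Lemma vconvex_steiner e b L : measurable L -> vconvex L -> vconvex (steiner e b L).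
Proof.
move=> mL cL x y r /(steinerP _ _ _ mL cL)[s [t [Ls Lt st]]].
move=> /(steinerP _ _ _ mL cL)[s' [t' [Ls' Lt' st']]] r01.
apply/steinerP => //; exists (r * s + (1 - r) * s'), (r * t + (1 - r) * t').
have E a a' : r *: x + (1 - r) *: y + (r * a + (1 - r) * a') *: e =
    r *: (x + a *: e) + (1 - r) *: (y + a' *: e).
  by apply/rowP => i; rewrite !mxE; ring.
rewrite !E; split; [exact: cL|exact: cL|].
have /andP[r0 r1] := r01.
rewrite dotpDl !dotpZl [ltRHS](_ : _ = r * (t - s) + (1 - r) * (t' - s')); last by ring.
apply: (@le_lt_trans _ _ (r * (2 * `|dotp x b|) + (1 - r) * (2 * `|dotp y b|))).
  have := ler_normD (r * dotp x b) ((1 - r) * dotp y b).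
  rewrite !normrM (ger0_norm r0) (@ger0_norm _ (1 - r)) ?subr_ge0//.
  by rewrite -(ler_pM2l (ltr0n R 2)) mulrDr !(mulrCA 2).
(* For [r = 0] strictness of the first chord is lost and that of the second one is used. *)
have [->|r_neq0] := eqVneq r 0; first by rewrite !mul0r !add0r subr0 !mul1r.
apply: ltr_leD; first by rewrite ltr_pM2l// lt_neqAle eq_sym r_neq0.
by apply: ler_wpM2l; [rewrite subr_ge0|exact: ltW].
Qed.

Lemma steinerN e b L : measurable L -> vconvex L -> (forall x, L x -> L (- x)) ->
  forall x, steiner e b L x -> steiner e b L (- x).
Proof.
move=> mL cL sL x /(steinerP _ _ _ mL cL)[s [t [Ls Lt st]]].
apply/steinerP => //; exists (- t), (- s).
have E a : - x + (- a) *: e = - (x + a *: e) by rewrite scaleNr opprD.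
rewrite !E dotpNl normrN; split; [exact: sL|exact: sL|].
by rewrite opprK addrC.
Qed.

Lemma steiner_flip e b L : dotp e b = 1 -> measurable L -> vconvex L ->
  forall x, steiner e b L x -> steiner e b L (dirscale e b (-1) x).
Proof.
move=> eb mL cL x /(steinerP _ _ _ mL cL)[s [t [Ls Lt st]]].
apply/steinerP => //; exists (s + 2 * dotp x b), (t + 2 * dotp x b).
have E a : dirscale e b (-1) x + (a + 2 * dotp x b) *: e = x + a *: e.
  by apply/rowP => i; rewrite !mxE; ring.
rewrite !E; split => //.
rewrite dotpDl dotpZl eb (_ : _ + _ = - dotp x b); last by ring.
by rewrite normrN; move: st; lra.
Qed.

(** The reflection along [e'] maps lines parallel to [e] to such lines and preserves [x . b], so
    symmetrizing along [e] keeps a symmetry gained before. *)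
Lemma steiner_flip_ortho e b e' b' L : dotp e b' = 0 -> dotp e' b = 0 ->
  measurable L -> vconvex L ->
  (forall x, L x -> L (dirscale e' b' (-1) x)) ->
  forall x, steiner e b L x -> steiner e b L (dirscale e' b' (-1) x).
Proof.
move=> eb' e'b mL cL fL x /(steinerP _ _ _ mL cL)[s [t [Ls Lt st]]].
apply/steinerP => //; exists s, t.
have E a : dirscale e' b' (-1) x + a *: e = dirscale e' b' (-1) (x + a *: e).
  by rewrite /dirscale dotpDl dotpZl eb' mulr0 addr0 addrAC.
rewrite !E; split; [exact: fL|exact: fL|].
by rewrite dotpDl dotpZl e'b mulr0 addr0.
Qed.

(** On each line parallel to [e] the chord is replaced by one of equal length, and [C] contains the
    line or misses it. *)
Lemma steiner_measure e b L C : dotp e b = 1 -> measurable L -> measurable C ->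
  (forall x t, C x -> C (x + t *: e)) ->
  @lebrow R n (C `&` steiner e b L) = @lebrow R n (C `&` L).
Proof.
move=> eb mL mC CC.
have mS := measurable_steiner e b mL.
have mCS := measurableI _ _ mC mS; have mCL := measurableI _ _ mC mL.
rewrite !measure_integral_indic//.
rewrite -[LHS]mul1e; apply: (eq_integral_direction (c := 1) _ eb) => //;
  do ?[exact: measurable_eindic].
move=> x; rewrite mul1e.
have [Cx|Cx] := pselect (C x); last first.
  rewrite !integral0_eq// => t _; rewrite indicE memNset//= => -[Cxt _]; apply: Cx;
    by rewrite -[x](addrK (t *: e)) -scaleNr; exact: CC.
transitivity (\int[@lebesgue_measure R]_t (\1_[set t |
    ((2 * `|dotp x b + t|)%:E < @lebesgue_measure R (linesection L x e))%E] t)%:E)%E.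
  apply: eq_integral => t _; apply: eindic_eq; rewrite /steiner/=.
  have -> : @lebesgue_measure R (linesection L (x + t *: e) e) =
      @lebesgue_measure R (linesection L x e).
    have mls y := measurable_linesection y e mL.
    rewrite (measure_integral_indic (@lebesgue_measure R) (mls (x + t *: e))).
    rewrite (measure_integral_indic (@lebesgue_measure R) (mls x)) -[RHS](ge0_integral_shift t).
    - apply: eq_integral => s _; apply: eindic_eq.
      by rewrite /linesection/= -addrA -scalerDl addrC [s + t]addrC addrC.
    - exact: measurable_eindic.
    - by move=> s; exact: eindic_ge0.
  by rewrite dotpDl dotpZl eb mulr1; split => [[]//|h]; split => //; exact: CC.
transitivity (\int[@lebesgue_measure R]_t (\1_(linesection L x e) t)%:E)%E; last first.
  apply: eq_integral => t _; apply: eindic_eq => /=.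
  by split => [h|[]//]; split => //; exact: CC.
rewrite -!measure_integral_indic//; last 2 first.
- exact: measurable_linesection.
- rewrite -[X in measurable X]setTI; apply: measurable_lte => //.
  apply/measurable_EFinP; apply: measurable_funM => //.
  by apply: measurableT_comp => //; exact: measurable_funD.
by apply: lebesgue_measure_sym; exact: measure_ge0.
Qed.

End steiner.

Section fiber.
Context {R : realType} {n : nat}.
Variables (E B : 'I_n -> 'rV[R]_n).
Hypothesis dual : forall i j, dotp (E i) (B j) = (i == j)%:R.
Implicit Types (r q : seq 'I_n) (L C : set 'rV[R]_n) (x : 'rV[R]_n).

Lemma partscale_line r s x i t : i \notin r ->
  partscale E B r s (x + t *: E i) = partscale E B r s x + t *: E i.
Proof.
move=> ir; rewrite /partscale -!addrA; congr (_ + _); rewrite addrC; congr (_ + _).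
rewrite big_seq [RHS]big_seq; apply: eq_bigr => j jr.
rewrite dotpDl dotpZl dual (_ : (i == j) = false) ?mulr0 ?addr0//.
by apply: contraNF ir => /eqP ->.
Qed.

Lemma dotp_partscale_notin r s x i : i \notin r ->
  dotp (partscale E B r s x) (B i) = dotp x (B i).
Proof.
move=> ir; rewrite dotpDl dotp_suml big_seq big1 ?addr0// => j jr.
rewrite dotpZl dual (_ : (j == i) = false) ?mulr0//.
by apply: contraNF ir => /eqP <-.
Qed.

(** Symmetrize along the [E i] in turn. As [partscale E B r s] commutes with translations along
    [E i] and preserves [x . B i] for [i] in [q], the symmetral of a preimage is the preimage of the
    symmetral; hence the last conjunct. *)
Lemma steiner_all r q L : measurable L -> vconvex L -> (forall x, L x -> L (- x)) ->
  uniq q -> ~~ has (mem r) q ->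
  exists L', [/\ [/\ measurable L', vconvex L' & forall x, L' x -> L' (- x)],
    forall i, i \in q -> forall x, L' x -> L' (dirscale (E i) (B i) (-1) x) &
    forall C, measurable C ->
      (forall i, i \in q -> forall x t, C x -> C (x + t *: E i)) ->
      @lebrow R n (C `&` L') = @lebrow R n (C `&` L) /\
      forall s, @lebrow R n (C `&` partscale E B r s @^-1` L') =
                @lebrow R n (C `&` partscale E B r s @^-1` L)].
Proof.
move=> mL cL sL; elim: q => [_ _|i q IH /= /andP[iq uq]].
  by exists L; split.
rewrite negb_or => /andP[ir qr]; have [L1 [[mL1 cL1 sL1] fL1 vL1]] := IH uq qr.
have Eii : dotp (E i) (B i) = 1 by rewrite dual eqxx.
exists (steiner (E i) (B i) L1); split.
- by split; [exact: measurable_steiner|exact: vconvex_steiner|exact: steinerN].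
- move=> j; rewrite inE => /orP[/eqP ->|jq]; first exact: steiner_flip.
  have /negbTE ij : i != j by apply: contraNneq iq => ->.
  apply: steiner_flip_ortho => //; [by rewrite dual ij|by rewrite dual eq_sym ij|].
  exact: fL1.
- move=> C mC CC.
  have Ci x t : C x -> C (x + t *: E i) by apply: CC; rewrite mem_head.
  have [vC vsC] : _ := vL1 C mC (fun j jq => CC j (mem_behead (s := i :: q) jq)).
  rewrite steiner_measure//; split => // s.
  rewrite -vsC -(steiner_measure (e := E i) (b := B i) (L := _ @^-1` L1))//; last first.
    by apply: measurable_preimage => //; exact: measurable_partscale.
  have lsE x : linesection (partscale E B r s @^-1` L1) x (E i) =
      linesection L1 (partscale E B r s x) (E i).
    by apply/seteqP; split => t; rewrite /linesection/= partscale_line.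
  congr (lebrow (_ `&` _)); apply/seteqP; split => x; rewrite /steiner/= lsE;
    by rewrite dotp_partscale_notin.
Qed.

Lemma partscale_flip q L : uniq q ->
  (forall i, i \in q -> forall x, L x -> L (dirscale (E i) (B i) (-1) x)) ->
  forall x, L x -> L (partscale E B q (-1) x).
Proof.
elim: q => [_ _ x Lx|i q IH /= /andP[iq uq] fL x Lx].
  by rewrite /partscale big_nil addr0.
have := fL i (mem_head _ _) _ (IH uq (fun j jq => fL j (mem_behead (s := i :: q) jq)) x Lx).
congr L; rewrite {1}/dirscale dotp_partscale_notin// /partscale big_cons.
by rewrite -!addrA; congr (_ + _); rewrite addrC.
Qed.

Variables (r q : seq 'I_n).
Hypothesis uq : uniq q.
Hypothesis rq : ~~ has (mem r) q.
Hypothesis full : forall x, x = \sum_(i <- r) dotp x (B i) *: E i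
                             + \sum_(i <- q) dotp x (B i) *: E i.

(* After symmetrization along all [E i], [i] in [q], the set contains with [x]
   also the reflection [y] of [x] in these directions, hence by symmetry [- y];
   [partscale E B r s x] is a convex combination of [x] and [- y]. *)
Lemma fiber_le L C s : measurable L -> vconvex L -> (forall x, L x -> L (- x)) ->
  measurable C -> (forall i, i \in q -> forall x t, C x -> C (x + t *: E i)) ->
  0 <= s <= 1 ->
  (@lebrow R n (C `&` L) <= @lebrow R n (C `&` partscale E B r s @^-1` L))%E.
Proof.
move=> mL cL sL mC CC /andP[s0 s1].
have [L' [[mL' cL' sL'] fL' vL']] := steiner_all mL cL sL uq rq.
have [<- <-] := vL' C mC CC; apply: le_measure; rewrite ?inE.
- exact: measurableI.
- apply: measurableI => //.
  by apply: measurable_preimage => //; exact: measurable_partscale.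
apply: setIS => x L'x /=.
(* For [x = x_r + x_q] the reflection is [x_r - x_q]; the weights [(1 + s)/2] on [x] and [(1 - s)/2]
   on [x_q - x_r] give [s x_r + x_q]. *)
have := cL' _ _ ((1 + s) / 2) L'x (sL' _ (partscale_flip uq fL' L'x)).
have -> : (1 + s) / 2 *: x + (1 - (1 + s) / 2) *: - partscale E B q (-1) x =
    partscale E B r s x.
  rewrite /partscale.
  under eq_bigr do rewrite -scalerA; rewrite -scaler_sumr.
  under [X in _ = _ + X]eq_bigr do rewrite -scalerA; rewrite -scaler_sumr.
  set Sq := \sum_(i <- q) _; set Sr := \sum_(i <- r) _.
  have := full x; rewrite -/Sq -/Sr; move: Sq Sr => Sq Sr ->.
  by apply/rowP => i; rewrite !mxE; field.
by apply; apply/andP; split; [rewrite divr_ge0// addr_ge0|rewrite ler_pdivrMr//; lra].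
Qed.

End fiber.

(** * The inequality for the weight [|x . w|^-p] *)

Section layer_cake.
Context {R : realType} {n : nat}.
Local Notation lam := (@lebrow R n).
Implicit Types (A C : set 'rV[R]_n) (F : 'rV[R]_n -> R).

Lemma integral_indicE d (T : measurableType d) (mu : {measure set T -> \bar R})
    (D : set T) (f : T -> \bar R) :
  (\int[mu]_(x in D) f x = \int[mu]_x (f x * (\1_D x)%:E))%E.
Proof. by rewrite integral_mkcond epatch_indic. Qed.

Lemma measurable_le_fun F (c : R) : measurable_fun setT F ->
  measurable [set x | c <= F x].
Proof.
move=> mF; rewrite -[X in measurable X]setTI.
rewrite (_ : mkset _ = F @^-1` `[c, +oo[); first exact: mF.
by apply/seteqP; split => x /=; rewrite in_itv/= andbT.
Qed.

(** Indicator of the region under the graph of [F] over [A]: its sections at fixed [x] are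
    intervals, those at fixed [t] superlevel sets. *)
Let lc_fun A F (z : 'rV[R]_n * measurableTypeR R) : \bar R :=
  (\1_(A `*` setT `&` [set z | 0 < z.2 <= F z.1]) z)%:E.

Let measurable_lc_fun A F : measurable A -> measurable_fun setT F ->
  measurable_fun setT (lc_fun A F).
Proof.
move=> mA mF; apply: measurable_eindic; apply: measurableI; first exact: measurableX.
rewrite (_ : mkset _ = [set z | (0 < z.2 :> R)] `&` [set z | z.2 <= F z.1]); last first.
  by apply/seteqP; split => z /= => [/andP[]//|[-> ->]].
apply: measurableI.
  rewrite (_ : mkset _ = setT `*` `]0, +oo[%classic); first exact: measurableX.
  by apply/seteqP; split => z /=; rewrite in_itv/= andbT => //; case.
rewrite -[X in measurable X]setTI; under eq_set do rewrite -subr_ge0.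
have mD : measurable_fun setT (fun z : 'rV[R]_n * measurableTypeR R => F z.1 - z.2).
  by apply: measurable_funB => //; apply: measurableT_comp.
rewrite (_ : mkset _ = (fun z : 'rV[R]_n * measurableTypeR R => F z.1 - z.2) @^-1` `[0, +oo[).
  exact: mD.
by apply/seteqP; split => x /=; rewrite in_itv/= andbT.
Qed.

Let lc_fun_ge0 A F z : (0 <= lc_fun A F z)%E.
Proof. exact: eindic_ge0. Qed.

Lemma layer_cake A F : measurable A -> measurable_fun setT F -> (forall x, 0 <= F x) ->
  (\int[lam]_(x in A) (F x)%:E =
   \int[@lebesgue_measure R]_t \int[lam]_x lc_fun A F (x, t))%E.
Proof.
move=> mA mF F0.
rewrite -(tonelli_row (measurable_lc_fun mA mF) (lc_fun_ge0 A F)).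
rewrite integral_indicE; apply: eq_integral => x _.
have [Ax|Ax] := pselect (A x); last first.
  rewrite indicE memNset// mule0 integral0_eq// => t _.
  by rewrite /lc_fun indicE memNset//= => -[[]].
rewrite indicE mem_set// mule1.
transitivity (\int[@lebesgue_measure R]_t (\1_(`]0, F x]%classic : set R) t)%:E)%E.
  rewrite integral_indic// setIT [RHS](lebesgue_measure_itv `]0, F x]) /= lte_fin.
  case: ltP => [_|Fx]; first by rewrite -EFinB subr0.
  by congr EFin; apply/le_anti; rewrite Fx F0.
apply: eq_integral => t _; apply: eindic_eq; rewrite /= in_itv/=.
by split => [|[]].
Qed.

Lemma layer_cake_le A A' F F' : measurable A -> measurable A' ->
  measurable_fun setT F -> measurable_fun setT F' ->
  (forall x, 0 <= F x) -> (forall x, 0 <= F' x) ->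
  (forall t : R, (0 < t)%R -> lam (A `&` [set x | (t <= F x)%R]) <=
                      lam (A' `&` [set x | (t <= F' x)%R]))%E ->
  (\int[lam]_(x in A) (F x)%:E <= \int[lam]_(x in A') (F' x)%:E)%E.
Proof.
move=> mA mA' mF mF' F0 F'0 h; rewrite (layer_cake mA mF F0) (layer_cake mA' mF' F'0).
apply: ge0_le_integral => //.
- by move=> t _; apply: integral_ge0 => x _; exact: lc_fun_ge0.
- exact: (measurable_fun_fubini_tonelli_G (m1 := lam) _
    (measurable_lc_fun mA mF) (lc_fun_ge0 A F)).
- exact: (measurable_fun_fubini_tonelli_G (m1 := lam) _
    (measurable_lc_fun mA' mF') (lc_fun_ge0 A' F')).
move=> t _; have [t0|t0] := ltP 0 t; last first.
  rewrite integral0_eq; first by apply: integral_ge0 => x _; exact: lc_fun_ge0.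
  by move=> x _; rewrite /lc_fun indicE memNset//= => -[_ /andP[]]; rewrite ltNge t0.
have E D G : measurable D -> measurable_fun setT G ->
    (\int[lam]_x lc_fun D G (x, t) = lam (D `&` [set x | (t <= G x)%R]))%E.
  move=> mD mG; rewrite measure_integral_indic; last first.
    by apply: measurableI => //; exact: measurable_le_fun.
  apply: eq_integral => x _; apply: eindic_eq => /=; rewrite t0/=.
  by split => -[]; tauto.
by rewrite !E//; exact: h.
Qed.

Lemma layer_cake_bound A F (H : R -> \bar R) : measurable A ->
  measurable_fun setT F -> (forall x, 0 <= F x) ->
  measurable_fun setT H -> (forall t, 0 <= H t)%E ->
  (forall t : R, (0 < t)%R -> lam (A `&` [set x | (t <= F x)%R]) <= H t)%E ->
  (\int[lam]_(x in A) (F x)%:E <= \int[@lebesgue_measure R]_t H t)%E.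
Proof.
move=> mA mF F0 mH H0 h; rewrite (layer_cake mA mF F0).
apply: ge0_le_integral => //.
- by move=> t _; apply: integral_ge0 => x _; exact: lc_fun_ge0.
- exact: (measurable_fun_fubini_tonelli_G (m1 := lam) _
    (measurable_lc_fun mA mF) (lc_fun_ge0 A F)).
move=> t _; have [t0|t0] := ltP 0 t; last first.
  rewrite integral0_eq// => x _.
  by rewrite /lc_fun indicE memNset//= => -[_ /andP[]]; rewrite ltNge t0.
apply: le_trans (h t t0); rewrite measure_integral_indic; last first.
  by apply: measurableI => //; exact: measurable_le_fun.
rewrite le_eqVlt; apply/orP; left; apply/eqP.
apply: eq_integral => x _; apply: eindic_eq => /=; rewrite t0/=.
by split => -[]; tauto.
Qed.

End layer_cake.

Section weighted_fiber.
Context {R : realType} {n : nat}.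
Local Notation lam := (@lebrow R n).
Implicit Types (p : R).

Definition rpow p (t : R) : R := `|t| `^ (- p).

Lemma rpow_ge0 p t : 0 <= rpow p t.
Proof. exact: powR_ge0. Qed.

Lemma rpowM p a b : rpow p (a * b) = rpow p a * rpow p b.
Proof. by rewrite /rpow normrM powRM. Qed.

Lemma rpowN p t : rpow p (- t) = rpow p t.
Proof. by rewrite /rpow normrN. Qed.

Lemma rpow0 p : p != 0 -> rpow p 0 = 0.
Proof. by move=> p0; rewrite /rpow normr0 powR0// oppr_eq0. Qed.

Lemma measurable_rpow p : measurable_fun setT (rpow p).
Proof.
by apply: (measurableT_comp (measurable_powR _)).
Qed.

Lemma ler_rpow p a b : 0 <= p -> 0 < `|a| -> `|a| <= `|b| -> rpow p b <= rpow p a.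
Proof.
move=> p0 a0 ab; rewrite /rpow !powRN lef_pV2 ?posrE ?powR_gt0 ?(lt_le_trans a0)//.
by apply: ge0_ler_powR => //; rewrite nnegrE.
Qed.

(* The point [0] is added by hand because [rpow p 0 = 0]. *)
Definition unimod p (c : R) : set R := [set t | t = 0 \/ c <= rpow p t].

Lemma rconvex_unimod p c : 0 <= p -> rconvex (unimod p c).
Proof.
move=> p0 a b t Ua Ub /andP[t0 t1].
have [->|ne] := eqVneq (t * a + (1 - t) * b) 0; first by left.
right.
have key d : `|t * a + (1 - t) * b| <= `|d| -> unimod p c d ->
    c <= rpow p (t * a + (1 - t) * b).
  move=> le; have d0 : 0 < `|d| by rewrite (lt_le_trans _ le)// normr_gt0.
  case=> [dE|/le_trans]; first by move: d0; rewrite dE normr0 ltxx.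
  by apply; apply: ler_rpow => //; rewrite normr_gt0.
have le : `|t * a + (1 - t) * b| <= t * `|a| + (1 - t) * `|b|.
  rewrite (le_trans (ler_normD _ _))// !normrM (ger0_norm t0).
  by rewrite (@ger0_norm _ (1 - t)) ?subr_ge0.
have t1' : 0 <= 1 - t by rewrite subr_ge0.
have [ab|/ltW ba] := leP `|a| `|b|.
  apply: (key b) => //; rewrite (le_trans le)//.
  rewrite [leRHS](_ : _ = t * `|b| + (1 - t) * `|b|); last by ring.
  by rewrite lerD2r; exact: ler_wpM2l.
apply: (key a) => //; rewrite (le_trans le)//.
rewrite [leRHS](_ : _ = t * `|a| + (1 - t) * `|a|); last by ring.
by rewrite lerD2l; exact: ler_wpM2l.
Qed.

Variables (E B : 'I_n -> 'rV[R]_n).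
Hypothesis dual : forall i j, dotp (E i) (B j) = (i == j)%:R.
Variables (r q : seq 'I_n).
Hypotheses (ur : uniq r) (uq : uniq q) (rq : ~~ has (mem r) q).
Hypothesis full : forall x, x = \sum_(i <- r) dotp x (B i) *: E i
                             + \sum_(i <- q) dotp x (B i) *: E i.
Local Notation D := (partscale E B r).

Lemma negligible_partscale (A : set 'rV[R]_n) s : 0 < s -> measurable A ->
  lam A = 0%E -> lam (D s @^-1` A) = 0%E.
Proof.
move=> s0 mA A0.
have mDA : measurable (D s @^-1` A).
  by apply: measurable_preimage => //; exact: measurable_partscale.
have IA : (\int[lam]_x (\1_A x : R)%:E = 0)%E.
  by rewrite -A0; exact/esym/(measure_integral_indic lam mA).
have IDA : (\int[lam]_x (\1_A (D s x) : R)%:E = lam (D s @^-1` A))%E.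
  exact/esym/(measure_integral_indic lam mDA).
have := ge0_integral_partscale dual s0 ur (measurable_eindic mA) (@eindic_ge0 R _ A).
rewrite IA IDA.
move/eqP; rewrite mule_eq0 => /orP[|/eqP//].
by rewrite eqe expf_eq0 gt_eqF ?andbF.
Qed.

(** Layer cake, with [fiber_le] for each slice [L /\ {c <= |x . w|^-p}], [c > 0]. The slice is made
    convex by putting back its points on [w^⊥], where [rpow] is [0] by convention; this hyperplane
    and its preimage under [D s] are null. *)
Lemma weighted_fiber_le p (w : 'rV[R]_n) (L C : set 'rV[R]_n) (s : R) : 0 < p -> w != 0 ->
  measurable L -> vconvex L -> (forall x, L x -> L (- x)) ->
  measurable C -> (forall i, i \in q -> forall x t, C x -> C (x + t *: E i)) ->
  0 < s <= 1 ->
  (\int[lam]_(x in C `&` L) (rpow p (dotp x w))%:E <=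
   \int[lam]_(x in C `&` D s @^-1` L) (rpow p (dotp (D s x) w))%:E)%E.
Proof.
move=> p0 w0 mL cL sL mC CC /andP[s0 s1].
have mrp : measurable_fun setT (fun x => rpow p (dotp x w)).
  exact: (measurableT_comp (measurable_rpow p) (measurable_dotpl w)).
have mD : measurable_fun setT (D s) by exact: measurable_partscale.
have mDL : measurable (D s @^-1` L) by exact: measurable_preimage.
have mH : measurable [set x | dotp x w = 0].
  apply: (@measurable_preimage _ _ _ _ (fun x => dotp x w) [set 0]) => //.
  exact: measurable_dotpl.
apply: layer_cake_le.
- exact: measurableI.
- exact: measurableI.
- by [].
- exact: (measurableT_comp mrp mD).
- by move=> x; exact: rpow_ge0.
- by move=> x; exact: rpow_ge0.
move=> c c0.
pose L' := L `&` [set x | unimod p c (dotp x w)].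
have mU : measurable [set x | unimod p c (dotp x w)].
  rewrite (_ : mkset _ = [set x | dotp x w = 0] `|` [set x | c <= rpow p (dotp x w)]).
    by apply: measurableU => //; exact: measurable_le_fun.
  by apply/seteqP; split.
have mL' : measurable L' by exact: measurableI.
have cL' : vconvex L'.
  move=> x y t [Lx Ux] [Ly Uy] t01; split; first exact: cL.
  by rewrite /= dotpDl !dotpZl; apply: rconvex_unimod => //; exact: ltW.
have sL' x : L' x -> L' (- x).
  case=> Lx Ux; split; first exact: sL.
  rewrite /= dotpNl; case: Ux => [->|h]; first by left; rewrite oppr0.
  by right; rewrite rpowN.
have s01 : 0 <= s <= 1 by rewrite (ltW s0).
have := fiber_le dual uq rq full mL' cL' sL' mC CC s01.
move=> h; apply: (@le_trans _ _ (lam (C `&` L'))).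
  apply: le_measure; rewrite ?inE.
  - by apply: measurableI; [exact: measurableI|exact: measurable_le_fun].
  - exact: measurableI.
  - by move=> x [[Cx Lx] h']; split => //; split => //; right.
apply: (le_trans h).
have mF : measurable [set x | c <= rpow p (dotp (D s x) w)].
  by apply: measurable_le_fun; exact: (measurableT_comp mrp mD).
apply: (@le_trans _ _ (lam ((C `&` D s @^-1` L) `&` [set x | c <= rpow p (dotp (D s x) w)]
   `|` D s @^-1` [set x | dotp x w = 0]))).
  apply: le_measure; rewrite ?inE.
  - by apply: measurableI => //; exact: measurable_preimage.
  - apply: measurableU; last exact: measurable_preimage.
    by apply: measurableI => //; exact: measurableI.
  - by move=> x [Cx [Lx [U|U]]]; [right|left].
rewrite (le_trans (measureU2 _ _ _))//.
- by apply: measurableI => //; exact: measurableI.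
- exact: measurable_preimage.
- by rewrite [X in (_ + X)%E]negligible_partscale ?adde0//; exact: negligible_hyperplane.
Qed.

End weighted_fiber.

Lemma tonelli_rows {R : realType} {n m} (f : 'rV[R]_n * 'rV[R]_m -> \bar R) :
  measurable_fun setT f -> (forall z, 0 <= f z)%E ->
  (\int[@lebrow R n]_x \int[@lebrow R m]_y f (x, y) =
   \int[@lebrow R m]_y \int[@lebrow R n]_x f (x, y))%E.
Proof. by move=> mf f0; exact: fubini_tonelli. Qed.

Section potential.
Context {R : realType} {n : nat}.
Local Notation lam := (@lebrow R n).
Variables (p : R) (gam : 'rV[R]_n -> R).
Hypotheses (mgam : measurable_fun setT gam) (gam_ge0 : forall y, 0 <= gam y).

(** The [W] of the overview. Integrating over the whole space, with [normalize y] in the kernel,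
    makes Tonelli for Lebesgue measure available. *)
Definition potential (x : 'rV[R]_n) : \bar R :=
  (\int[lam]_y (gam y * rpow p (dotp x (normalize y)))%:E)%E.

Lemma potential_ge0 x : (0 <= potential x)%E.
Proof. by apply: integral_ge0 => y _; rewrite lee_fin mulr_ge0// rpow_ge0. Qed.

Let ker (phi : 'rV[R]_n -> 'rV[R]_n) (z : 'rV[R]_n * 'rV[R]_n) : \bar R :=
  (gam z.2 * rpow p (dotp (phi z.1) (normalize z.2)))%:E.

Lemma measurable_dotp2 d (T : measurableType d) (f g : T -> 'rV[R]_n) :
  measurable_fun setT f -> measurable_fun setT g ->
  measurable_fun setT (fun t => dotp (f t) (g t)).
Proof.
move=> mf mg; apply: measurable_sum => i; apply: measurable_funM.
  exact: (measurableT_comp (measurable_coord i) mf).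
exact: (measurableT_comp (measurable_coord i) mg).
Qed.

Let measurable_ker phi : measurable_fun setT phi -> measurable_fun setT (ker phi).
Proof.
move=> mphi; apply/measurable_EFinP; apply: measurable_funM.
  exact: measurableT_comp.
apply: (measurableT_comp (measurable_rpow p)); apply: measurable_dotp2.
  exact: measurableT_comp.
exact: (measurableT_comp (@measurable_normalize R n)).
Qed.

Let ker_ge0 phi z : (0 <= ker phi z)%E.
Proof. by rewrite lee_fin mulr_ge0// rpow_ge0. Qed.

Lemma measurable_potential : measurable_fun setT potential.
Proof.
exact: (measurable_fun_fubini_tonelli_F (m2 := lam) _
  (measurable_ker (@measurable_id _ _ setT)) (ker_ge0 id)).
Qed.

Lemma potentialZ s x : 0 < s -> potential (s *: x) = ((rpow p s)%:E * potential x)%E.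
Proof.
move=> s0; rewrite /potential -ge0_integralZl//.
- by apply: eq_integral => y _; rewrite dotpZl rpowM -EFinM mulrCA.
- exact: (measurableT_comp (measurable_ker (@measurable_id _ _ setT)) (pair1_measurable x)).
- by move=> y _; exact: ker_ge0 id (x, y).
- by rewrite lee_fin rpow_ge0.
Qed.

(** Reduces inequalities for [W] to inequalities for [|x . w|^-p] with one fixed
    [w = normalize y]. *)
Lemma integral_potential (A : set 'rV[R]_n) (phi : 'rV[R]_n -> 'rV[R]_n) :
  measurable A -> measurable_fun setT phi ->
  (\int[lam]_(x in A) potential (phi x) =
   \int[lam]_y ((gam y)%:E * \int[lam]_(x in A) (rpow p (dotp (phi x) (normalize y)))%:E))%E.
Proof.
move=> mA mphi; rewrite integral_indicE.
pose f (z : 'rV[R]_n * 'rV[R]_n) := (ker phi z * (\1_A z.1)%:E)%E.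
have mf : measurable_fun setT f.
  apply: emeasurable_funM; first exact: measurable_ker.
  exact: (measurableT_comp (measurable_eindic mA) measurable_fst).
have f0 z : (0 <= f z)%E by rewrite mule_ge0// ?eindic_ge0//; exact: ker_ge0.
have mk x : measurable_fun setT (fun y => ker phi (x, y)).
  exact: (measurableT_comp (measurable_ker mphi) (pair1_measurable x)).
transitivity (\int[lam]_x \int[lam]_y f (x, y))%E.
  apply: eq_integral => x _; rewrite /f/= ge0_integralZr//.
rewrite (tonelli_rows mf f0).
apply: eq_integral => y _.
rewrite [X in (_ * X)%E]integral_indicE -ge0_integralZl//.
- by apply: eq_integral => x _; rewrite /f/ker/= EFinM muleA.
- apply: emeasurable_funM; last exact: measurable_eindic.
  apply/measurable_EFinP; apply: (measurableT_comp (measurable_rpow p)).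
  exact: (measurableT_comp (measurable_dotpl (normalize y)) mphi).
- by move=> x _; rewrite mule_ge0// ?eindic_ge0// lee_fin rpow_ge0.
- by rewrite lee_fin.
Qed.

Lemma measurable_integral_rpow_dotp (A : set 'rV[R]_n) (phi psi : 'rV[R]_n -> 'rV[R]_n) :
  measurable A -> measurable_fun setT phi -> measurable_fun setT psi ->
  measurable_fun setT (fun y : 'rV[R]_n => \int[lam]_(x in A) (rpow p (dotp (phi x) (psi y)))%:E)%E.
Proof.
move=> mA mphi mpsi; pose f (z : 'rV[R]_n * 'rV[R]_n) : \bar R :=
  ((rpow p (dotp (phi z.1) (psi z.2)))%:E * (\1_A z.1)%:E)%E.
have mf : measurable_fun setT f.
  apply: emeasurable_funM; last exact: (measurableT_comp (measurable_eindic mA) measurable_fst).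
  apply/measurable_EFinP; apply: (measurableT_comp (measurable_rpow p)); apply: measurable_dotp2.
    exact: measurableT_comp.
  exact: (measurableT_comp mpsi).
have f0 z : (0 <= f z)%E by rewrite mule_ge0// ?eindic_ge0// lee_fin rpow_ge0.
rewrite (_ : (fun y => _) = fun y => \int[lam]_x f (x, y))%E; last first.
  by apply/funext => y; rewrite integral_indicE.
exact: (measurable_fun_fubini_tonelli_G (m1 := lam) _ mf f0).
Qed.

Lemma measurable_integral_rpow (A : set 'rV[R]_n) (phi : 'rV[R]_n -> 'rV[R]_n) :
  measurable A -> measurable_fun setT phi ->
  measurable_fun setT (fun y : 'rV[R]_n =>
    \int[lam]_(x in A) (rpow p (dotp (phi x) (normalize y)))%:E)%E.
Proof.
by move=> mA mphi; apply: measurable_integral_rpow_dotp => //; exact: measurable_normalize.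
Qed.

End potential.

Lemma partscaleZ {R : realType} {n : nat} (E B : 'I_n -> 'rV[R]_n) r s a x :
  partscale E B r s (a *: x) = a *: partscale E B r s x.
Proof.
rewrite /partscale scalerDr scaler_sumr; congr (_ + _).
by apply: eq_bigr => i _; rewrite dotpZl scalerA mulrCA.
Qed.

(** * The cone inequality *)

Section core.
Context {R : realType} {n : nat}.
Local Notation lam := (@lebrow R n).
Variables (p : R) (W : 'rV[R]_n -> \bar R).
Hypotheses (mW : measurable_fun setT W) (W0 : forall x, (0 <= W x)%E).
Hypothesis WZ : forall s x, 0 < s -> W (s *: x) = ((rpow p s)%:E * W x)%E.
Variables (E B : 'I_n -> 'rV[R]_n).
Hypothesis dual : forall i j, dotp (E i) (B j) = (i == j)%:R.
Variables (r : seq 'I_n) (ur : uniq r).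
Local Notation D := (partscale E B r).
(** [P] stands for the cylinder and [C] for the cone part. [fib] is the symmetrization inequality on
    a shell [P \ lP], [Kfin] permits subtraction, and [strict] is the source of the strict sign. *)
Variables (K P C : set 'rV[R]_n).
Hypotheses (mK : measurable K) (mP : measurable P) (mC : measurable C).
Local Notation dil s A := ((fun x : 'rV[R]_n => s^-1 *: x) @^-1` A).
Hypothesis PD : forall s x, 0 < s -> P (s^-1 *: D s x) <-> P x.
Hypothesis Pdil : forall s, 0 < s <= 1 -> dil s P `<=` P.
Hypotheses (KP : K `<=` P) (CK : C `<=` K).
Hypothesis CP : forall s, 0 < s < 1 -> C `&` dil s P `<=` dil s C.
Hypothesis fib : forall s l, 0 < s <= 1 -> 0 < l < 1 ->
  (\int[lam]_(x in (P `\` dil l P) `&` K) W x <=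
   \int[lam]_(x in (P `\` dil l P) `&` D s @^-1` K) W (D s x))%E.
Hypothesis Kfin : (\int[lam]_(x in K) W x < +oo)%E.
Variable d : R.
Hypothesis d01 : 0 < d < 1.
Hypothesis strict : (\int[lam]_(x in K) W x <
  \int[lam]_(x in P `&` D d @^-1` K) W (D d x))%E.

Lemma measurable_scale (s : R) : measurable_fun setT (fun x : 'rV[R]_n => s *: x).
Proof.
rewrite (_ : (fun x => _) = fun x : 'rV[R]_n => x + (s - 1) *: x); last first.
  by apply/funext => x; rewrite scalerBl scale1r addrC subrK.
apply: measurable_rowP => i.
rewrite (_ : (fun x => _) = fun x : 'rV[R]_n => x 0 i + (s - 1) * x 0 i).
  apply: measurable_funD; first exact: measurable_coord.
  by apply: measurable_funM => //; exact: measurable_coord.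
by apply/funext => x; rewrite !mxE.
Qed.

Lemma measurable_dil s A : measurable A -> measurable (dil s A).
Proof. by move=> mA; apply: measurable_preimage => //; exact: measurable_scale. Qed.

Let mu A := (\int[lam]_(x in A) W x)%E.

Let mu_ge0 A : (0 <= mu A)%E. Proof. exact: integral_ge0. Qed.

Let mu_le A A' : measurable A -> measurable A' -> A `<=` A' -> (mu A <= mu A')%E.
Proof. by move=> mA mA' AA'; apply: ge0_subset_integral => //; exact: measurable_funTS. Qed.

Let mu_setU A A' : measurable A -> measurable A' -> A `&` A' = set0 ->
  (mu (A `|` A') = mu A + mu A')%E.
Proof.
move=> mA mA' AA'; apply: ge0_integral_setU => //; first exact: measurable_funTS.
by rewrite disj_set2E AA'.
Qed.

Let mu_dil s A : 0 < s -> measurable A ->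
  (mu (dil s A) = (s ^+ n * rpow p s)%:E * mu A)%E.
Proof.
move=> s0 mA; rewrite /mu (integral_indicE _ (dil s A)) (integral_indicE _ A).
rewrite -[LHS](ge0_integral_homothety s0); last 2 first.
- by apply: emeasurable_funM => //; apply: measurable_eindic; exact: measurable_dil.
- by move=> t; rewrite mule_ge0// eindic_ge0.
rewrite EFinM -muleA; congr (_ * _)%E; rewrite -ge0_integralZl//.
- apply: eq_integral => x _; rewrite WZ// muleA; congr (_ * _)%E.
  by apply: eindic_eq; rewrite /= scalerA mulVf ?gt_eqF// scale1r.
- by apply: emeasurable_funM => //; exact: measurable_eindic.
- by move=> t _; rewrite mule_ge0// eindic_ge0.
- by rewrite lee_fin rpow_ge0.
Qed.

Let mu_partscale s A : 0 < s -> measurable A ->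
  (mu A = (s ^+ size r)%:E * \int[lam]_(x in D s @^-1` A) W (D s x))%E.
Proof.
move=> s0 mA; rewrite /mu (integral_indicE _ A) (integral_indicE _ (D s @^-1` A)).
rewrite -[LHS](ge0_integral_partscale dual s0 ur)//.
- by apply: emeasurable_funM => //; exact: measurable_eindic.
- by move=> t; rewrite mule_ge0// eindic_ge0.
Qed.

(** The substitution [D t], of Jacobian [t^k], turns the shell between [tlP] and [tP] into the one
    between [lP] and [P], since [D_t P = tP]; there [fib] applies. *)
Let shell t l : 0 < t <= 1 -> 0 < l < 1 ->
  ((t ^+ size r)%:E * mu (K `\` dil l P) <= mu ((K `&` dil t P) `\` dil (t * l) P))%E.
Proof.
move=> /andP[t0 t1] /andP[l0 l1]; have t01 : 0 < t <= 1 by rewrite t0.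
rewrite [leRHS](mu_partscale t0); last first.
  by apply: measurableD; [apply: measurableI => //|]; exact: measurable_dil.
apply: lee_wpmul2l; first by rewrite lee_fin exprn_ge0// ltW.
rewrite (_ : D t @^-1` _ = (P `\` dil l P) `&` D t @^-1` K); last first.
  apply/seteqP; split => x /=.
    move=> [[Kx /(PD x t0) Px] nP]; split=> //; split => // h; apply: nP.
    by rewrite invfM -scalerA -partscaleZ; apply/PD.
  move=> [[Px nP] Kx]; split; first by split => //; apply/PD.
  by move=> h; apply: nP; apply/(PD _ t0); rewrite partscaleZ scalerA -invfM.
rewrite (_ : K `\` _ = (P `\` dil l P) `&` K); last first.
  apply/seteqP; split => x /= [].
    by move=> Kx nP; split => //; split => //; exact: KP.
  by move=> [Px nP] Kx; split.
by apply: fib => //; apply/andP.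
Qed.

Let fin_mu A : measurable A -> A `<=` K -> mu A \is a fin_num.
Proof.
move=> mA AK; rewrite ge0_fin_numE//; exact: le_lt_trans (mu_le mA mK AK) Kfin.
Qed.

Let m A := fine (mu A).

Let m_ge0 A : 0 <= m A. Proof. exact: fine_ge0. Qed.

Let mdil s A : measurable A -> measurable (dil s A).
Proof. exact: measurable_dil. Qed.

(** The shell [K \ lP] contains [C \ lP], and [C /\ lP] lies in [lC], of mass [l^(n-p) mu(C)]; this
    power appears as [l ^+ n * rpow p l]. *)
Let step t l : 0 < t <= 1 -> 0 < l < 1 ->
  m (K `&` dil (t * l) P) + t ^+ size r * ((1 - l ^+ n * rpow p l) * m C) <=
  m (K `&` dil t P).
Proof.
move=> t01 l01; have /andP[t0 t1] := t01; have /andP[l0 l1] := l01.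
have mKt s : measurable (K `&` dil s P) by apply: measurableI => //; exact: mdil.
have fKt s : mu (K `&` dil s P) \is a fin_num by apply: fin_mu => // x [].
have mKl : measurable (K `\` dil l P) by apply: measurableD => //; exact: mdil.
have fKl : mu (K `\` dil l P) \is a fin_num by apply: fin_mu => // x [].
have mCl : measurable (C `\` dil l P) by apply: measurableD => //; exact: mdil.
have fCl : mu (C `\` dil l P) \is a fin_num by apply: fin_mu => // x [/CK].
have fC : mu C \is a fin_num by apply: fin_mu.
have h1 : mu (K `&` dil t P) =
    (mu (K `&` dil (t * l) P) + mu ((K `&` dil t P) `\` dil (t * l) P))%E.
  rewrite -mu_setU//.
  - congr mu; apply/seteqP; split => x /=.
      move=> [Kx Px]; have [Pl|Pl] := pselect (P ((t * l)^-1 *: x)); first by left.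
      by right.
    move=> [[Kx Px]|[[Kx Px] _]//]; split => //.
    rewrite invfM mulrC -scalerA in Px; apply: (Pdil (s := l)) => //.
    by rewrite l0 ltW.
  - by apply: measurableD => //; exact: mdil.
  - by apply/seteqP; split => // x [[_ Px] [_ /(_ Px)]].
have fS : mu ((K `&` dil t P) `\` dil (t * l) P) \is a fin_num.
  by apply: fin_mu => [|x [[]]//]; apply: measurableD => //; exact: mdil.
have h2 := shell t01 l01.
have h3 : (mu (C `\` dil l P) <= mu (K `\` dil l P))%E.
  by apply: mu_le => // x [/CK Kx nP].
have h4 : (mu C <= mu (C `\` dil l P) + (l ^+ n * rpow p l)%:E * mu C)%E.
  rewrite -mu_dil// [leLHS](_ : _ = mu ((C `\` dil l P) `|` (C `&` dil l P))); last first.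
    by congr mu; rewrite setDE -setIUr setUCl setIT.
  have mI : measurable (C `&` dil l P) by apply: measurableI => //; exact: mdil.
  rewrite mu_setU//.
    by rewrite leeD2l//; apply: mu_le => //; [exact: mdil|exact: CP].
  by apply/seteqP; split => // x [[_ nP] [_ /nP]].
have -> : m (K `&` dil t P) =
    m (K `&` dil (t * l) P) + m ((K `&` dil t P) `\` dil (t * l) P).
  by rewrite /m h1 fineD.
rewrite lerD2l /m.
move: h2 h3 h4; rewrite -(fineK fS) -(fineK fKl) -(fineK fCl) -(fineK fC).
rewrite -!EFinM -EFinD !lee_fin => h2 h3 h4.
apply: le_trans h2; apply: ler_wpM2l; first by rewrite exprn_ge0// ltW.
by apply: le_trans h3; rewrite mulrBl mul1r lerBlDr.
Qed.

Let dil1 : K `&` dil 1 P = K.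
Proof.
by apply/seteqP; split => x; [case|move=> Kx; split => //=; rewrite invr1 scale1r; exact: KP].
Qed.

Let steps l j : 0 < l < 1 ->
  m (K `&` dil (l ^+ j) P) +
    (\sum_(i < j) (l ^+ size r) ^+ i) * ((1 - l ^+ n * rpow p l) * m C) <= m K.
Proof.
move=> l01; have /andP[l0 l1] := l01.
elim: j => [|j IH]; first by rewrite expr0 dil1 big_ord0 mul0r addr0.
have lj : 0 < l ^+ j <= 1 by rewrite exprn_gt0//= exprn_ile1// ltW.
have := step lj l01; rewrite -exprSr exprAC => h.
by rewrite big_ord_recr/= mulrDl; lra.
Qed.

(** By [mu_partscale], [mu(K /\ dP)] is [d^k] times the right-hand side of [strict]. *)
Let strict_real : d ^+ size r * m K < m (K `&` dil d P).
Proof.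
have /andP[d0 d1] := d01.
have mI : measurable (K `&` dil d P) by apply: measurableI => //; exact: mdil.
have fI : mu (K `&` dil d P) \is a fin_num by apply: fin_mu => // x [].
have fK : mu K \is a fin_num by exact: fin_mu.
rewrite -lte_fin EFinM /m !fineK// [ltRHS](mu_partscale d0)// lte_pmul2l//; last first.
  by rewrite lte_fin exprn_gt0.
rewrite (_ : D d @^-1` _ = P `&` D d @^-1` K)//.
by apply/seteqP; split => x /= [] => [Kx /(PD x d0)|/(PD x d0)].
Qed.

(* [steps] is used with [l = d ^ (1 / M.+1)] and [j = M.+1]; then [M] tends to
   infinity. *)
Lemma core_ineq : (0 < size r)%N -> p < n%:R ->
  (n%:R - p) * fine (\int[lam]_(x in C) W x) <
  (size r)%:R * fine (\int[lam]_(x in K) W x).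
Proof.
move=> k0 pn; have /andP[d0 d1] := d01.
rewrite -[fine (integral _ C _)]/(m C) -[fine (integral _ K _)]/(m K).
set k := size r in k0 *; set a := n%:R - p.
have a0 : 0 < a by rewrite subr_gt0.
have kR0 : 0 < k%:R :> R by rewrite ltr0n.
pose L := - ln d.
have L0 : 0 < L by rewrite oppr_gt0 ln_lt0// d0.
have dk1 : 0 < 1 - d ^+ k by rewrite subr_gt0 exprn_ilt1// ?ltW// -lt0n.
set md := m (K `&` dil d P); set Q := (1 - d ^+ k) * a * m C.
have Q0 : 0 <= Q by rewrite !mulr_ge0// ?m_ge0// ltW.
have main M : Q * (1 - a * L / M.+1%:R) <= k%:R * (m K - md).
  set x := L / M.+1%:R; have x0 : 0 < x by rewrite divr_gt0.
  have ax0 : 0 < a * x by rewrite mulr_gt0.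
  pose l := expR (- x).
  have l01 : 0 < l < 1 by rewrite expR_gt0 expR_lt1 oppr_lt0.
  have lM : l ^+ M.+1 = d.
    by rewrite -expRM_natl mulrN mulrC divfK// opprK lnK.
  have lk : l ^+ k = expR (- (k%:R * x)) by rewrite -expRM_natl mulrN.
  have la : l ^+ n * rpow p l = expR (- (a * x)).
    rewrite /rpow gtr0_norm ?expR_gt0// -powR_mulrn ?expR_ge0// -powRD; last first.
      by rewrite gt_eqF ?implybT// expR_gt0.
    by rewrite /powR gt_eqF ?expR_gt0// expRK mulrN.
  have := steps M.+1 l01; rewrite lM -/md la; set S := \sum_(i < _) _.
  have SE : S * (1 - l ^+ k) = 1 - d ^+ k.
    rewrite -[d]lM exprAC -[1 in RHS](expr1n _ M.+1) subrXX mulrC; congr (_ * _).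
    rewrite /S; under [RHS]eq_bigr do rewrite expr1n mul1r.
    by [].
  have S0 : 0 <= S by apply: sumr_ge0 => i _; rewrite exprn_ge0// exprn_ge0// expR_ge0.
  (* From [1 - exp(-u) <= u] at [u = k x]. *)
  have h1 : 1 - d ^+ k <= S * (k%:R * x).
    rewrite -SE ler_wpM2l// lk; have := expR_ge1Dx (- (k%:R * x)); lra.
  (* From [1 - exp(-u) >= u exp(-u) >= u (1 - u)] at [u = a x]. *)
  have h2 : (1 - a * x) * (a * x) <= 1 - expR (- (a * x)).
    have e1 := expR_ge1Dx (- (a * x)); have e2 := expR_ge1Dx (a * x).
    have e3 : expR (- (a * x)) * expR (a * x) = 1 by rewrite -expRD addNr expR0.
    have e4 := expR_ge0 (- (a * x)).
    have : expR (- (a * x)) * (a * x) <= 1 - expR (- (a * x)).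
      rewrite lerBrDl -[X in X + _]mulr1 -mulrDr -[leRHS]e3 ler_wpM2l//.
    apply: le_trans; rewrite ler_wpM2r ?(ltW ax0)//; lra.
  have c0 := m_ge0 C.
  move=> h3.
  have h4 : S * ((1 - a * x) * (a * x) * m C) <= m K - md.
    rewrite lerBrDl; apply: le_trans h3; rewrite lerD2l ler_wpM2l// ler_wpM2r//.
  (* If [1 - a x <= 0], the left-hand side is nonpositive and [md <= m K] suffices. *)
  have [neg|pos] := leP (1 - a * x) 0.
    rewrite (@le_trans _ _ 0)// ?mulr_ge0_le0// -?mulrA// mulr_ge0// ?(ltW kR0)//.
    have : 0 <= S * ((1 - expR (- (a * x))) * m C).
      by rewrite !mulr_ge0// subr_ge0 expR_le1 oppr_le0 ltW.
    by move: h3; lra.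
  rewrite -mulrA -/x; apply: le_trans (_ : k%:R * (S * ((1 - a * x) * (a * x) * m C)) <= _).
    rewrite [leRHS](_ : _ = (S * (k%:R * x)) * (a * m C * (1 - a * x))); last by ring.
    rewrite [leLHS](_ : _ = (1 - d ^+ k) * (a * m C * (1 - a * x))); last by rewrite /Q; ring.
    by apply: ler_wpM2r => //; rewrite !mulr_ge0// ltW.
  by apply: ler_wpM2l => //; exact: ltW.
have QX : Q <= k%:R * (m K - md).
  (* The limit in [M]: were [Q > X], some [M + 1 > Q a L / (Q - X)] would contradict [main]. *)
  rewrite leNgt; apply/negP => XQ; set X := k%:R * _ in XQ main.
  have := main (Num.truncn (Q * (a * L) / (Q - X))).
  set M := Num.truncn _; have := truncnS_gt (Q * (a * L) / (Q - X)); rewrite -/M => hM.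
  rewrite ltr_pdivrMr ?subr_gt0// in hM.
  rewrite leNgt => /negP; apply.
  have : Q * (a * L) / M.+1%:R < Q - X by rewrite ltr_pdivrMr// [ltRHS]mulrC.
  have -> : Q * (1 - a * L / M.+1%:R) = Q - Q * (a * L) / M.+1%:R.
    by move: (Q) (a * L) (M.+1%:R) => u v w; rewrite mulrBr mulr1 mulrA.
  by move: (_ / _) => Y; lra.
have := strict_real; rewrite -/k -/md => hs.
have : Q < k%:R * ((1 - d ^+ k) * m K).
  apply: (le_lt_trans QX); rewrite ltr_pM2l//; lra.
rewrite /Q -mulrA [X in _ < X]mulrCA.
by rewrite ltr_pM2l.
Qed.

End core.

(** * Integrability of the weight on balls *)

Section power_integral.
Context {R : realType}.

Lemma powR_cvgy (c : R) : 0 < c -> x `^ (- c) @[x --> +oo] --> 0.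
Proof.
move=> c0; apply/cvgrPdist_le => e e0; near=> x.
have x0 : 0 < x by near: x; exact: nbhs_pinfty_gt.
rewrite sub0r normrN ger0_norm ?powR_ge0// powRN -[e]invrK lef_pV2 ?posrE ?powR_gt0 ?invr_gt0//.
have -> : e^-1 = (e^-1 `^ c^-1) `^ c by rewrite -powRrM mulVf ?gt_eqF// powRr1// invr_ge0 ltW.
have hx : e^-1 `^ c^-1 <= x by near: x; exact: nbhs_pinfty_ge.
by apply: ge0_ler_powR; rewrite ?nnegrE ?powR_ge0 ?(ltW c0) ?(ltW x0).
Unshelve. all: by end_near. Qed.

Lemma integral_powR (c : R) : 0 < c ->
  (\int[@lebesgue_measure R]_(x in `[1%R, +oo[) (x `^ (- (c + 1)))%:E = (c^-1)%:E)%E.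
Proof.
move=> c0; pose F (x : R) := - c^-1 * x `^ (- c).
have dF (x : R) : 0 < x -> is_derive x 1 F (x `^ (- (c + 1))).
  move=> x0; have := is_derive1_powR (- c) x0.
  move=> h; rewrite (_ : _ `^ _ = - c^-1 * (- c * x `^ (- c - 1))).
    exact: is_deriveZ.
  by rewrite mulrA mulrNN mulVf ?gt_eqF// mul1r opprD.
have cF (a x : R) : 0 < x -> {for x, continuous (fun y : R => y `^ a)}.
  move=> x0; apply: differentiable_continuous; apply/derivable1_diffP.
  by apply: derivable_powR; rewrite in_itv/= andbT.
rewrite (@ge0_continuous_FTC2y _ _ F 1 0).
- by rewrite /F powR1 mulr1 -EFinB sub0r opprK.
- by move=> x _; exact: powR_ge0.
- apply/continuous_within_itvcyP; split.
    by move=> x; rewrite in_itv/= andbT => x1; apply: cF; rewrite (lt_trans _ x1).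
  by apply: cvg_at_right_filter; apply: cF.
- rewrite -(mulr0 (- c^-1)); apply: cvgMr; exact: powR_cvgy.
- by move=> x x1; have [] := dF x (lt_trans ltr01 x1).
- apply: cvg_at_right_filter; apply: cvgMr; exact: cF.
- move=> x; rewrite in_itv/= andbT => x1.
  by rewrite derive1E; have [_ ->] := dF x (lt_trans ltr01 x1).
Qed.

End power_integral.

Section euclid.
Context {R : realType} {n : nat}.
Local Notation lam := (@lebrow R n).
Implicit Types (x y w : 'rV[R]_n).

Lemma continuous_sumr (T : topologicalType) (I : Type) (s : seq I) (F : I -> T -> R) :
  (forall i, continuous (F i)) -> continuous (fun t => \sum_(i <- s) F i t).
Proof.
move=> cF; elim: s => [|i s IH] x.
  by under eq_fun do rewrite big_nil; exact: cst_continuous.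
under eq_fun do rewrite big_cons.
by apply: (@continuousD _ _ _ (F i) (fun t => \sum_(j <- s) F j t)); [exact: cF|exact: IH].
Qed.

Lemma continuous_dotp2 (T : topologicalType) (f g : T -> 'rV[R]_n) :
  continuous f -> continuous g -> continuous (fun t => dotp (f t) (g t)).
Proof.
move=> cf cg; apply: continuous_sumr => i t.
have cc (h : T -> 'rV[R]_n) : continuous h -> {for t, continuous (fun t => h t 0 i)}.
  move=> ch; apply: (@continuous_comp _ _ _ h (fun M : 'rV[R]_n => M 0 i)) => //.
    exact: ch.
  exact: (@coord_continuous R 1 n 0 i (h t)).
by apply: (@continuousM _ _ (fun t => f t 0 i) (fun t => g t 0 i)); exact: cc.
Qed.

Lemma continuous_dotpl w : continuous (fun x => dotp x w).
Proof. by apply: continuous_dotp2 => x; [exact: cvg_id|exact: cst_continuous]. Qed.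

Lemma continuous_enorm2 (T : topologicalType) (f : T -> 'rV[R]_n) :
  continuous f -> continuous (fun t => enorm (f t)).
Proof.
move=> cf t; rewrite /enorm.
apply: (@continuous_comp _ _ _ (fun t => dotp (f t) (f t)) (@Num.sqrt R)).
  by apply: continuous_dotp2.
exact: sqrt_continuous.
Qed.

Lemma continuous_enorm : continuous (@enorm R n).
Proof. by apply: continuous_enorm2 => x; exact: cvg_id. Qed.

Lemma ler_coord_enorm x i : `|x 0 i| <= enorm x.
Proof.
have := ler_dotp x (delta_mx 0 i); rewrite dotp_deltar.
by rewrite [enorm (delta_mx _ _)]/enorm dotp_delta eqxx sqrtr1 mulr1.
Qed.

Lemma ler_enorm_norm x : enorm x <= n%:R * `|x|.
Proof.
rewrite -ler_sqr ?nnegrE ?enorm_ge0 ?mulr_ge0// enorm_sqr exprMn.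
apply: (@le_trans _ _ (\sum_(i < n) `|x| ^+ 2)).
  apply: ler_sum => i _; rewrite -expr2 -real_normK ?num_real//.
  rewrite ler_sqr ?nnegrE//.
  by rewrite {2}/Num.norm/= mx_normrE; apply: (le_bigmax _ (fun ij => `|x ij.1 ij.2|) (0, i)).
rewrite sumr_const card_ord -[leLHS]mulr_natl; apply: ler_wpM2r; first exact: sqr_ge0.
by rewrite -natrX ler_nat; case: (n) => // m; rewrite expnS expn1 leq_pmull.
Qed.

Definition eball (r : R) : set 'rV[R]_n := [set x | enorm x <= r].

Lemma measurable_eball r : measurable (eball r).
Proof.
rewrite (_ : eball r = @enorm R n @^-1` `]-oo, r]).
  by apply: measurable_preimage => //; exact: measurable_enorm.
by apply/seteqP; split => x /=; rewrite in_itv.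
Qed.

Lemma lebrow_eball_fin r : (lam (eball r) < +oo)%E.
Proof.
pose s := `|r| + 1; have s0 : 0 < s by rewrite ltr_wpDl.
apply: (@le_lt_trans _ _ (lam (row_box (- s) s))).
  apply: le_measure; rewrite ?inE; [exact: measurable_eball|exact: measurable_row_box|].
  move=> x /= xr i; have h := le_trans (ler_coord_enorm x i) xr.
  have : `|x 0 i| < s by rewrite (le_lt_trans h)// (le_lt_trans (ler_norm r))// ltrDl.
  by rewrite ltr_norml => /andP[-> /ltW].
by rewrite lebrow_box ?ltry// ge0_cp// ltW.
Qed.

(** A box of half-side [e/2] around a point of [U] fits in a sup-norm ball inside [U]. *)
Lemma lebrow_open_gt0 (U : set 'rV[R]_n) : open U -> U !=set0 -> (0 < lam U)%E.
Proof.
move=> oU [c Uc].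
have /nbhs_ballP[e /= e0 ceU] : nbhs c U by exact: open_nbhs_nbhs.
have mU := row_open_measurable oU.
have e20 : 0 < e / 2 by rewrite divr_gt0.
pose b := row_box (- (e / 2)) (e / 2) : set 'rV[R]_n.
have mb : measurable b by exact: measurable_row_box.
have b0 : (0 < lam b)%E.
  by rewrite lebrow_box ?lte_fin ?exprn_gt0 ?ge0_cp ?ltW// opprK addr_gt0.
apply: (lt_le_trans b0).
have mc : measurable ((fun x : 'rV[R]_n => x - c) @^-1` b).
  by apply: measurable_preimage => //; exact: measurable_shift.
have -> : lam b = lam ((fun x : 'rV[R]_n => x - c) @^-1` b).
  rewrite (measure_integral_indic lam mb) (measure_integral_indic lam mc).
  by rewrite -[LHS](ge0_integral_row_shift (- c))//; exact: measurable_eindic.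
apply: le_measure; rewrite ?inE// => x /= h; apply: ceU; split => // i j.
rewrite ord1 /ball/= distrC; have := h j; rewrite !mxE => /andP[h1 h2].
by rewrite ltr_norml; apply/andP; split; lra.
Qed.

(** Integrate along [w] by [ge0_integral_direction]. Where [0 <= x . w <= 1] and [x + t w] is in the
    ball, [|t| <= r + 1], so [x] is in the ball of radius [2 r + 1]; the admissible [t] lie in an
    interval of length [2 e]. *)
Lemma slab_bound w r e : enorm w = 1 -> 0 <= e ->
  (lam (eball r `&` [set x | (`|dotp x w| <= e)%R]) <=
   lam (eball (r *+ 2 + 1)) * (2 * e)%:E)%E.
Proof.
move=> w1 e0.
have ww : dotp w w = 1 by rewrite -enorm_sqr w1 expr1n.
set A := (_ `&` _).
have mA : measurable A.
  apply: measurableI; first exact: measurable_eball.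
  rewrite (_ : mkset _ = (fun x => dotp x w) @^-1` `[- e, e]).
    by apply: measurable_preimage => //; exact: measurable_dotpl.
  by apply/seteqP; split => x /=; rewrite in_itv/= ler_norml.
have mB := measurable_eball (r *+ 2 + 1).
rewrite (measure_integral_indic lam mA).
rewrite (ge0_integral_direction ww (measurable_eindic mA) (eindic_ge0 _)).
rewrite (measure_integral_indic lam mB) -ge0_integralZr//; last 2 first.
- exact: measurable_eindic.
- by rewrite lee_fin mulr_ge0.
pose S (x : 'rV[R]_n) : set R := `[- e - dotp x w, e - dotp x w]%classic.
have key x t : ((\1_A (x + t *: w)%R)%:E * (\1_(`[0, 1]%classic : set R) (dotp x w))%:E <=
    (\1_(eball (r *+ 2 + 1)%R) x)%:E * (\1_(S x) t)%:E :> \bar R)%E.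
  rewrite [X in (X%:E * _)%E]indicE; case: (boolP (_ \in _)) => [/set_mem[/= h1 h2]|_]; last first.
    by rewrite /= mul0e mule_ge0// eindic_ge0.
  rewrite [X in (_ * X%:E <= _)%E]indicE.
  case: (boolP (_ \in _)) => [/set_mem/=|_]; last first.
    by rewrite /= mule0 mule_ge0// eindic_ge0.
  rewrite in_itv/= => /andP[h3 h4].
  have h5 := le_trans (ler_dotp (x + t *: w) w) (_ : _ <= r).
  rewrite w1 mulr1 in h5; have {}h5 := h5 h1.
  move: h2 h5; rewrite dotpDl dotpZl ww mulr1 => h2 h5.
  rewrite !indicE !mem_set//.
    rewrite /S/= in_itv/=; move: h2; rewrite ler_norml => /andP[]; lra.
  rewrite /eball/= -[x](addrK (t *: w)) (le_trans (ler_enormD _ _))// enormN enormZ w1 mulr1.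
  have : `|t| <= r + 1.
    by move: h5; rewrite !ler_norml => /andP[]; lra.
  rewrite /eball/= in h1; rewrite mulr2n; lra.
apply: ge0_le_integral => //.
- by move=> x _; apply: integral_ge0 => t _; rewrite mule_ge0// eindic_ge0.
- have mF : measurable_fun setT (fun z : 'rV[R]_n * measurableTypeR R =>
     (\1_A (z.1 + z.2 *: w)%R)%:E *
     (\1_(`[0, 1]%classic : set R) (dotp z.1 w))%:E : \bar R)%E.
    apply: emeasurable_funM.
      by apply: (measurableT_comp (measurable_eindic mA)); exact: measurable_move.
    apply: (measurableT_comp (@measurable_eindic _ _ _ (`[0, 1]%classic : set R) _)) => //.
    exact: (measurableT_comp (measurable_dotpl w) measurable_fst).
  apply: (measurable_fun_fubini_tonelli_F (m2 := @lebesgue_measure R) _ mF) => z.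
  by rewrite mule_ge0// eindic_ge0.
- by apply: emeasurable_funM => //; exact: measurable_eindic.
move=> x _.
have mS : measurable (S x) by exact: measurable_itv.
apply: (@le_trans _ _ (\int[@lebesgue_measure R]_t
   ((\1_(eball (r *+ 2 + 1)%R) x)%:E * (\1_(S x) t)%:E))%E).
  apply: ge0_le_integral => //.
  - apply: emeasurable_funM => //.
    exact: (measurable_line x w (measurable_eindic mA)).
  - by apply: emeasurable_funM => //; exact: measurable_eindic.
rewrite ge0_integralZl//; last exact: measurable_eindic.
apply: lee_wpmul2l; first exact: eindic_ge0.
rewrite -(measure_integral_indic (@lebesgue_measure R) mS).
rewrite [leLHS](lebesgue_measure_itv `[_, _])/= lte_fin.
by case: ifPn => _; rewrite -?EFinD lee_fin ?mulr_ge0//; lra.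
Qed.

(* The slab where [t <= |x . w|^-p] has volume [O(t^(-1/p))], which is
   integrable at infinity because [p < 1]. *)
Lemma integral_rpow_eball_le p r : 0 < p < 1 -> exists2 J : R, 0 <= J & forall w, enorm w = 1 ->
  (\int[lam]_(x in eball r) (rpow p (dotp x w))%:E <= J%:E)%E.
Proof.
move=> /andP[p0 p1].
set V := lam (eball (r *+ 2 + 1)); set V1 := lam (eball r).
have Vfin : V \is a fin_num by rewrite ge0_fin_numE ?measure_ge0// lebrow_eball_fin.
have V1fin : V1 \is a fin_num by rewrite ge0_fin_numE ?measure_ge0// lebrow_eball_fin.
have c0 : 0 < p^-1 - 1 by rewrite subr_gt0 invf_gt1.
(* For [t <= 1] the whole ball, of volume [V1]; for [t > 1] the slab of half-width [t^(-1/p)]. The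
   exponent is written [-(c + 1)], [c = 1/p - 1 > 0], to match [integral_powR]. *)
pose H (t : R) : \bar R := (V1 * (\1_(`]0, 1]%classic : set R) t)%:E +
  V * ((2 * t `^ (- (p^-1 - 1 + 1)))%:E * (\1_(`[1, +oo[%classic : set R) t)%:E))%E.
have H0 t : (0 <= H t)%E.
  rewrite adde_ge0// mule_ge0// ?measure_ge0// ?eindic_ge0// mule_ge0// ?eindic_ge0//.
  by rewrite lee_fin mulr_ge0// powR_ge0.
have mI (A : set R) : measurable A -> measurable_fun setT (fun t : R => (\1_A t : R)%:E).
  by move=> mA; exact: measurable_eindic.
have mH : measurable_fun setT H.
  apply: emeasurable_funD; apply: emeasurable_funM => //; first exact: mI.
  apply: emeasurable_funM => //; last exact: mI.
  apply/measurable_EFinP; apply: measurable_funM => //; exact: measurable_powR.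
have IH : (\int[@lebesgue_measure R]_t H t = V1 + V * (2 * (p^-1 - 1)^-1)%:E)%E.
  rewrite ge0_integralD//.
  - congr (_ + _)%E.
      rewrite ge0_integralZl//; [|exact: mI|by rewrite measure_ge0].
      rewrite integral_indic// setIT [X in (_ * X)%E](lebesgue_measure_itv `]0, 1]).
      by rewrite /= lte_fin ltr01 sube0 mule1.
    rewrite ge0_integralZl//.
    + congr (_ * _)%E; rewrite -integral_indicE.
      under eq_integral do rewrite EFinM; rewrite ge0_integralZl//.
      * by rewrite integral_powR.
      * by apply/measurable_EFinP/measurable_funTS; exact: measurable_powR.
      * by move=> t _; rewrite lee_fin powR_ge0.
    + apply: emeasurable_funM => //; last exact: mI.
      apply/measurable_EFinP; apply: measurable_funM => //; exact: measurable_powR.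
    + by move=> t _; rewrite mule_ge0 ?eindic_ge0// lee_fin mulr_ge0// powR_ge0.
    + by rewrite measure_ge0.
  - by move=> t _; rewrite mule_ge0// ?measure_ge0// eindic_ge0.
  - apply: emeasurable_funM => //; exact: mI.
  - move=> t _; rewrite mule_ge0 ?measure_ge0//.
    by rewrite mule_ge0 ?eindic_ge0// lee_fin mulr_ge0// powR_ge0.
  - apply: emeasurable_funM => //; apply: emeasurable_funM => //; last exact: mI.
    apply/measurable_EFinP; apply: measurable_funM => //; exact: measurable_powR.
exists (fine (V1 + V * (2 * (p^-1 - 1)^-1)%:E)).
  by rewrite fine_ge0// adde_ge0// ?mule_ge0// ?measure_ge0// lee_fin mulr_ge0// invr_ge0 ltW.
move=> w w1; rewrite fineK; last first.
  by rewrite fin_numD V1fin fin_numM.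
rewrite -IH; apply: layer_cake_bound => //.
- exact: measurable_eball.
- exact: (measurableT_comp (measurable_rpow p) (measurable_dotpl w)).
- by move=> x; exact: rpow_ge0.
move=> t t0; rewrite /H.
have mle : measurable [set x | t <= rpow p (dotp x w)].
  by apply: measurable_le_fun; exact: (measurableT_comp (measurable_rpow p) (measurable_dotpl w)).
have mb := measurable_eball r.
have [t1|t1] := leP t 1.
  rewrite [X in (V1 * X%:E)%E]indicE mem_set/= ?in_itv/= ?t0//.
  rewrite mule1; apply: (@le_trans _ _ V1).
    by apply: le_measure; rewrite ?inE//; exact: measurableI.
  rewrite leeDl// mule_ge0 ?measure_ge0// mule_ge0 ?eindic_ge0//.
  by rewrite lee_fin mulr_ge0// powR_ge0.
rewrite [X in (V1 * X%:E)%E]indicE memNset; last by rewrite /= in_itv/= t0/= leNgt t1.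
rewrite mule0 add0e [X in (_ * (_ * X%:E))%E]indicE mem_set/= ?in_itv/= ?(ltW t1)//.
rewrite mule1 subrK.
apply: le_trans (slab_bound r w1 (powR_ge0 t (- p^-1))).
apply: le_measure; rewrite ?inE.
- exact: measurableI.
- apply: measurableI => //.
  rewrite (_ : mkset _ = (fun x => dotp x w) @^-1` `[- (t `^ (- p^-1)), t `^ (- p^-1)]).
    by apply: measurable_preimage => //; exact: measurable_dotpl.
  by apply/seteqP; split => x /=; rewrite in_itv/= ler_norml.
move=> x [xr tx]; split => //=.
have [d0|d0] := eqVneq (dotp x w) 0; first by rewrite d0 normr0 powR_ge0.
move: tx; rewrite /= /rpow powRN => tx.
have dp : 0 < `|dotp x w| by rewrite normr_gt0.
have h : `|dotp x w| `^ p <= t^-1.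
  by rewrite -[leLHS]invrK lef_pV2 ?posrE ?invr_gt0 ?powR_gt0.
have -> : `|dotp x w| = (`|dotp x w| `^ p) `^ p^-1.
  by rewrite -powRrM divff ?gt_eqF// powRr1.
have -> : t `^ (- p^-1) = t^-1 `^ p^-1.
  by rewrite -[t^-1]powR_inv1 ?(ltW t0)// -powRrM mulN1r.
by apply: ge0_ler_powR; rewrite ?nnegrE ?invr_ge0 ?powR_ge0 ?(ltW p0) ?(ltW t0).
Qed.

End euclid.

Lemma count_ltn_iota (k m : nat) : (k <= m)%N -> count (fun j => j < k)%N (iota 0 m) = k.
Proof.
move=> km; rewrite -(subnKC km) iotaD count_cat add0n.
rewrite (@eq_in_count _ _ predT (iota 0 _)) => [|j]; last by rewrite mem_iota add0n.
rewrite count_predT size_iota (@eq_in_count _ _ pred0 (iota k _)) => [|j].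
  by rewrite count_pred0 addn0.
by rewrite mem_iota => /andP[le _]; rewrite ltnNge le.
Qed.

(* [B i], [i] in [r], is a basis of [xi], and [E i], [i] in [q], is a basis of
   its orthogonal complement. *)
Lemma dual_basis {R : realType} {n : nat} (xi : {vspace 'rV[R]_n}) :
  exists (E B : 'I_n -> 'rV[R]_n) (r q : seq 'I_n),
    [/\ forall i j, dotp (E i) (B j) = (i == j)%:R,
        [/\ uniq r, uniq q, ~~ has (mem r) q & size r = \dim xi],
        forall x, x = \sum_(i <- r) dotp x (B i) *: E i
                    + \sum_(i <- q) dotp x (B i) *: E i &
        forall v, v \in xi -> exists c, v = \sum_(i <- r) c i *: B i].
Proof.
pose X := vbasis xi ++ vbasis (xi^C)%VS.
have bX : basis_of fullv X.
  rewrite -(addv_complf xi); apply: cat_basis; try exact: vbasisP.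
  by apply/directv_addP; exact: capv_compl.
have dn : \dim {:'rV[R]_n} = n by rewrite dimvf /dim/= mul1n.
have sX : size X == n.
  by rewrite size_cat !size_tuple dimv_compl subnKC ?dimvS ?subvf// dn.
pose Xt : n.-tuple 'rV[R]_n := Tuple sX.
have freeX : free Xt by exact: basis_free bX.
pose M : 'M[R]_n := \matrix_i Xt`_i.
have uM : M \in unitmx.
  rewrite -row_free_unit -kermx_eq0; apply/rowV0P => c /sub_kermxP cM.
  apply/rowP => i; rewrite mxE; move/freeP: freeX => freeX; apply: (freeX (fun i => c 0 i)).
  by rewrite -[RHS]cM mulmx_sum_row; apply: eq_bigr => j _; rewrite rowK.
(* The [E i] are the columns of the inverse matrix; for [i] in [q] they are orthogonal to the first
   [\dim xi] rows of [M], a basis of [xi]. *)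
pose B i := row i M; pose E i := row i (invmx M)^T.
have dual i j : dotp (E i) (B j) = (i == j)%:R.
  rewrite /dotp; transitivity ((M *m invmx M) j i).
    by rewrite mxE; apply: eq_bigr => k _; rewrite !mxE mulrC.
  by rewrite mulmxV// mxE eq_sym.
have full x : x = \sum_(i < n) dotp x (B i) *: E i.
  transitivity (x *m M^T *m (invmx M)^T).
    by rewrite -mulmxA -trmx_mul mulVmx// trmx1 mulmx1.
  rewrite mulmx_sum_row; apply: eq_bigr => i _; congr (_ *: _).
  by rewrite mxE; apply: eq_bigr => j _; rewrite !mxE.
pose a := [pred i : 'I_n | (i < \dim xi)%N].
exists E, B, [seq i <- enum 'I_n | a i], [seq i <- enum 'I_n | ~~ a i].
have bE (Q : pred 'I_n) (F : 'I_n -> 'rV[R]_n) :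
    \sum_(i <- [seq i <- enum 'I_n | Q i]) F i = \sum_(i | Q i) F i.
  by rewrite big_filter big_enum_cond; apply: eq_bigl.
have dxi : (\dim xi <= n)%N by rewrite -[X in (_ <= X)%N]dn dimvS ?subvf.
split => //.
- split; [exact: filter_uniq (enum_uniq _)|exact: filter_uniq (enum_uniq _)| |].
    by apply/hasPn => i; rewrite mem_filter => /andP[ai _]; rewrite /= mem_filter negb_and ai.
  rewrite size_filter -(count_map val (fun m => m < \dim xi)%N) val_enum_ord.
  exact: count_ltn_iota.
- by move=> x; rewrite {1}(full x) (bigID a)/= !bE.
move=> v vxi; exists (fun i => dotp v (E i)).
have fullB x : x = \sum_(i < n) dotp x (E i) *: B i.
  transitivity (x *m invmx M *m M); first by rewrite -mulmxA mulVmx// mulmx1.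
  rewrite mulmx_sum_row; apply: eq_bigr => i _; congr (_ *: _).
  by rewrite mxE; apply: eq_bigr => j _; rewrite !mxE.
rewrite bE {1}(fullB v) (bigID a)/= [X in _ + X]big1 ?addr0//.
move=> i ai; rewrite (coord_vbasis vxi) dotp_suml big1 ?scale0r// => j _.
have BE : (vbasis xi)`_j = B (widen_ord dxi j).
  rewrite /B rowK /Xt/= /X nth_cat size_tuple ltn_ord.
  by apply: set_nth_default; rewrite size_tuple.
rewrite dotpZl BE dotpC dual (_ : (i == _) = false) ?mulr0//.
by apply: contraNF ai => /eqP ->; rewrite /=.
Qed.

Section normalize_theory.
Context {R : realType} {n : nat}.
Implicit Types (x y w : 'rV[R]_n).

Lemma enorm_normalize y : y != 0 -> enorm (normalize y) = 1.
Proof.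
by move=> y0; rewrite enormZ ger0_norm ?invr_ge0 ?enorm_ge0// mulVf// enorm_eq0.
Qed.

Lemma normalize_sphere y : enorm y = 1 -> normalize y = y.
Proof. by move=> y1; rewrite /normalize y1 invr1 scale1r. Qed.

Lemma normalizeZ t y : 0 < t -> normalize (t *: y) = normalize y.
Proof.
move=> t0; rewrite /normalize enormZ gtr0_norm// scalerA invfM.
by rewrite mulrAC mulVf ?gt_eqF// mul1r.
Qed.

Lemma enormK y : enorm y *: normalize y = y.
Proof.
have [->|y0] := eqVneq y 0; first by rewrite /normalize !scaler0.
by rewrite /normalize scalerA divff ?scale1r// enorm_eq0.
Qed.

Lemma punctured_ball_neq0 y : punctured_ball y -> y != 0.
Proof. by move=> /andP[]; rewrite enorm_gt0. Qed.

(** Multiplied by [|y|], the cap condition reads [|y - |y| w0| <= d |y|], which is continuous in [y]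
    even at the origin; its strict form cuts out an open set containing [w0 / 2]. *)
Lemma lebrow_cap_gt0 (w0 : 'rV[R]_n) d : enorm w0 = 1 -> 0 < d ->
  (0 < @lebrow R n (punctured_ball `&` [set y | (enorm (normalize y - w0) <= d)%R]))%E.
Proof.
move=> w1 d0; set A := _ `&` _.
pose U := [set y : 'rV[R]_n | 0 < enorm y] `&` [set y | enorm y < 1] `&`
  [set y | enorm (y - enorm y *: w0) - d * enorm y < 0].
have oU : open U.
  apply: openI; first apply: openI.
  - apply: (@open_comp _ _ (@enorm R n) [set t | 0 < t]); last exact: open_gt.
    by move=> y _; exact: continuous_enorm.
  - apply: (@open_comp _ _ (@enorm R n) [set t | t < 1]); last exact: open_lt.
    by move=> y _; exact: continuous_enorm.
  - apply: (@open_comp _ _ (fun y : 'rV[R]_n => enorm (y - enorm y *: w0) - d * enorm y)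
      [set t | t < 0]); last exact: open_lt.
    move=> y _; apply: (@continuousB _ _ _
      (fun y : 'rV[R]_n => enorm (y - enorm y *: w0)) (fun y => d * enorm y)).
      apply: continuous_enorm2 => z.
      apply: (@continuousB _ _ _ id (fun y : 'rV[R]_n => enorm y *: w0)).
        exact: cvg_id.
      by apply: continuousZr_tmp; exact: continuous_enorm.
    apply: (@continuousM _ _ (fun=> d) (@enorm R n)); first exact: cst_continuous.
    exact: continuous_enorm.
apply: (@lt_le_trans _ _ (@lebrow R n U)).
  apply: lebrow_open_gt0 => //; exists (2^-1 *: w0).
  have E2 : enorm (2^-1 *: w0) = 2^-1.
    by rewrite enormZ w1 mulr1 ger0_norm// invr_ge0.
  rewrite /U/= E2 subrr; split; first by split; [rewrite invr_gt0|rewrite invf_lt1// ltr1n].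
  have -> : enorm (0 : 'rV[R]_n) = 0 by apply/eqP; rewrite enorm_eq0.
  by rewrite sub0r oppr_lt0 mulr_gt0.
apply: le_measure; rewrite ?inE.
- exact: row_open_measurable.
- apply: measurableI; first exact: measurable_punctured_ball.
  rewrite (_ : mkset _ = (fun y => enorm (normalize y - w0)) @^-1` `]-oo, d]).
    apply: measurable_preimage => //.
    apply: (measurableT_comp (@measurable_enorm R n)).
    exact: (measurableT_comp (measurable_shift (- w0)) (@measurable_normalize R n)).
  by apply/seteqP; split => y /=; rewrite in_itv.
move=> y [[/= y0 y1] h]; split; first by rewrite /punctured_ball/= y0 ltW.
rewrite /= -(ler_pM2l y0) -[X in X * enorm _]gtr0_norm// -enormZ scalerBr enormK.
by rewrite mulrC; move: h; lra.
Qed.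

End normalize_theory.

(** * Inner and outer balls of a symmetric convex body *)

Section convex_body_facts.
Context {R : realType} {n : nat}.
Implicit Types (K : set 'rV[R]_n) (x : 'rV[R]_n).

Lemma convex_set_vconvex K : convex_set K -> vconvex K.
Proof.
move=> cK x y t Kx Ky /andP[t0 t1].
have := cK x y (Itv01 t0 t1); rewrite !inE => /(_ Kx Ky).
by [].
Qed.

Lemma vconvex_star K x t : vconvex K -> K 0 -> 0 <= t <= 1 -> K x -> K (t *: x).
Proof. by move=> cK K0 t01 Kx; have := cK _ _ _ Kx K0 t01; rewrite scaler0 addr0. Qed.

Lemma convex_body_eball K : vconvex K -> origin_symmetric K -> interior K !=set0 ->
  exists2 r, 0 < r & eball r `<=` K.
Proof.
move=> cK sK [c ic].
have /nbhs_ballP[e /= e0 ceK] : nbhs c K by [].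
exists (e / 2); first by rewrite divr_gt0.
move=> x /= xe.
have Kc : K (c + x).
  apply: ceK; split => // i j; rewrite ord1 /ball/= !mxE opprD addNKr normrN.
  by rewrite (le_lt_trans (ler_coord_enorm x j))// (le_lt_trans xe)// ltr_pdivrMr// ltr_pMr// ltr1n.
have Kcm : K (c - x).
  apply: ceK; split => // i j; rewrite ord1 /ball/= !mxE opprB addrC subrK.
  by rewrite (le_lt_trans (ler_coord_enorm x j))// (le_lt_trans xe)// ltr_pdivrMr// ltr_pMr// ltr1n.
(* [x] is the midpoint of [c + x] and [-(c - x)], the latter in [K] by symmetry. *)
have := cK _ _ 2^-1 Kc (sK _ Kcm).
have -> : 2^-1 *: (c + x) + (1 - 2^-1) *: - (c - x) = x.
  by apply/rowP => i; rewrite !mxE; lra.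
by apply; rewrite invr_ge0 ler0n/= invf_le1// ler1n.
Qed.

Lemma compact_eball K : compact K -> exists2 r, 0 < r & K `<=` eball r.
Proof.
move=> /compact_bounded[M [_ hM]].
exists (n%:R * (`|M| + 1) + 1).
  by rewrite ltr_wpDl// mulr_ge0// addr_ge0.
move=> x Kx /=; have h : `|x| <= `|M| + 1.
  by apply: hM => //; rewrite (le_lt_trans (ler_norm M))// ltrDl.
rewrite /eball/= (le_trans (ler_enorm_norm x))// (le_trans (ler_wpM2l (ler0n _ n) h))//.
by rewrite lerDl.
Qed.

End convex_body_facts.

(** * The cone inequality for a symmetric convex body *)

Section body.
Context {R : realType} {n : nat}.
Local Notation lam := (@lebrow R n).
Implicit Types (x y v w : 'rV[R]_n).
Variables (K : set 'rV[R]_n) (xi : {vspace 'rV[R]_n}).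

(* For [K] closed, convex and containing the origin this is the closure of
   [K + xi^⊥]. *)
Definition polar_cylinder : set 'rV[R]_n :=
  [set x | forall v, v \in xi -> (forall y, K y -> dotp y v <= 1) -> dotp x v <= 1].
Local Notation P := polar_cylinder.

(* The points [x] of [K] such that [x / s] stays in [K] as long as it stays in the
   cylinder. Rational [s] make measurability evident; they suffice for closed
   [K], by [cone_partP]. *)
Definition cone_part : set 'rV[R]_n :=
  [set x | K x /\ forall s : rat, 0 < s < 1 ->
    P ((ratr s)^-1 *: x) -> K ((ratr s)^-1 *: x)].
Local Notation C := cone_part.

Lemma closed_polar_cylinder : closed P.
Proof.
rewrite (_ : P = \bigcap_(v in [set v | v \in xi /\ forall y, K y -> dotp y v <= 1])
    (fun x => dotp x v) @^-1` [set t | t <= 1]).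
  apply: closed_bigI => v _.
  have /continuous_closedP := @continuous_dotpl R n v; apply; exact: closed_le.
by apply/seteqP; split => x /= h v; [move=> [? ?]; exact: h|move=> ? ?; apply: h].
Qed.

Lemma measurable_polar_cylinder : measurable P.
Proof. exact/row_closed_measurable/closed_polar_cylinder. Qed.

Lemma sub_polar_cylinder : K `<=` P.
Proof. by move=> x Kx v _; apply. Qed.

Lemma polar_cylinder_star x s : 0 <= s <= 1 -> P x -> P (s *: x).
Proof.
move=> /andP[s0 s1] Px v vxi vK; rewrite dotpZl.
by apply: (le_trans _ s1); rewrite -[leRHS]mulr1; apply: ler_wpM2l => //; exact: Px.
Qed.

Hypothesis mK : measurable K.

Lemma measurable_cone_part : measurable C.
Proof.
rewrite (_ : C = K `\` \bigcup_(s : rat) if 0 < s < 1 then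
    ((fun x => (ratr s)^-1 *: x) @^-1` P) `\` ((fun x => (ratr s)^-1 *: x) @^-1` K)
    else set0).
  apply: measurableD => //; apply: bigcupT_measurable_rat => s; case: ifPn => // _.
  have mS := @measurable_scale R n ((ratr s)^-1).
  by apply: measurableD; apply: measurable_preimage => //; exact: measurable_polar_cylinder.
apply/seteqP; split => x /= [Kx h]; split=> //.
  by move=> [s _]; case: ifPn => // s01 [Ps]; apply; exact: h.
move=> s s01 Ps; apply: contrapT => nK; apply: h; exists s => //.
by rewrite s01; split.
Qed.

Hypotheses (cK : vconvex K) (K0 : K 0) (clK : closed K).

(** From rational to real [s]: if [x / s] were outside the closed set [K], so would be [x / q] for a
    rational [q] slightly above [s], while [x / q] is still in the star-shaped [P]. *)
Lemma cone_partP x s : C x -> 0 < s < 1 -> P (s^-1 *: x) -> K (s^-1 *: x).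
Proof.
move=> [Kx h] /andP[s0 s1] Ps; apply: contrapT => nK.
have cf : {for s, continuous (fun t : R => t^-1 *: x)}.
  apply: continuousZr_tmp; apply: cvgV; first by rewrite gt_eqF.
  exact: cvg_id.
have oK : open (~` K) by exact: closed_openC.
have /cf /nbhs_ballP[e /= e0 ball_e] : nbhs (s^-1 *: x) (~` K) by exact: open_nbhs_nbhs.
have [q] : exists q : rat, ratr q \in `]s, Num.min 1 (s + e)[.
  by apply: rat_in_itvoo; rewrite lt_min s1 ltrDl.
rewrite in_itv/= lt_min => /andP[sq /andP[q1 qe]].
have q0 : 0 < ratr q :> R by exact: lt_trans sq.
apply: (ball_e (ratr q)).
  by rewrite /ball/= distrC gtr0_norm ?subr_gt0// ltrBlDl.
apply: h; first by rewrite -(ltr0q R) q0 -(ltr_rat R) rmorph1.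
rewrite (_ : _ *: x = (s / ratr q) *: (s^-1 *: x)); last first.
  by rewrite scalerA mulrAC divff ?gt_eqF// mul1r.
apply: polar_cylinder_star => //.
by rewrite divr_ge0 ?(ltW s0) ?(ltW q0)//= ler_pdivrMr// mul1r ltW.
Qed.

(** For [t <= s] the point [t x / s] is in [K] by star-shapedness; for [s < t] use the property of
    [x] at [s / t < 1]. *)
Lemma cone_part_star x t : 0 < t <= 1 -> C x -> C (t *: x).
Proof.
move=> /andP[t0 t1] Cx; split; first by apply: vconvex_star => //; [rewrite (ltW t0)|case: Cx].
move=> s /andP[s0 s1]; rewrite scalerA.
have s0' : 0 < ratr s :> R by rewrite ltr0q.
have [ts|st] := leP t (ratr s).
  move=> _; apply: vconvex_star => //; last by case: Cx.
  by rewrite mulrC divr_ge0 ?(ltW t0) ?(ltW s0')//= ler_pdivrMr// mul1r.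
rewrite (_ : _ * t = (ratr s / t)^-1); last by rewrite (invfM (ratr s) t^-1) invrK.
move=> h; apply: cone_partP => //.
by rewrite divr_gt0//= ltr_pdivrMr// mul1r.
Qed.

Lemma cone_part_dil s : 0 < s < 1 ->
  C `&` (fun x => s^-1 *: x) @^-1` P `<=` (fun x => s^-1 *: x) @^-1` C.
Proof.
move=> s01 x [Cx Ps]; have /andP[s0 s1] := s01; split; first exact: cone_partP.
move=> q /andP[q0 q1]; rewrite scalerA -(invfM (ratr q) s); apply: cone_partP => //.
have q0' : 0 < ratr q :> R by rewrite ltr0q.
rewrite mulr_gt0//= (lt_trans _ s1)// gtr_pMl//.
by rewrite -[1](rmorph1 (@ratr R)) ltr_rat.
Qed.

Variables (p : R) (g : 'rV[R]_n -> R) (G : R).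
Hypotheses (p01 : 0 < p < 1) (mg : measurable_fun setT g) (g0 : forall w, 0 <= g w).
Hypotheses (g_gt0 : forall w, enorm w = 1 -> 0 < g w).
Hypotheses (gG : forall w, enorm w = 1 -> g w <= G).
Hypothesis (n0 : (0 < n)%N).

(* With this weight, [potential p (sphere_weight g) x] is the integral of
   [g w * |x . w|^-p] over the sphere. *)
Definition sphere_weight y : R := n%:R * (\1_(@punctured_ball R n) y * g (normalize y)).
Local Notation gam := sphere_weight.
Local Notation W := (potential p gam).

Lemma sphere_weight_ge0 y : 0 <= gam y.
Proof. by rewrite !mulr_ge0// indicE. Qed.

Lemma measurable_sphere_weight : measurable_fun setT gam.
Proof.
apply: measurable_funM => //; apply: measurable_funM.
  by apply: measurable_indic; exact: measurable_punctured_ball.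
exact: (measurableT_comp mg (@measurable_normalize R n)).
Qed.

Lemma sphere_weight_out y : ~ punctured_ball y -> gam y = 0.
Proof. by move=> h; rewrite /gam indicE memNset// mul0r mulr0. Qed.

Lemma integral_sphere_weight_le (H0 H1 : 'rV[R]_n -> \bar R) :
  (forall y, 0 <= H0 y)%E -> measurable_fun setT H0 -> measurable_fun setT H1 ->
  (forall y, y != 0 -> (H0 y <= H1 y)%E) ->
  (\int[lam]_y ((gam y)%:E * H0 y) <= \int[lam]_y ((gam y)%:E * H1 y))%E.
Proof.
move=> H00 mH0 mH1 H01; have mw := measurable_sphere_weight.
apply: ge0_le_integral => //.
- by move=> y _; rewrite mule_ge0 ?lee_fin ?sphere_weight_ge0.
- by apply: emeasurable_funM; first exact/measurable_EFinP.
- by apply: emeasurable_funM; first exact/measurable_EFinP.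
move=> y _; have [By|By] := pselect (punctured_ball y); last first.
  by rewrite sphere_weight_out// !mul0e.
apply: lee_wpmul2l; first by rewrite lee_fin sphere_weight_ge0.
by apply: H01; exact: punctured_ball_neq0.
Qed.

(** [H1] dominates [H0] plus the indicator of [U], and [gam] is positive on [U]; as the smaller
    integral is finite, the added mass gives strictness. *)
Lemma integral_sphere_weight_lt (H0 H1 : 'rV[R]_n -> \bar R) (U : set 'rV[R]_n) :
  (forall y, 0 <= H0 y)%E -> measurable_fun setT H0 -> measurable_fun setT H1 ->
  (forall y, y != 0 -> (H0 y <= H1 y)%E) ->
  measurable U -> U `<=` @punctured_ball R n -> (0 < lam U)%E ->
  (forall y, U y -> (H0 y + 1 <= H1 y)%E) ->
  (\int[lam]_y ((gam y)%:E * H0 y) < +oo)%E ->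
  (\int[lam]_y ((gam y)%:E * H0 y) < \int[lam]_y ((gam y)%:E * H1 y))%E.
Proof.
move=> H00 mH0 mH1 H01 mU UB U0 HU H0fin.
have mgam : measurable_fun setT (fun y => (gam y)%:E).
  exact/measurable_EFinP/measurable_sphere_weight.
have gam0 y : (0 <= (gam y)%:E)%E by rewrite lee_fin sphere_weight_ge0.
have m1U : measurable_fun setT (fun y => (\1_U y : R)%:E) by exact: measurable_eindic.
have mgU : measurable_fun setT (fun y => (gam y)%:E * (\1_U y : R)%:E)%E.
  exact: emeasurable_funM.
apply: (@lt_le_trans _ _ (\int[lam]_y ((gam y)%:E * (H0 y + (\1_U y)%:E)))%E); last first.
  apply: integral_sphere_weight_le => //.
  - by move=> y; rewrite adde_ge0// eindic_ge0.
  - exact: emeasurable_funD.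
  move=> y y0; have [Uy|Uy] := pselect (U y); first by rewrite indicE mem_set//; exact: HU.
  by rewrite indicE memNset// adde0 H01.
rewrite [ltRHS](_ : _ = \int[lam]_y ((gam y)%:E * H0 y + (gam y)%:E * (\1_U y)%:E))%E; last first.
  by apply: eq_integral => y _; rewrite ge0_muleDr ?eindic_ge0.
rewrite ge0_integralD//; last 3 first.
- by move=> y _; rewrite mule_ge0.
- exact: emeasurable_funM.
- by move=> y _; rewrite mule_ge0// eindic_ge0.
rewrite lteDl//; last first.
  by rewrite ge0_fin_numE//; apply: integral_ge0 => y _; rewrite mule_ge0.
rewrite lt_neqAle; apply/andP; split; last first.
  by apply: integral_ge0 => y _; rewrite mule_ge0// eindic_ge0.
rewrite eq_sym; apply/eqP => I0.
have h : (\int[lam]_y `|(gam y)%:E * (\1_U y)%:E| = 0)%E.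
  by rewrite -[RHS]I0; apply: eq_integral => y _; rewrite gee0_abs// mule_ge0// eindic_ge0.
have [N [mN N0 UN]] := (ae_eq_integral_abs lam measurableT mgU).1 h.
have : (lam U <= lam N)%E.
  apply: le_measure; rewrite ?inE//.
  move=> y Uy; apply: UN => /= /(_ I); have By := UB _ Uy.
  rewrite indicE mem_set// mule1 => -[] /eqP.
  rewrite /gam indicE mem_set// mul1r mulf_eq0 pnatr_eq0 eqn0Ngt n0/= gt_eqF//.
  by apply: g_gt0; rewrite enorm_normalize// punctured_ball_neq0.
by rewrite N0 leNgt U0.
Qed.

Lemma integral_sphere_weight_fin : (\int[lam]_y (gam y)%:E < +oo)%E.
Proof.
have G0 : 0 <= n%:R * `|G| :> R by rewrite mulr_ge0.
apply: (@le_lt_trans _ _ (\int[lam]_y ((n%:R * `|G|)%:E * (\1_(@punctured_ball R n) y)%:E))%E).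
  apply: ge0_le_integral => //.
  - by move=> y _; rewrite lee_fin sphere_weight_ge0.
  - exact/measurable_EFinP/measurable_sphere_weight.
  - by apply: emeasurable_funM => //; apply: measurable_eindic; exact: measurable_punctured_ball.
  move=> y _; have [By|By] := pselect (punctured_ball y); last first.
    by rewrite sphere_weight_out// mule_ge0 ?eindic_ge0.
  rewrite -EFinM lee_fin /gam indicE mem_set// mul1r mulr1 ler_wpM2l//.
  by rewrite (le_trans (gG _))// ?ler_norm// enorm_normalize// punctured_ball_neq0.
rewrite ge0_integralZl//; last first.
  by apply: measurable_eindic; exact: measurable_punctured_ball.
rewrite -(measure_integral_indic lam (@measurable_punctured_ball R n)).
apply: lte_mul_pinfty => //.
apply: (@le_lt_trans _ _ (lam (eball 1))); last exact: lebrow_eball_fin.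
apply: le_measure; rewrite ?inE; [exact: measurable_punctured_ball|exact: measurable_eball|].
by move=> y /andP[].
Qed.

Hypothesis (sK : forall x, K x -> K (- x)).
Variables (rho0 R0 : R).
Hypotheses (rho0_gt0 : 0 < rho0) (R0_gt0 : 0 < R0).
Hypotheses (Kr : eball rho0 `<=` K) (KR : K `<=` eball R0).

Lemma potential_eball_fin : (\int[lam]_(x in eball R0) W x < +oo)%E.
Proof.
have [J J0 hJ] := @integral_rpow_eball_le R n p R0 p01.
rewrite (integral_potential p measurable_sphere_weight sphere_weight_ge0 _
  (@measurable_id _ _ setT)); last exact: measurable_eball.
apply: (@le_lt_trans _ _ (\int[lam]_y ((gam y)%:E * J%:E))%E).
  apply: ge0_le_integral => //.
  - move=> y _; rewrite mule_ge0 ?lee_fin ?sphere_weight_ge0//.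
    by apply: integral_ge0 => x _; rewrite lee_fin rpow_ge0.
  - apply: emeasurable_funM; first exact/measurable_EFinP/measurable_sphere_weight.
    by apply: measurable_integral_rpow => //; exact: measurable_eball.
  - by apply: emeasurable_funM => //; exact/measurable_EFinP/measurable_sphere_weight.
  move=> y _; have [By|By] := pselect (punctured_ball y); last first.
    by rewrite sphere_weight_out// !mul0e.
  apply: lee_wpmul2l; first by rewrite lee_fin sphere_weight_ge0.
  by apply: hJ; rewrite enorm_normalize// punctured_ball_neq0.
rewrite ge0_integralZr//; last 2 first.
- exact/measurable_EFinP/measurable_sphere_weight.
- by move=> y _; rewrite lee_fin sphere_weight_ge0.
by rewrite muleC lte_mul_pinfty// integral_sphere_weight_fin.
Qed.

Lemma potential_body_fin : (\int[lam]_(x in K) W x < +oo)%E.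
Proof.
apply: le_lt_trans potential_eball_fin; apply: ge0_subset_integral => //.
- exact: measurable_eball.
- apply: measurable_funTS; apply: measurable_potential; first exact: measurable_sphere_weight.
  exact: sphere_weight_ge0.
- by move=> x _; apply: potential_ge0; exact: sphere_weight_ge0.
Qed.

Lemma measurable_W : measurable_fun setT W.
Proof. exact: measurable_potential measurable_sphere_weight sphere_weight_ge0. Qed.

Lemma body_measure_gt0 : (0 < lam K)%E.
Proof.
apply: (@lt_le_trans _ _ (lam [set x | enorm x < rho0])); last first.
  apply: le_measure; rewrite ?inE//.
    by apply: row_open_measurable; apply: (@open_comp _ _ (@enorm R n) [set t | t < rho0]);
      [move=> y _; exact: continuous_enorm|exact: open_lt].
  by move=> x /= /ltW; exact: Kr.
apply: lebrow_open_gt0; last first.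
  exists 0 => /=; have -> : enorm (0 : 'rV[R]_n) = 0 by apply/eqP; rewrite enorm_eq0.
  by [].
apply: (@open_comp _ _ (@enorm R n) [set t | t < rho0]); last exact: open_lt.
by move=> y _; exact: continuous_enorm.
Qed.

Variables (E B : 'I_n -> 'rV[R]_n) (r q : seq 'I_n).
Hypotheses (dual : forall i j, dotp (E i) (B j) = (i == j)%:R)
  (ur : uniq r) (uq : uniq q) (rq : ~~ has (mem r) q) (sr : size r = \dim xi)
  (full : forall x, x = \sum_(i <- r) dotp x (B i) *: E i
                      + \sum_(i <- q) dotp x (B i) *: E i)
  (span : forall v, v \in xi -> exists c, v = \sum_(i <- r) c i *: B i).
Local Notation D := (partscale E B r).

(** The [B i], [i] in [r], span [xi], so every functional from [xi] sees [D s] as multiplication by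
    [s]. The corresponding [E i] may lie outside [xi]. *)
Lemma dotp_partscale_xi v x s : v \in xi -> dotp (D s x) v = s * dotp x v.
Proof.
move=> /span[c ->]; rewrite !(dotpC _ (\sum_(_ <- _) _)) !dotp_suml mulr_sumr.
rewrite big_seq [RHS]big_seq; apply: eq_bigr => i ir.
by rewrite !dotpZl !(dotpC (B i)) (dotp_partscale dual)// ir mulrCA.
Qed.

Lemma dotp_fiber_xi v i : v \in xi -> i \in q -> dotp (E i) v = 0.
Proof.
move=> /span[c ->] iq; rewrite dotpC dotp_suml big_seq big1// => j jr.
rewrite dotpZl dotpC dual (_ : (i == j) = false) ?mulr0//.
by apply: contraNF (hasPn rq i iq) => /eqP ->.
Qed.

Lemma polar_cylinder_fiber i x t : i \in q -> P x <-> P (x + t *: E i).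
Proof.
move=> iq; split => Px v vxi vK; have := Px v vxi vK;
  by rewrite dotpDl dotpZl dotp_fiber_xi// mulr0 addr0.
Qed.

Lemma polar_cylinder_partscale s x : 0 < s -> P (s^-1 *: D s x) <-> P x.
Proof.
move=> s0; split => Px v vxi vK; have := Px v vxi vK;
  by rewrite dotpZl dotp_partscale_xi// mulKf// gt_eqF.
Qed.

Let fiber_ineq Q s y : measurable Q ->
  (forall i, i \in q -> forall x t, Q x -> Q (x + t *: E i)) -> 0 < s <= 1 -> y != 0 ->
  (\int[lam]_(x in Q `&` K) (rpow p (dotp x (normalize y)))%:E <=
   \int[lam]_(x in Q `&` D s @^-1` K) (rpow p (dotp (D s x) (normalize y)))%:E)%E.
Proof.
move=> mQ hQ s01 y0; apply: (weighted_fiber_le dual ur uq rq full) => //.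
- by case/andP: p01.
- by rewrite -enorm_gt0 enorm_normalize.
Qed.

Let measurable_Q Q s : measurable Q -> measurable (Q `&` D s @^-1` K).
Proof.
move=> mQ; apply: measurableI => //; apply: measurable_preimage => //.
exact: measurable_partscale.
Qed.

Lemma potential_fiber_le Q s : measurable Q ->
  (forall i, i \in q -> forall x t, Q x -> Q (x + t *: E i)) -> 0 < s <= 1 ->
  (\int[lam]_(x in Q `&` K) W x <= \int[lam]_(x in Q `&` D s @^-1` K) W (D s x))%E.
Proof.
move=> mQ hQ s01.
have mQK : measurable (Q `&` K) by exact: measurableI.
have mQD := @measurable_Q Q s mQ.
have mD : measurable_fun setT (D s) by exact: measurable_partscale.
have mw := measurable_sphere_weight.
rewrite (integral_potential p mw sphere_weight_ge0 mQK (@measurable_id _ _ setT)).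
rewrite (integral_potential p mw sphere_weight_ge0 mQD mD).
apply: integral_sphere_weight_le.
- by move=> y; apply: integral_ge0 => x _; rewrite lee_fin rpow_ge0.
- exact: measurable_integral_rpow.
- exact: measurable_integral_rpow.
- by move=> y y0; exact: fiber_ineq.
Qed.

Hypothesis xi0 : (0 < \dim xi)%N.

Lemma xi_unit : exists2 w, w \in xi & enorm w = 1.
Proof.
have xi_neq0 : vpick xi != 0 by rewrite vpick0 -dimv_eq0 -lt0n.
exists (normalize (vpick xi)); last exact: enorm_normalize.
by rewrite memvZ// memv_pick.
Qed.

(** Both [w / R0] and [-w / R0] are functionals from [xi] bounded by [1] on [K]. *)
Lemma polar_cylinder_bound w x : w \in xi -> enorm w = 1 -> P x -> `|dotp x w| <= R0.
Proof.
move=> wxi w1 Px.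
have KwR y : K y -> `|dotp y w| <= R0.
  move=> /KR yR; apply: le_trans (ler_dotp y w) _; rewrite w1 mulr1; exact: yR.
have h (e : R) : `|e| = 1 -> dotp x (e *: w) <= R0.
  move=> e1; have : dotp x (R0^-1 *: (e *: w)) <= 1.
    apply: Px; first by rewrite !memvZ.
    move=> y Ky; rewrite dotpZr mulrC ler_pdivrMr// mul1r dotpZr.
    by rewrite (le_trans (ler_norm _))// normrM e1 mul1r KwR.
  by rewrite (dotpZr R0^-1) mulrC (ler_pdivrMr _ _ R0_gt0) mul1r.
rewrite ler_norml; apply/andP; split.
  by rewrite lerNl -dotpNr -scaleN1r; apply: h; rewrite normrN1.
by rewrite -[w]scale1r; apply: h; rewrite normr1.
Qed.

Lemma small_rpow (M : R) : exists2 d, 0 < d < 1 & M < rpow p (R0 *+ 2 * d).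
Proof.
have /andP[p0 _] := p01.
(* With [d = t / (2 R0) <= 1/2], the argument [2 R0 d = t] is small enough for [t^-p >= |M| + 1]. *)
pose t := Num.min R0 ((`|M| + 1) `^ (- p^-1)).
have M1 : 0 < `|M| + 1 by rewrite ltr_wpDl.
have t0 : 0 < t by rewrite lt_min R0_gt0 powR_gt0.
have R2 : 0 < R0 *+ 2 by rewrite mulrn_wgt0.
exists (t / (R0 *+ 2)).
  rewrite divr_gt0//= ltr_pdivrMr// mul1r mulr2n.
  by rewrite (@le_lt_trans _ _ R0)// ?ge_min ?lexx// ltrDl.
rewrite mulrC divfK ?gt_eqF//; apply: (@lt_le_trans _ _ (`|M| + 1)).
  by rewrite (le_lt_trans (ler_norm M))// ltrDl.
have rM (m : R) : 0 < m -> rpow p (m `^ (- p^-1)) = m.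
  move=> m0; rewrite /rpow ger0_norm ?powR_ge0// -powRrM mulrNN mulVf ?gt_eqF//.
  by rewrite powRr1// ltW.
rewrite -[leLHS](rM _ M1).
apply: ler_rpow; [exact: ltW|by rewrite gtr0_norm|].
rewrite gtr0_norm// ger0_norm ?powR_ge0//.
by rewrite ge_min lexx orbT.
Qed.

(* For [w] in the cap of radius [d] about a unit vector of [xi], [|D d x . w|] is
   at most [2 R0 d] on the cylinder, which makes the right-hand side large. *)
Lemma potential_strict : exists2 d, 0 < d < 1 &
  (\int[lam]_(x in K) W x < \int[lam]_(x in P `&` D d @^-1` K) W (D d x))%E.
Proof.
have [w0 w0xi w01] := xi_unit; have [J J0 hJ] := @integral_rpow_eball_le R n p R0 p01.
have /andP[p0 p1] := p01.
have lamK : lam K \is a fin_num.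
  rewrite ge0_fin_numE ?measure_ge0//; apply: le_lt_trans (lebrow_eball_fin R0).
  by apply: le_measure; rewrite ?inE//; exact: measurable_eball.
pose k := fine (lam K); have k0 : 0 < k.
  by rewrite -lte_fin fineK// body_measure_gt0.
have [d d01 hd] := small_rpow ((J + 1) / k); exists d => //; have /andP[d0 d1] := d01.
have mP := measurable_polar_cylinder.
have mPD := @measurable_Q P d mP.
have mD : measurable_fun setT (D d) by exact: measurable_partscale.
have mw := measurable_sphere_weight.
have PK : P `&` K = K.
  apply/seteqP; split => x; first by case.
  by move=> Kx; split=> //; exact: sub_polar_cylinder.
have hP i : i \in q -> forall x t, P x -> P (x + t *: E i).
  by move=> iq x t /(polar_cylinder_fiber _ _ iq); apply.
have d01' : 0 < d <= 1 by rewrite d0 ltW.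
set U := punctured_ball `&` [set y | enorm (normalize y - w0) <= d].
have U0 := lebrow_cap_gt0 w01 d0; rewrite -/U in U0.
have mU : measurable U.
  apply: measurableI; first exact: measurable_punctured_ball.
  rewrite (_ : mkset _ = (fun y => enorm (normalize y - w0)) @^-1` `]-oo, d]).
    apply: measurable_preimage => //.
    apply: (measurableT_comp (@measurable_enorm R n)).
    exact: (measurableT_comp (measurable_shift (- w0)) (@measurable_normalize R n)).
  by apply/seteqP; split => y /=; rewrite in_itv.
pose H0 y := (\int[lam]_(x in K) (rpow p (dotp x (normalize y)))%:E)%E.
pose H1 y := (\int[lam]_(x in P `&` D d @^-1` K) (rpow p (dotp (D d x) (normalize y)))%:E)%E.
have H0_ge0 y : (0 <= H0 y)%E by apply: integral_ge0 => x _; rewrite lee_fin rpow_ge0.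
have H01 y : y != 0 -> (H0 y <= H1 y)%E.
  by move=> y0; rewrite /H0 -{1}PK; exact: fiber_ineq.
(* On the cap [H0 <= J]. By [fiber_le] the domain of [H1] has at least the volume [k] of [K], and
   its integrand is at least [rpow p (2 R0 d) > (J + 1) / k] almost everywhere. *)
have HU y : U y -> (H0 y + 1 <= H1 y)%E.
  move=> [By /= yw]; have y0 := punctured_ball_neq0 By.
  have ny := enorm_normalize y0.
  apply: (@le_trans _ _ (J + 1)%:E).
    rewrite EFinD leeD2r//; apply: le_trans (hJ _ ny).
    apply: ge0_subset_integral => //; first exact: measurable_eball.
      apply/measurable_EFinP; apply: measurable_funTS.
      exact: (measurableT_comp (measurable_rpow p) (measurable_dotpl (normalize y))).
    by move=> x _; rewrite lee_fin rpow_ge0.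
  apply: (@le_trans _ _ (\int[lam]_(x in P `&` D d @^-1` K) (rpow p (R0 *+ 2 * d))%:E)%E).
    rewrite integral_cst//; apply: (@le_trans _ _ ((rpow p (R0 *+ 2 * d))%:E * lam K)%E).
      by rewrite -(fineK lamK) -EFinM lee_fin -ler_pdivrMr// ltW.
    apply: lee_wpmul2l; first by rewrite lee_fin rpow_ge0.
    by rewrite -{1}PK; apply: (fiber_le dual uq rq full) => //; rewrite (ltW d0) ltW.
  rewrite /H1.
  (* On [Z] the integrand takes the default value [0] and the lower bound fails; this null set is
     removed. *)
  pose Z := D d @^-1` [set x | dotp x (normalize y) = 0].
  have mZ0 : measurable [set x | dotp x (normalize y) = 0].
    apply: (@measurable_preimage _ _ _ _ (fun x => dotp x (normalize y)) [set 0]) => //.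
    exact: measurable_dotpl.
  have mZ : measurable Z by exact: measurable_preimage.
  have Zn : lam Z = 0%E.
    apply: (negligible_partscale dual ur d0 mZ0).
    by apply: negligible_hyperplane; rewrite -enorm_gt0 ny.
  have mF : measurable_fun setT (fun x => (rpow p (dotp (D d x) (normalize y)))%:E).
    apply/measurable_EFinP.
    apply: (measurableT_comp (measurable_rpow p)).
    exact: (measurableT_comp (measurable_dotpl (normalize y)) mD).
  have neg F : measurable_fun setT F -> (forall x, (0 <= F x)%E) ->
      (\int[lam]_(x in P `&` D d @^-1` K) F x =
       \int[lam]_(x in (P `&` D d @^-1` K) `\` Z) F x)%E.
    by move=> mF' F0; apply: ge0_negligible_integral => //; exact: measurable_funTS.
  rewrite (neg _ mF) => [|x]; last by rewrite lee_fin rpow_ge0.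
  rewrite (neg (fun=> (rpow p (R0 *+ 2 * d))%:E)) => [||x]//; last by rewrite lee_fin rpow_ge0.
  apply: ge0_le_integral => //.
  - by apply: measurableD.
  - by move=> x _; rewrite lee_fin rpow_ge0.
  - by apply: measurable_funTS.
  move=> x [[Px KDx] nZ]; rewrite lee_fin; apply: ler_rpow; first exact: ltW.
    by rewrite normr_gt0; apply/eqP.
  rewrite [leRHS]ger0_norm ?mulr_ge0 ?mulrn_wge0 ?(ltW d0) ?(ltW R0_gt0)//.
  (* Splitting off [w0] bounds the product by [d |x . w0| + |D d x| d <= 2 R0 d]. *)
  have -> : normalize y = w0 + (normalize y - w0) by rewrite addrC subrK.
  rewrite dotpDr (le_trans (ler_normD _ _))// dotp_partscale_xi// normrM gtr0_norm//.
  have h1 := polar_cylinder_bound w0xi w01 Px.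
  have h2 : `|dotp (D d x) (normalize y - w0)| <= R0 * d.
    apply: le_trans (ler_dotp _ _) _; apply: ler_pM; rewrite ?enorm_ge0//.
    exact: KR.
  by rewrite mulrnAl mulr2n lerD// [leLHS]mulrC ler_wpM2r// ltW.
rewrite (integral_potential p mw sphere_weight_ge0 mPD mD).
rewrite (integral_potential p mw sphere_weight_ge0 mK (@measurable_id _ _ setT)).
apply: (integral_sphere_weight_lt (U := U)) => //.
- exact: (measurable_integral_rpow p mK (@measurable_id _ _ setT)).
- exact: measurable_integral_rpow.
- by move=> y [].
- have := potential_body_fin.
  by rewrite (integral_potential p mw sphere_weight_ge0 mK (@measurable_id _ _ setT)).
Qed.

Lemma body_ineq :
  (n%:R - p) * fine (\int[lam]_(x in C) W x) < (\dim xi)%:R * fine (\int[lam]_(x in K) W x).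
Proof.
have /andP[p0 p1] := p01.
have [d d01 hd] := potential_strict.
rewrite -sr; apply: (@core_ineq _ _ p W measurable_W _ _ E B dual r ur K P C mK
  measurable_polar_cylinder measurable_cone_part _ _ _ _ _ _ _ d d01 hd).
- by move=> x; apply: potential_ge0; exact: sphere_weight_ge0.
- move=> s x s0; apply: potentialZ => //; first exact: measurable_sphere_weight.
  exact: sphere_weight_ge0.
- by move=> s x s0; exact: polar_cylinder_partscale.
- move=> s /andP[s0 s1] x /= Px; rewrite -[x](scalerKV (a := s)) ?gt_eqF//.
  by apply: polar_cylinder_star => //; rewrite (ltW s0).
- exact: sub_polar_cylinder.
- by move=> x [].
- exact: cone_part_dil.
- move=> s l s01 l01; apply: potential_fiber_le => //.
    by apply: measurableD; [|apply: measurable_dil]; exact: measurable_polar_cylinder.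
  move=> i iq x t [Px nPx]; split; first exact/(polar_cylinder_fiber x t iq).
  move=> h; apply: nPx; move: h => /=; rewrite scalerDr scalerA.
  by move=> h; apply/(polar_cylinder_fiber (l^-1 *: x) (l^-1 * t) iq).
- exact: potential_body_fin.
- by rewrite sr.
- by rewrite (lt_le_trans p1)// ler1n.
Qed.

End body.

Lemma indic_in {R : realType} (T : Type) (A : set T) x : A x -> \1_A x = 1 :> R.
Proof. by move=> Ax; rewrite indicE mem_set. Qed.

Lemma indic_out {R : realType} (T : Type) (A : set T) x : ~ A x -> \1_A x = 0 :> R.
Proof. by move=> Ax; rewrite indicE memNset. Qed.

(** * Polar coordinates *)

Section polar.
Context {R : realType} {n : nat}.
Local Notation lam := (@lebrow R n).
Implicit Types (x : 'rV[R]_n).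

Lemma measurable_ler d (T : measurableType d) (f g : T -> R) :
  measurable_fun setT f -> measurable_fun setT g -> measurable [set t | f t <= g t].
Proof.
move=> mf mg; rewrite (_ : mkset _ = (fun t => g t - f t) @^-1` `[0, +oo[).
  by apply: measurable_preimage => //; exact: measurable_funB.
by apply/seteqP; split => t /=; rewrite in_itv/= andbT subr_ge0.
Qed.

Lemma measurable_ltr d (T : measurableType d) (f g : T -> R) :
  measurable_fun setT f -> measurable_fun setT g -> measurable [set t | f t < g t].
Proof.
move=> mf mg; rewrite (_ : mkset _ = ~` [set t | g t <= f t]).
  by apply: measurableC; exact: measurable_ler.
by apply/seteqP; split => t /=; rewrite ltNge => /negP.
Qed.

Lemma integral_powR_tail (a c : R) : 0 < a -> 0 < c ->
  (\int[@lebesgue_measure R]_s ((s `^ (- (a + 1)))%:E * (\1_(`[c, +oo[%classic : set R) s)%:E)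
   = (c `^ (- a) / a)%:E)%E.
Proof.
move=> a0 c0.
have mf b : measurable_fun setT (fun s : measurableTypeR R => (s `^ (- (a + 1)))%:E *
    (\1_(`[b, +oo[%classic : set R) s : R)%:E)%E.
  apply: emeasurable_funM; first by apply/measurable_EFinP; exact: measurable_powR.
  exact: measurable_eindic.
have f0 b s : (0 <= (s `^ (- (a + 1)))%:E * (\1_(`[b, +oo[%classic : set R) s : R)%:E)%E.
  by rewrite mule_ge0 ?eindic_ge0// lee_fin powR_ge0.
rewrite -[LHS](ge0_integral_affine 0 c0 (mf c) (f0 c)).
transitivity (c%:E * ((c `^ (- (a + 1)))%:E * \int[@lebesgue_measure R]_s
    ((s `^ (- (a + 1)))%:E * (\1_(`[1, +oo[%classic : set R) s)%:E)))%E.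
  congr (_ * _)%E; rewrite -ge0_integralZl//; last first.
    by rewrite lee_fin powR_ge0.
  apply: eq_integral => s _; rewrite addr0 !indicE.
  have [s1|s1] := leP 1 s.
    rewrite !mem_set/= ?in_itv/= ?s1 ?andbT ?ler_pMr//.
    by rewrite !mule1 -EFinM powRM// ?(ltW c0)// (le_trans ler01).
  by rewrite !memNset/= ?in_itv/= ?leNgt ?s1 ?andbT ?gtr_pMr ?s1// ?mule0.
rewrite -integral_indicE integral_powR// muleA -!EFinM; congr EFin.
rewrite -[X in X * _ / _]powRr1 ?ltW// -powRD; last by rewrite (gt_eqF c0) implybT.
by congr (_ `^ _ / _); ring.
Qed.

Variables (F : 'rV[R]_n -> \bar R) (rho : 'rV[R]_n -> R) (a : R).
Hypotheses (a0 : 0 < a) (mF : measurable_fun setT F) (mrho : measurable_fun setT rho).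
Hypotheses (F0 : forall x, (0 <= F x)%E) (FZ : forall t x, 0 < t -> F (t *: x) = F x).
Hypotheses (rhoZ : forall t x, 0 < t -> rho (t *: x) = rho x).
Hypotheses (rho_gt0 : forall x, x != 0 -> 0 < rho x).

(** [A2] is [A1] after [x -> x / s]: [s |x| <= 1] becomes [|x| <= 1], and [|x| <= rho x] becomes
    [|x| <= s rho x]. *)
Let A1 := [set z : 'rV[R]_n * measurableTypeR R |
  [/\ 0 < enorm z.1, enorm z.1 <= rho z.1, 0 < z.2 & z.2 * enorm z.1 <= 1]].
Let A2 := [set z : 'rV[R]_n * measurableTypeR R |
  [/\ 0 < enorm z.1, enorm z.1 <= 1, 0 < z.2 & enorm z.1 <= z.2 * rho z.1]].

Let me1 : measurable_fun setT (fun z : 'rV[R]_n * measurableTypeR R => enorm z.1).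
Proof. exact: (measurableT_comp (@measurable_enorm R n) measurable_fst). Qed.

Let mr1 : measurable_fun setT (fun z : 'rV[R]_n * measurableTypeR R => rho z.1).
Proof. exact: (measurableT_comp mrho measurable_fst). Qed.

Let m2 : measurable_fun setT (fun z : 'rV[R]_n * measurableTypeR R => z.2 : R).
Proof. exact: measurable_snd. Qed.

Let and4E (T : Type) (P Q S U : set T) :
  [set z | [/\ P z, Q z, S z & U z]] = P `&` Q `&` S `&` U.
Proof. by apply/seteqP; split => z /= [] => [? ? ? ?|[[? ?] ?] ?]; split. Qed.

Let mA1 : measurable A1.
Proof.
rewrite [A1]and4E; apply: measurableI; first apply: measurableI; first apply: measurableI.
- exact: measurable_ltr.
- exact: measurable_ler.
- exact: measurable_ltr.
- by apply: measurable_ler => //; exact: measurable_funM.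
Qed.

Let mA2 : measurable A2.
Proof.
rewrite [A2]and4E; apply: measurableI; first apply: measurableI; first apply: measurableI.
- exact: measurable_ltr.
- exact: measurable_ler.
- exact: measurable_ltr.
- by apply: measurable_ler => //; exact: measurable_funM.
Qed.

Let Phi (z : 'rV[R]_n * measurableTypeR R) : \bar R :=
  (F z.1 * ((enorm z.1 `^ (a - n%:R + 1))%:E * (\1_A1 z)%:E))%E.
(** The power [s^-(a+1)] collects [s^-n] from the Jacobian and [s^-(a-n+1)] from the power of
    [|x|]. *)
Let Psi (z : 'rV[R]_n * measurableTypeR R) : \bar R :=
  (F z.1 * ((enorm z.1 `^ (a - n%:R + 1))%:E * ((z.2 `^ (- (a + 1)))%:E * (\1_A2 z)%:E)))%E.

Let mPhi : measurable_fun setT Phi.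
Proof.
apply: emeasurable_funM; first exact: (measurableT_comp mF measurable_fst).
apply: emeasurable_funM; last exact: measurable_eindic.
by apply/measurable_EFinP; exact: (measurableT_comp (measurable_powR _) me1).
Qed.

Let mPsi : measurable_fun setT Psi.
Proof.
apply: emeasurable_funM; first exact: (measurableT_comp mF measurable_fst).
apply: emeasurable_funM.
  by apply/measurable_EFinP; exact: (measurableT_comp (measurable_powR _) me1).
apply: emeasurable_funM; last exact: measurable_eindic.
by apply/measurable_EFinP; exact: (measurableT_comp (measurable_powR _) m2).
Qed.

Let Phi0 z : (0 <= Phi z)%E.
Proof. by rewrite !mule_ge0 ?eindic_ge0// lee_fin powR_ge0. Qed.

Let Psi0 z : (0 <= Psi z)%E.
Proof. by rewrite !mule_ge0 ?eindic_ge0// lee_fin powR_ge0. Qed.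

Let Phi_out z : ~ A1 z -> Phi z = 0%E.
Proof. by move=> h; rewrite /Phi indicE memNset// mule0 mule0. Qed.

Let Psi_out z : ~ A2 z -> Psi z = 0%E.
Proof. by move=> h; rewrite /Psi indicE memNset// mule0 mule0 mule0. Qed.

Let polar_left x : (F x * ((enorm x `^ (a - n%:R))%:E *
    (\1_[set x | (0 < enorm x <= rho x)%R] x)%:E) =
  \int[@lebesgue_measure R]_s Phi (x, s))%E.
Proof.
have [/andP[x0 x1]|hx] := pselect (0 < enorm x <= rho x); last first.
  have -> : (\int[@lebesgue_measure R]_s Phi (x, s) = 0)%E.
    apply: integral0_eq => s _; apply: Phi_out.
    move=> -[h1 h2 _ _]; apply: hx.
    by rewrite h1.
  rewrite (indic_out (A := [set x | 0 < enorm x <= rho x]) hx) mule0 mule0.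
  exact: erefl.
have hx : 0 < enorm x <= rho x by apply/andP; split; [exact: x0|exact: x1].
rewrite (indic_in (A := [set x | 0 < enorm x <= rho x]) hx) mule1.
transitivity (F x * ((enorm x `^ (a - n%:R + 1))%:E *
    \int[@lebesgue_measure R]_s (\1_(`]0, (enorm x)^-1]%classic : set R) s)%:E))%E.
  rewrite integral_indic// setIT [X in (_ * (_ * X))%E](lebesgue_measure_itv `]0, _]) /=.
  rewrite lte_fin invr_gt0 x0 sube0 -EFinM; congr (_ * _%:E)%E.
  by rewrite [in RHS]powRD ?(gt_eqF x0) ?implybT// powRr1 ?enorm_ge0// mulfK// gt_eqF.
rewrite -ge0_integralZl//; last 2 first.
- exact: measurable_eindic.
- by rewrite lee_fin powR_ge0.
have mI : measurable_fun setT (fun s : measurableTypeR R => (enorm x `^ (a - n%:R + 1))%:E *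
    (\1_(`]0, (enorm x)^-1]%classic : set R) s)%:E)%E.
  by apply: emeasurable_funM => //; exact: measurable_eindic.
rewrite -ge0_integralZl//; last first.
  by move=> s _; rewrite mule_ge0 ?eindic_ge0// lee_fin powR_ge0.
apply: eq_integral => s _; rewrite /Phi/=; congr (_ * (_ * _))%E.
apply: eindic_eq; rewrite /A1/= in_itv/=.
rewrite -[(enorm x)^-1]mul1r ler_pdivlMr//.
by split => [/andP[]|[? ? -> ->]].
Qed.

(** The section of [A2] is [s >= |x| / rho x], over which [s^-(a+1)] integrates to
    [(|x| / rho x)^-a / a]. *)
Let polar_right x : (\int[@lebesgue_measure R]_s Psi (x, s) =
  (a^-1)%:E * (F x * ((enorm x `^ (1 - n%:R) * rho x `^ a)%:E *
     (\1_(@punctured_ball R n) x)%:E)))%E.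
Proof.
have [Bx|Bx] := pselect (punctured_ball x); last first.
  have -> : (\int[@lebesgue_measure R]_s Psi (x, s) = 0)%E.
    apply: integral0_eq => s _; apply: Psi_out.
    move=> -[h1 h2 _ _]; apply: Bx.
    by rewrite /punctured_ball/= h1.
  rewrite (indic_out Bx) mule0 mule0 mule0; exact: erefl.
have xn0 := punctured_ball_neq0 Bx; have /andP[x0 x1] := Bx.
have r0 := rho_gt0 xn0.
rewrite (indic_in Bx) mule1.
have c0 : 0 < enorm x / rho x by rewrite divr_gt0.
have mT : measurable_fun setT (fun s : measurableTypeR R => (s `^ (- (a + 1)))%:E *
    (\1_(`[enorm x / rho x, +oo[%classic : set R) s : R)%:E)%E.
  apply: emeasurable_funM; first by apply/measurable_EFinP; exact: measurable_powR.
  exact: measurable_eindic.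
have T0 s : (0 <= (s `^ (- (a + 1)))%:E *
    (\1_(`[enorm x / rho x, +oo[%classic : set R) s : R)%:E)%E.
  by rewrite mule_ge0 ?eindic_ge0// lee_fin powR_ge0.
transitivity (F x * ((enorm x `^ (a - n%:R + 1))%:E * \int[@lebesgue_measure R]_s
    ((s `^ (- (a + 1)))%:E * (\1_(`[enorm x / rho x, +oo[%classic : set R) s)%:E)))%E.
  rewrite -ge0_integralZl//; last by rewrite lee_fin powR_ge0.
  rewrite -ge0_integralZl//; last 2 first.
  - by apply: emeasurable_funM.
  - by move=> s _; rewrite mule_ge0// lee_fin powR_ge0.
  apply: eq_integral => s _; rewrite /Psi/=; congr (_ * (_ * (_ * _)))%E.
  apply: eindic_eq; rewrite /A2/= in_itv/= andbT ler_pdivrMr//.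
  split => [[]//|h]; split => //.
  by rewrite -(pmulr_lgt0 _ r0) (lt_le_trans x0).
rewrite integral_powR_tail// [RHS]muleCA; congr (_ * _)%E; rewrite -!EFinM; congr EFin.
rewrite mulrA mulrC; congr (_ * _).
rewrite powRM ?enorm_ge0// ?invr_ge0 ?(ltW r0)// -powR_inv1 ?(ltW r0)// -powRrM mulN1r opprK.
rewrite mulrA -powRD ?(gt_eqF x0) ?implybT//.
by congr (_ `^ _ * _); ring.
Qed.

(* Insert [|x| int_s 1(0 < s |x| <= 1) ds = 1], exchange the integrals, and
   replace [x] by [x / s]. *)
Lemma polar_scale :
  (\int[lam]_x (F x * ((enorm x `^ (a - n%:R))%:E * (\1_[set x | (0 < enorm x <= rho x)%R] x)%:E)) =
   (a^-1)%:E * \int[lam]_x (F x * ((enorm x `^ (1 - n%:R) * rho x `^ a)%:E *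
     (\1_(@punctured_ball R n) x)%:E)))%E.
Proof.
rewrite -ge0_integralZl; first last.
- by rewrite lee_fin invr_ge0 ltW.
- by move=> x _; rewrite !mule_ge0 ?eindic_ge0// lee_fin mulr_ge0// powR_ge0.
- apply: emeasurable_funM => //; apply: emeasurable_funM.
    apply/measurable_EFinP; apply: measurable_funM.
      by apply: (measurableT_comp (measurable_powR _)); exact: measurable_enorm.
    exact: (measurableT_comp (measurable_powR _) mrho).
  by apply: measurable_eindic; exact: measurable_punctured_ball.
- exact: measurableT.
transitivity (\int[lam]_x \int[@lebesgue_measure R]_s Phi (x, s))%E.
  by apply: eq_integral => x _; exact: polar_left.
transitivity (\int[lam]_x \int[@lebesgue_measure R]_s Psi (x, s))%E; last first.
  by apply: eq_integral => x _; exact: polar_right.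
rewrite (tonelli_row mPhi Phi0) (tonelli_row mPsi Psi0).
apply: eq_integral => s _.
have [s0|s0] := ltP 0 s; last first.
  rewrite integral0_eq => [|x _]; last first.
    by apply: Phi_out => -[_ _]; rewrite ltNge s0.
  rewrite integral0_eq// => x _.
  by apply: Psi_out => -[_ _]; rewrite ltNge s0.
have si0 : 0 < s^-1 by rewrite invr_gt0.
rewrite -[LHS](ge0_integral_homothety si0); last 2 first.
- exact: (measurableT_comp mPhi (pair2_measurable s)).
- by move=> x; exact: Phi0.
rewrite -ge0_integralZl//; last 2 first.
- apply: (measurableT_comp (measurableT_comp mPhi (pair2_measurable s))).
  exact: measurable_scale.
- by rewrite lee_fin exprn_ge0// ltW.
apply: eq_integral => x _; rewrite /Phi /Psi/= FZ// muleCA; congr (_ * _)%E.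
have -> : (\1_A1 (s^-1 *: x, s))%:E = (\1_A2 (x, s))%:E :> \bar R.
  apply: eindic_eq; rewrite /A1 /A2 /= rhoZ// enormZ gtr0_norm// pmulr_rgt0//.
  rewrite mulVKf ?gt_eqF// ler_pdivrMl//.
  by split => -[].
rewrite !muleA; congr (_ * _)%E; rewrite -!EFinM; congr EFin.
rewrite enormZ gtr0_norm// powRM ?enorm_ge0 ?(ltW si0)// mulrA mulrC; congr (_ * _).
rewrite -powR_mulrn ?(ltW si0)// -powR_inv1 ?(ltW s0)// -!powRrM -powRD; last first.
  by rewrite (gt_eqF s0) implybT.
by congr (_ `^ _); ring.
Qed.

End polar.

(* Compare [polar_scale] for [(F, rho, a)] with its instance [(F rho^a, 1, n)]. *)
Lemma polar_ball {R : realType} {n : nat} (F : 'rV[R]_n -> \bar R) (rho : 'rV[R]_n -> R) (a : R) :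
  (0 < n)%N -> 0 < a -> measurable_fun setT F -> measurable_fun setT rho ->
  (forall x, (0 <= F x)%E) -> (forall t x, 0 < t -> F (t *: x) = F x) ->
  (forall t x, 0 < t -> rho (t *: x) = rho x) -> (forall x, x != 0 -> 0 < rho x) ->
  (n%:R%:E * \int[@lebrow R n]_x (F x * (rho x `^ a)%:E * (\1_(@punctured_ball R n) x)%:E) =
   a%:E * \int[@lebrow R n]_x (F x * ((enorm x `^ (a - n%:R))%:E *
      (\1_[set x | (0 < enorm x <= rho x)%R] x)%:E)))%E.
Proof.
move=> n0 a0 mF mrho F0 FZ rhoZ rho0; have nR0 : 0 < n%:R :> R by rewrite ltr0n.
rewrite (polar_scale a0 mF mrho F0 FZ rhoZ rho0).
rewrite muleA -EFinM divff ?gt_eqF// mul1e.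
have mFr : measurable_fun setT (fun x => F x * (rho x `^ a)%:E)%E.
  apply: emeasurable_funM => //; apply/measurable_EFinP.
  exact: (measurableT_comp (measurable_powR _) mrho).
have := @polar_scale R n (fun x => F x * (rho x `^ a)%:E)%E (fun=> 1) n%:R nR0 mFr
  (@measurable_cst _ _ _ _ _ _) _ _ _ _.
have c1 x : (0 <= F x * (rho x `^ a)%:E)%E by rewrite mule_ge0// lee_fin powR_ge0.
have c2 t x : 0 < t -> (F (t *: x) * (rho (t *: x) `^ a)%:E = F x * (rho x `^ a)%:E)%E.
  by move=> t0; rewrite FZ// rhoZ.
move=> /(_ c1 c2 (fun _ _ _ => erefl) (fun _ _ => ltr01)).
rewrite subrr => h.
transitivity (n%:R%:E * \int[@lebrow R n]_x (F x * (rho x `^ a)%:E * ((enorm x `^ 0)%:E *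
   (\1_[set x | (0 < enorm x <= 1)%R] x)%:E)))%E.
  by congr (_ * _)%E; apply: eq_integral => x _; rewrite powRr0 mul1e.
rewrite h muleA -EFinM divff ?gt_eqF// mul1e.
apply: eq_integral => x _; rewrite powR1 mulr1 EFinM -!muleA; congr (_ * _)%E.
by rewrite muleCA.
Qed.

(** * Supporting hyperplanes and radial functions *)

Section separation.
Context {R : realType} {n : nat}.
Implicit Types (K : set 'rV[R]_n) (x y z v w : 'rV[R]_n).

Lemma sphere_compact : compact (@sphere R n).
Proof.
apply: bounded_closed_compact.
  exists 1; split; first exact: num_real.
  move=> M M1 x x1; apply: ltW; apply: le_lt_trans M1.
  rewrite -[X in _ <= X]x1.
  have [->|x0] := eqVneq `|x| 0; first exact: enorm_ge0.
  have /mx_norm_neq0[[i j] /= xij] : mx_norm x != 0 by [].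
  by rewrite [leLHS]xij ord1; exact: ler_coord_enorm.
rewrite (_ : sphere = @enorm R n @^-1` [set 1]); last by [].
by have /continuous_closedP := @continuous_enorm R n; apply; exact: closed_eq.
Qed.

(** Let [m] be the point of [K] nearest to [z]. Were [(x - m) . (z - m) > 0], a short step from [m]
    towards [x] would come closer to [z]. *)
Lemma nearest_point_separation K z : compact K -> K !=set0 -> vconvex K -> ~ K z ->
  exists v, enorm v = 1 /\ forall x, K x -> dotp x v <= dotp z v.
Proof.
move=> coK K0 cK nKz.
have [|m Km hm] := @EVT_min_rV R n (fun x => enorm (x - z)) K K0 coK.
  apply: continuous_subspaceT; apply: continuous_enorm2 => x.
  by apply: (@continuousB _ _ _ id (fun=> z)); [exact: cvg_id|exact: cst_continuous].
rewrite inE in Km.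
have mz : z - m != 0 by apply: contra_notN nKz => /eqP; move/subr0_eq => ->.
exists (normalize (z - m)); split; first exact: enorm_normalize.
have key x : K x -> dotp (x - m) (z - m) <= 0.
  move=> Kx; rewrite leNgt; apply/negP => pos.
  set a := dotp (x - m) (z - m) in pos; set b := dotp (x - m) (x - m).
  have b0 : 0 <= b by exact: dotp_ge0.
  (* The squared distance changes by [t (t b - 2 a)], negative for this [t]; [b + 1] avoids division
     by [0]. *)
  pose t := Num.min 1 (a / (b + 1)).
  have t0 : 0 < t by rewrite lt_min ltr01 divr_gt0// ltr_wpDl.
  have t1 : t <= 1 by rewrite ge_min lexx.
  have Kt : K (t *: x + (1 - t) *: m) by apply: cK => //; rewrite (ltW t0).
  have := hm (t *: x + (1 - t) *: m); rewrite inE => /(_ Kt).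
  rewrite -ler_sqr ?nnegrE ?enorm_ge0// !enorm_sqr.
  have -> : t *: x + (1 - t) *: m - z = t *: (x - m) - (z - m).
    by apply/rowP => i; rewrite !mxE; ring.
  rewrite -(opprB z m) dotpNl dotpNr opprK.
  have tb : t * (b + 1) <= a.
    by rewrite -ler_pdivlMr ?ltr_wpDl// ge_min lexx orbT.
  have tb2 : t * b < 2 * a.
    rewrite (@lt_le_trans _ _ (t * (b + 1)))// ?ltr_pM2l ?ltrDl//; lra.
  move: (x - m) (z - m) @a @b pos b0 @t t0 t1 Kt tb tb2 => u w a b pos b0 t t0 t1 _ _ tb2.
  rewrite !(dotpBl, dotpBr) !dotpZl !dotpZr (dotpC w u) -/a -/b => h.
  have : t * (t * b - 2 * a) < 0 by rewrite pmulr_rlt0// subr_lt0.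
  by rewrite mulrBr; lra.
move=> x Kx; rewrite /normalize !dotpZr ler_wpM2l ?invr_ge0 ?enorm_ge0//.
have := key x Kx; rewrite dotpBl => h.
have := dotp_ge0 (z - m); rewrite [dotp (z - m) _]dotpBl; lra.
Qed.

(* A cluster point of unit normals separating [K] from [(1 + 1 / j) y]. *)
Lemma supporting_hyperplane K y : compact K -> vconvex K -> K 0 -> K y ->
  (forall t, 1 < t -> ~ K (t *: y)) ->
  exists2 v, enorm v = 1 & forall x, K x -> dotp x v <= dotp y v.
Proof.
move=> coK cK K0 Ky hy.
have tj (j : nat) : 1 < 1 + j.+1%:R^-1 :> R by rewrite ltrDl invr_gt0.
have /choice[v_ hv] j : exists v, enorm v = 1 /\
    forall x, K x -> dotp x v <= dotp ((1 + j.+1%:R^-1) *: y) v.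
  by apply: nearest_point_separation => //; [exists 0|exact: hy].
have [|v [v1 hcl]] := @sphere_compact (v_ @ \oo) _.
  by exists 0%N => // j _; case: (hv j).
exists v => // x Kx.
(* The inequality at [j] holds for all later [v_ i], as [1 / (i + 1)] decreases and [y . v_ i >= 0];
   being closed, it passes to the cluster point. *)
have vj j x' : K x' -> dotp x' v <= (1 + j.+1%:R^-1) * dotp y v.
  move=> Kx'.
  pose V := [set w | 0 <= (1 + j.+1%:R^-1) * dotp y w - dotp x' w].
  have cV : closed V.
    have cf : continuous (fun w => dotp ((1 + j.+1%:R^-1) *: y - x') w).
      by apply: continuous_dotp2 => w; [exact: cst_continuous|exact: cvg_id].
    rewrite (_ : V = (fun w => dotp ((1 + j.+1%:R^-1) *: y - x') w) @^-1` [set t | 0 <= t]).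
      by move/continuous_closedP : cf; apply; exact: closed_ge.
    by apply/seteqP; split => w; rewrite /V/= dotpBl dotpZl.
  suff : V v by rewrite /V/= subr_ge0.
  apply: cV => U Uv; apply: hcl => //.
  exists j => // i /= ji; rewrite /V/= subr_ge0.
  have [_ hi] := hv i; apply: (le_trans (hi x' Kx')); rewrite dotpZl.
  apply: ler_wpM2r; first by have := hi 0 K0; rewrite dotp0l dotpZl pmulr_rge0 ?addr_gt0.
  by rewrite lerD2l lef_pV2 ?posrE// ler_nat.
have yv0 : 0 <= dotp y v.
  by have := vj 0%N 0 K0; rewrite dotp0l pmulr_rge0// addr_gt0.
rewrite leNgt; apply/negP => lt.
set al := dotp x v in lt; set be := dotp y v in lt yv0.
have d0 : 0 < al - be by rewrite subr_gt0.
(* An index with [N > be / (al - be)] makes [al <= (1 + 1/N) be] false. *)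
have := vj (Num.truncn (be / (al - be))) x Kx.
have := truncnS_gt (be / (al - be)); rewrite -/al -/be ltr_pdivrMr//.
set N := _.+1%:R => h1; have N0 : 0 < N by rewrite ltr0n.
rewrite mulrDl mul1r -lerBlDl mulrC ler_pdivlMr// mulrC => h2.
by move: h1; rewrite ltNge h2.
Qed.

End separation.

(** * Spherical integrals and the radial function *)

Section sphere_integral.
Context {R : realType} {n : nat}.
Local Notation lam := (@lebrow R n).

(** The integral of a nonnegative function is a supremum over simple functions, hence monotone in
    the domain even when this is not Borel, as may happen for a reverse radial Gauss image. *)
Lemma ge0_integral_subset_any d (T : measurableType d) (mu : {measure set T -> \bar R})
    (A B : set T) (f : T -> \bar R) : (forall x, 0 <= f x)%E -> A `<=` B ->
  (\int[mu]_(x in A) f x <= \int[mu]_(x in B) f x)%E.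
Proof.
move=> f0 AB; rewrite !ge0_integralE//; apply: ereal_sup_le => _ [h hA <-].
exists h => // x; apply: le_trans (hA x) _.
rewrite /patch; case: ifPn => [/set_mem/AB/mem_set ->//|_].
by case: ifPn.
Qed.

Lemma ge0_integral_mrestr d (T : measurableType d) (mu : {measure set T -> \bar R})
    (D : set T) (mD : measurable D) (f : T -> \bar R) : measurable_fun setT f ->
  (forall x, 0 <= f x)%E -> (\int[mrestr mu mD]_x f x = \int[mu]_(x in D) f x)%E.
Proof.
move=> mf f0; rewrite -(setUv D) ge0_integral_setU//; last 3 first.
- exact: measurableC.
- by rewrite setUv.
- by rewrite disj_set2E setICr.
rewrite [X in (_ + X)%E](_ : _ = 0%E) ?adde0.
  apply: eq_measure_integral => A mA AD.
  by rewrite /= /mrestr; congr (mu _); exact/setIidPl.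
rewrite (eq_measure_integral mzero) ?integral_measure_zero// => A mA AD.
rewrite /= /mrestr /mzero (_ : A `&` D = set0) ?measure0//.
by apply/seteqP; split => // x [/AD].
Qed.

Lemma sphere_integralE (A : set 'rV[R]_n) (f : 'rV[R]_n -> \bar R) :
  measurable A -> measurable_fun setT f -> (forall x, 0 <= f x)%E ->
  (\int[@sphere_measure R n]_(v in A) f v =
   n%:R%:E * \int[lam]_x (f (normalize x) * (\1_A (normalize x))%:E *
     (\1_(@punctured_ball R n) x)%:E))%E.
Proof.
move=> mA mf f0.
have mfA : measurable_fun setT (fun v => f v * (\1_A v)%:E)%E.
  by apply: emeasurable_funM => //; exact: measurable_eindic.
have fA0 v : (0 <= f v * (\1_A v)%:E)%E by rewrite mule_ge0// eindic_ge0.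
rewrite integral_indicE /sphere_measure ge0_integral_mscale//; congr (_ * _)%E.
transitivity (\int[pushforward (mrestr lam (@measurable_punctured_ball R n))
    (@normalize R n)]_v (f v * (\1_A v)%:E))%E; first by [].
rewrite ge0_integral_pushforward//; last exact: measurable_normalize.
rewrite preimage_setT ge0_integral_mrestr//.
- by rewrite integral_indicE.
- exact: (measurableT_comp mfA (@measurable_normalize R n)).
- by move=> x; exact: fA0.
Qed.

End sphere_integral.

Section radial.
Context {R : realType} {n : nat}.
Variables (K : set 'rV[R]_n) (rho0 R0 : R).
Hypotheses (cK : vconvex K) (clK : closed K) (K0 : K 0).
Hypotheses (rho0_gt0 : 0 < rho0) (Kr : eball rho0 `<=` K) (KR : K `<=` eball R0).
Implicit Types (u x v : 'rV[R]_n).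

Lemma radial_has_sup u : enorm u = 1 ->
  [set t | 0 <= t /\ K (t *: u)] !=set0 /\ has_ubound [set t | 0 <= t /\ K (t *: u)].
Proof.
move=> u1; split; first by exists 0; rewrite /= lexx scale0r.
exists R0 => t [t0 /KR]; rewrite /eball/= enormZ u1 mulr1 ger0_norm//.
Qed.

Lemma radial_mem u : enorm u = 1 -> K (radial_fun K u *: u).
Proof.
move=> u1; have [h1 h2] := radial_has_sup u1.
have clA : closed [set t | 0 <= t /\ K (t *: u)].
  apply: closedI; first exact: closed_ge.
  have cf : continuous (fun t : R => t *: u) by move=> t; exact: scalel_continuous.
  by move/continuous_closedP : cf; apply.
by have [] := clA _ (closure_sup h1 h2).
Qed.

Lemma radial_leP u t : enorm u = 1 -> 0 <= t -> K (t *: u) <-> t <= radial_fun K u.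
Proof.
move=> u1 t0; have [h1 h2] := radial_has_sup u1; split => [Ktu|tr].
  by apply: ub_le_sup.
have [r0|r0] := eqVneq (radial_fun K u) 0.
  by rewrite (_ : t = 0) ?scale0r//; apply/le_anti; rewrite t0 -r0 tr.
have rp : 0 < radial_fun K u by rewrite lt_neqAle eq_sym r0 (le_trans t0).
rewrite -[t](divfK r0) -scalerA; apply: vconvex_star => //; last exact: radial_mem.
by rewrite divr_ge0 ?(ltW rp)//= ler_pdivrMr// mul1r.
Qed.

Lemma radial_gt0 u : enorm u = 1 -> 0 < radial_fun K u.
Proof.
move=> u1; apply: (lt_le_trans rho0_gt0); apply/radial_leP => //; first exact: ltW.
by apply: Kr; rewrite /eball/= enormZ u1 mulr1 gtr0_norm.
Qed.

Lemma radial_out u t : enorm u = 1 -> 1 < t -> ~ K (t *: (radial_fun K u *: u)).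
Proof.
move=> u1 t1; have r0 := radial_gt0 u1; rewrite scalerA.
have tr0 : 0 <= t * radial_fun K u by rewrite mulr_ge0 ?(ltW r0)// ltW// (lt_trans _ t1).
by move/(radial_leP u1 tr0); rewrite leNgt -[ltLHS]mul1r ltr_pM2r// t1.
Qed.

(** The radial function extended from the sphere with degree [0] instead of [-1], as [polar_ball]
    requires. *)
Definition radial0 x := radial_fun K (normalize x).

Lemma radial0Z t x : 0 < t -> radial0 (t *: x) = radial0 x.
Proof. by move=> t0; rewrite /radial0 normalizeZ. Qed.

Lemma radial0_gt0 x : x != 0 -> 0 < radial0 x.
Proof. by move=> x0; apply: radial_gt0; exact: enorm_normalize. Qed.

Lemma radial0P x : x != 0 -> K x <-> enorm x <= radial0 x.
Proof.
move=> x0; rewrite -{1}(enormK x); apply: radial_leP; first exact: enorm_normalize.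
exact: enorm_ge0.
Qed.

(** At the origin the set of admissible [t] is unbounded, and [sup] takes its default value. *)
Lemma radial0_0 : radial0 0 = 0.
Proof.
rewrite /radial0 /radial_fun; apply: sup_out => -[_ [M hM]].
have := hM (`|M| + 1); rewrite /= /normalize !scaler0; have -> : 0 <= `|M| + 1 by rewrite addr_ge0.
move=> /(_ (conj isT K0)); rewrite leNgt => /negP; apply.
by rewrite (le_lt_trans (ler_norm M))// ltrDl.
Qed.

Lemma measurable_radial0 : measurable_fun setT radial0.
Proof.
have mK : measurable K by exact: row_closed_measurable.
apply: (measurability (@RGenCInfty.G R)) => [|/= _ [_] [s] -> <-].
  exact: RGenCInfty.measurableE.
rewrite setTI; have [s0|s0] := leP s 0.
  rewrite (_ : _ @^-1` _ = setT) //; apply/seteqP; split => // x _ /=.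
  rewrite in_itv/= andbT (le_trans s0)//.
  by have [->|/radial0_gt0/ltW//] := eqVneq x 0; rewrite radial0_0.
rewrite (_ : _ @^-1` _ = [set x | 0 < enorm x] `&`
    (fun x => s *: normalize x) @^-1` K); last first.
  apply/seteqP; split => x /=; rewrite in_itv/= andbT.
    move=> h; have x0 : x != 0 by apply: contraTneq h => ->; rewrite radial0_0 -ltNge.
    split; first by rewrite enorm_gt0.
    by apply/radial_leP => //; [exact: enorm_normalize|exact: ltW].
  rewrite enorm_gt0 => -[x0 h]; apply/radial_leP => //; last exact: ltW.
  exact: enorm_normalize.
apply: measurableI; first exact: measurable_ltr (measurable_cst _) (@measurable_enorm R n).
apply: measurable_preimage => //.
exact: (measurableT_comp (measurable_scale s) (@measurable_normalize R n)).
Qed.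

Lemma support_has_sup v : [set dotp x v | x in K] !=set0 /\
  has_ubound [set dotp x v | x in K].
Proof.
split; first by exists (dotp 0 v), 0.
exists (R0 * enorm v) => _ [x Kx <-].
rewrite (le_trans (ler_norm _))// (le_trans (ler_dotp x v))// ler_wpM2r ?enorm_ge0//.
exact: KR.
Qed.

Lemma support_ge x v : K x -> dotp x v <= support_fun K v.
Proof. by move=> Kx; have [_ h] := support_has_sup v; apply: ub_le_sup => //; exists x. Qed.

Lemma support_eq y v : K y -> (forall x, K x -> dotp x v <= dotp y v) ->
  dotp y v = support_fun K v.
Proof.
move=> Ky h; apply/le_anti; rewrite support_ge//=.
have [h1 _] := support_has_sup v; apply: ge_sup => // _ [x Kx <-]; exact: h.
Qed.

Lemma support_gt0 v : enorm v = 1 -> 0 < support_fun K v.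
Proof.
move=> v1; apply: (lt_le_trans rho0_gt0).
have <- : dotp (rho0 *: v) v = rho0 by rewrite dotpZl -enorm_sqr v1 expr1n mulr1.
by apply: support_ge; apply: Kr; rewrite /eball/= enormZ v1 mulr1 gtr0_norm.
Qed.

Lemma gauss_image_sphere : compact K -> reverse_radial_gauss_image K sphere = sphere.
Proof.
move=> coK; apply/seteqP; split => [u [v _ []]//|u u1].
have Ky := radial_mem u1.
have [v v1 hv] := supporting_hyperplane coK cK K0 Ky (fun t => @radial_out u t u1).
by exists v => //; split => //; exact: support_eq.
Qed.

(** The functional [v / h_K(v)] comes from [xi], is at most [1] on [K] and equals [1] at the
    boundary point in direction [u]. Any dilation of this point by a factor above [1] leaves the
    cylinder, so the condition in [cone_part] holds vacuously. *)
Lemma gauss_image_sub (xi : {vspace 'rV[R]_n}) :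
  reverse_radial_gauss_image K ([set` xi] `&` sphere) `<=`
  sphere `&` [set u | cone_part K xi (radial_fun K u *: u)].
Proof.
move=> u [v [vxi v1] [u1 huv]]; split => //=; split; first exact: radial_mem.
move=> s /andP[s0 s1] Ps; have s0' : 0 < ratr s :> R by rewrite ltr0q.
have h0 := support_gt0 v1; have r0 := radial_gt0 u1.
have hK y : K y -> dotp y ((support_fun K v)^-1 *: v) <= 1.
  by move=> Ky; rewrite dotpZr mulrC ler_pdivrMr// mul1r support_ge.
have := Ps _ (memvZ (support_fun K v)^-1 vxi) hK.
rewrite dotpZr dotpZl huv mulrCA mulVf ?gt_eqF// mulr1 invf_le1// leNgt.
by rewrite -[X in _ < X](rmorph1 (@ratr R)) ltr_rat s1.
Qed.

End radial.

(** * The affine dual curvature measure *)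

Section intersection_body.
Context {R : realType} {n : nat}.
Local Notation lam := (@lebrow R n).
Variables (K : set 'rV[R]_n) (p R0 : R).
Hypotheses (p01 : 0 < p < 1) (mK : measurable K) (KR : K `<=` eball R0).
Hypothesis lamK : (0 < lam K)%E.

Lemma radial_star_body (f : 'rV[R]_n -> R) w : 0 <= f w -> enorm w = 1 ->
  radial_fun (star_body_of f) w = f w.
Proof.
move=> f0 w1; rewrite /radial_fun (_ : [set t | _] = `[0, f w]%classic) ?sup_itvcc//.
apply/seteqP; split => t /=; rewrite in_itv/=.
  move=> [t0 [u u1 [s /=]]]; rewrite in_itv/= => /andP[s0 sf] E.
  have ts : t = s.
    by have := congr1 enorm E; rewrite !enormZ u1 w1 !mulr1 !ger0_norm.
  have [->|tn0] := eqVneq t 0; first by rewrite lexx.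
  by rewrite t0/= -(scalerI tn0 (etrans (congr1 ( *:%R^~ u) ts) E)) ts.
move=> /andP[t0 tf]; split => //; exists w => //; exists t => //=.
by rewrite in_itv/= t0.
Qed.

Let I w := (\int[lam]_(y in K) (rpow p (dotp w y))%:E)%E.

Let measurable_I : measurable_fun setT I.
Proof.
rewrite (_ : I = fun w => \int[lam]_(y in K) (rpow p (dotp (id y) (id w)))%:E)%E.
  exact: measurable_integral_rpow_dotp.
by apply/funext => w; apply: eq_integral => y _; rewrite dotpC.
Qed.

(** The integrand vanishes only on the hyperplane [w^⊥]; a zero integral would put [K] in a null
    set. *)
Let I_gt0 w : enorm w = 1 -> (0 < I w)%E.
Proof.
move=> w1; have I0 : (0 <= I w)%E by apply: integral_ge0 => y _; rewrite lee_fin rpow_ge0.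
rewrite lt_neqAle I0 andbT eq_sym; apply/eqP => Iw.
have mf : measurable_fun K (fun y => (rpow p (dotp w y))%:E).
  apply: measurable_funTS; apply/measurable_EFinP.
  apply: (measurableT_comp (measurable_rpow p)); exact: measurable_dotp2.
have h : (\int[lam]_(y in K) `|(rpow p (dotp w y))%:E| = 0)%E.
  by rewrite -[RHS]Iw; apply: eq_integral => y _; rewrite gee0_abs// lee_fin rpow_ge0.
have [N [mN N0 KN]] := (ae_eq_integral_abs lam mK mf).1 h.
have w0 : w != 0 by rewrite -enorm_gt0 w1.
pose H := [set y : 'rV[R]_n | dotp y w = 0].
have mH : measurable H.
  rewrite (_ : H = (fun y => dotp y w) @^-1` [set 0])//.
  by apply: measurable_preimage => //; exact: measurable_dotpl.
have : (lam K <= lam N + lam H)%E.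
  apply: (@le_trans _ _ (lam (N `|` H))).
    apply: le_measure; rewrite ?inE//; first exact: measurableU.
    move=> y Ky; have [yw|yw] := eqVneq (dotp y w) 0; [by right|left].
    apply: KN => /= /(_ Ky) [] /eqP; rewrite gt_eqF// /rpow powR_gt0// normr_gt0.
    by rewrite dotpC.
  exact: measureU2.
by rewrite N0 negligible_hyperplane// adde0 leNgt lamK.
Qed.

Let I_bound : exists2 J : R, 0 <= J & forall w, enorm w = 1 -> (I w <= J%:E)%E.
Proof.
have [J J0 hJ] := @integral_rpow_eball_le R n p R0 p01; exists J; first exact: J0.
move=> w w1; apply: le_trans (hJ w w1); rewrite /I.
rewrite [leLHS](_ : _ = \int[lam]_(x in K) (rpow p (dotp x w))%:E)%E; last first.
  by apply: eq_integral => y _; rewrite dotpC.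
apply: ge0_integral_subset_any => // x; by rewrite lee_fin rpow_ge0.
Qed.

Local Notation f := (Lp_intersection_radial p K).

Lemma Lp_intersection_radialE w : f w = ((1 - p) / 2 * fine (I w)) `^ p^-1.
Proof. by []. Qed.

Lemma measurable_Lp_intersection_radial : measurable_fun setT f.
Proof.
rewrite (_ : f = fun w => ((1 - p) / 2 * fine (I w)) `^ p^-1)//.
apply: (measurableT_comp (measurable_powR _)); apply: measurable_funM => //.
exact: (measurableT_comp _ measurable_I).
Qed.

Lemma Lp_intersection_radial_gt0 w : enorm w = 1 -> 0 < f w.
Proof.
move=> w1; rewrite Lp_intersection_radialE; apply: powR_gt0; case/andP: p01 => p0 p1.
apply: mulr_gt0; first by rewrite divr_gt0// subr_gt0.
have [J J0 hJ] := I_bound.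
by rewrite fine_gt0// I_gt0//= (le_lt_trans (hJ w w1))// ltry.
Qed.

Lemma Lp_intersection_radial_bounded : exists2 G : R, 0 <= G &
  forall w, enorm w = 1 -> f w <= G.
Proof.
have [J J0 hJ] := I_bound; case/andP: (p01) => p0 p1.
exists (((1 - p) / 2 * J) `^ p^-1); first exact: powR_ge0.
have c0 : 0 <= (1 - p) / 2 by rewrite divr_ge0// subr_ge0 ltW.
move=> w w1; rewrite Lp_intersection_radialE; have Iw0 := ltW (I_gt0 w1).
have IJ : fine (I w) <= J.
  by rewrite -lee_fin fineK ?hJ// ge0_fin_numE// (le_lt_trans (hJ w w1))// ltry.
apply: ge0_ler_powR; rewrite ?nnegrE ?invr_ge0 ?(ltW p0)//.
- by rewrite mulr_ge0// fine_ge0.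
- by rewrite mulr_ge0.
- exact: ler_wpM2l.
Qed.

End intersection_body.

Section cosine.
Context {R : realType} {n : nat}.
Local Notation lam := (@lebrow R n).
Variables (p : R) (g : 'rV[R]_n -> R).
Hypotheses (mg : measurable_fun setT g) (g0 : forall w, 0 <= g w).
Local Notation W := (potential p (sphere_weight g)).

Lemma measurable_sphere : measurable (@sphere R n).
Proof.
rewrite (_ : sphere = @enorm R n @^-1` [set 1])//.
by apply: measurable_preimage => //; exact: measurable_enorm.
Qed.

Lemma cosine_transformE (h : 'rV[R]_n -> R) v : (forall w, enorm w = 1 -> h w = g w) ->
  cosine_transform (- p) h v = fine (W v).
Proof.
move=> hg; rewrite /cosine_transform /Rintegral; congr fine.
transitivity (\int[@sphere_measure R n]_(w in sphere) (g w * rpow p (dotp v w))%:E)%E.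
  by apply: eq_integral => w /set_mem w1; rewrite hg.
have mh : measurable_fun setT (fun w => (g w * rpow p (dotp v w))%:E).
  apply/measurable_EFinP; apply: measurable_funM => //.
  by apply: (measurableT_comp (measurable_rpow p)); exact: measurable_dotp2.
have h0 w : (0 <= (g w * rpow p (dotp v w))%:E)%E by rewrite lee_fin mulr_ge0// rpow_ge0.
rewrite (sphere_integralE measurable_sphere mh h0) -ge0_integralZl//; last 2 first.
- apply: emeasurable_funM; last first.
    by apply: measurable_eindic; exact: measurable_punctured_ball.
  apply: emeasurable_funM.
    exact: (measurableT_comp mh (@measurable_normalize R n)).
  apply: (measurableT_comp (measurable_eindic measurable_sphere)).
  exact: measurable_normalize.
- by move=> x _; rewrite !mule_ge0// ?eindic_ge0.
apply: eq_integral => x _; have [Bx|Bx] := pselect (punctured_ball x); last first.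
  by rewrite sphere_weight_out// mul0r (indic_out Bx) !mule0.
rewrite indic_in; last by apply: enorm_normalize; exact: punctured_ball_neq0.
rewrite /sphere_weight indic_in// mul1r !mule1 -EFinM; congr EFin; exact: mulrA.
Qed.

(** Finiteness makes [fine (W v)] the true value. As [|y| <= 1] on the punctured ball,
    [|v . y/|y||^-p <= |v . y|^-p], and [integral_rpow_eball_le] applies. *)
Lemma potential_sphere_bounded G : 0 < p < 1 -> (forall w, enorm w = 1 -> g w <= G) ->
  forall v, enorm v = 1 -> (W v < +oo)%E.
Proof.
move=> p01 gG v v1; have [J J0 hJ] := @integral_rpow_eball_le R n p 1 p01; case/andP: p01 => p0 p1.
apply: (@le_lt_trans _ _
  (\int[lam]_x ((n%:R * `|G|)%:E * ((rpow p (dotp x v))%:E * (\1_(eball 1) x)%:E)))%E).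
  apply: ge0_le_integral => //.
  - by move=> y _; rewrite lee_fin mulr_ge0 ?rpow_ge0// sphere_weight_ge0.
  - apply/measurable_EFinP; apply: measurable_funM; first exact: measurable_sphere_weight.
    apply: (measurableT_comp (measurable_rpow p)); apply: measurable_dotp2 => //.
    exact: measurable_normalize.
  - apply: emeasurable_funM => //; apply: emeasurable_funM.
      apply/measurable_EFinP; apply: (measurableT_comp (measurable_rpow p)).
      exact: measurable_dotpl.
    by apply: measurable_eindic; exact: measurable_eball.
  move=> y _; have [By|By] := pselect (punctured_ball y); last first.
    by rewrite sphere_weight_out// mul0r !mule_ge0 ?eindic_ge0// lee_fin rpow_ge0.
  have y0 := punctured_ball_neq0 By; have /andP[ny0 ny1] := By.
  rewrite indic_in// mule1 -EFinM lee_fin; apply: ler_pM.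
  - exact: sphere_weight_ge0.
  - exact: rpow_ge0.
  - rewrite /sphere_weight indic_in// mul1r ler_wpM2l//.
    by rewrite (le_trans (gG _ (enorm_normalize y0)))// ler_norm.
  rewrite dotpC -{2}(enormK y) dotpZl rpowM ler_peMl ?rpow_ge0//.
  have -> : 1 = rpow p 1 by rewrite /rpow normr1 powR1.
  by apply: ler_rpow; rewrite ?(ltW p0)// ?normr1 gtr0_norm.
rewrite ge0_integralZl//; last 2 first.
- apply: emeasurable_funM.
    apply/measurable_EFinP; apply: (measurableT_comp (measurable_rpow p)).
    exact: measurable_dotpl.
  by apply: measurable_eindic; exact: measurable_eball.
- by move=> x _; rewrite mule_ge0 ?eindic_ge0// lee_fin rpow_ge0.
rewrite -integral_indicE; apply: lte_mul_pinfty; rewrite ?lee_fin ?mulr_ge0//.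
by rewrite (le_lt_trans (hJ v v1))// ltry.
Qed.

End cosine.

Section polar_potential.
Context {R : realType} {n : nat}.
Local Notation lam := (@lebrow R n).
Variables (K : set 'rV[R]_n) (rho0 R0 : R).
Hypotheses (cK : vconvex K) (clK : closed K) (K0 : K 0).
Hypotheses (rho0_gt0 : 0 < rho0) (Kr : eball rho0 `<=` K) (KR : K `<=` eball R0).
Variables (p : R) (g : 'rV[R]_n -> R) (G : R).
Hypotheses (p01 : 0 < p < 1) (mg : measurable_fun setT g) (g0 : forall w, 0 <= g w).
Hypotheses (gG : forall w, enorm w = 1 -> g w <= G) (n0 : (0 < n)%N).
Local Notation W := (potential p (sphere_weight g)).

Lemma normalize_idem (x : 'rV[R]_n) : normalize (normalize x) = normalize x.
Proof.
have [->|x0] := eqVneq x 0; first by rewrite /normalize !scaler0.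
by rewrite normalize_sphere// enorm_normalize.
Qed.

(** On the ray through [u] the weight is [r^-p W(u)], so [rho^(n-p) W(u)] is [n - p] times its
    integral against [r^(n-1) dr] up to [rho]: [polar_ball] with [a = n - p]. *)
Lemma sphere_integral_potential (A : set 'rV[R]_n) : measurable A ->
  (\int[@sphere_measure R n]_(v in A `&` sphere)
     (radial_fun K v `^ (n%:R - p) * fine (W v))%:E =
   (n%:R - p)%:E * \int[lam]_x (W x * (\1_K x)%:E * (\1_A (normalize x))%:E))%E.
Proof.
move=> mA; have /andP[p0 p1] := p01.
have np : 0 < n%:R - p by rewrite subr_gt0 (lt_le_trans p1)// ler1n.
have mW : measurable_fun setT W by exact: measurable_W.
have W0 x : (0 <= W x)%E by apply: potential_ge0; exact: sphere_weight_ge0.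
have mrad := measurable_radial0 cK clK K0 rho0_gt0 Kr KR.
have mAS : measurable (A `&` @sphere R n) by apply: measurableI => //; exact: measurable_sphere.
transitivity (\int[@sphere_measure R n]_(v in A `&` sphere)
    ((radial0 K v `^ (n%:R - p))%:E * W v))%E.
  apply: eq_integral => v /set_mem[_ v1].
  rewrite EFinM fineK /radial0 ?normalize_sphere// ge0_fin_numE//.
  exact: potential_sphere_bounded gG _ v1.
have mrW : measurable_fun setT (fun v => (radial0 K v `^ (n%:R - p))%:E * W v)%E.
  apply: emeasurable_funM => //; apply/measurable_EFinP.
  exact: (measurableT_comp (measurable_powR _)).
have rW0 v : (0 <= (radial0 K v `^ (n%:R - p))%:E * W v)%E.
  by rewrite mule_ge0// lee_fin powR_ge0.
rewrite (sphere_integralE mAS mrW rW0).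
pose F x := (W (normalize x) * (\1_(A `&` @sphere R n) (normalize x))%:E)%E.
have mF : measurable_fun setT F.
  apply: emeasurable_funM; first exact: (measurableT_comp mW (@measurable_normalize R n)).
  exact: (measurableT_comp (measurable_eindic mAS) (@measurable_normalize R n)).
have F0 x : (0 <= F x)%E by rewrite mule_ge0// eindic_ge0.
have FZ t x : 0 < t -> F (t *: x) = F x by move=> t0; rewrite /F normalizeZ.
have E := polar_ball n0 np mF mrad F0 FZ (@radial0Z _ _ K)
  (@radial0_gt0 _ _ _ _ _ cK clK K0 rho0_gt0 Kr KR).
transitivity (n%:R%:E * (\int[lam]_x (F x * (radial0 K x `^ (n%:R - p))%:E *
    (\1_(@punctured_ball R n) x)%:E)))%E.
  congr (_ * _)%E; apply: eq_integral => x _; congr (_ * _)%E.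
  by rewrite /F {1}/radial0 normalize_idem [RHS]muleC muleA.
rewrite E; congr (_ * _)%E; apply: eq_integral => x _.
(* The origin is in [K] but not in [{0 < |x| <= rho}]; both sides vanish there because
   [rpow p 0 = 0]. *)
have [->|x0] := eqVneq x 0.
  rewrite [X in (_ * (_ * X%:E))%E]indic_out /=; last first.
    have -> : enorm (0 : 'rV[R]_n) = 0 by apply/eqP; rewrite enorm_eq0.
    by rewrite ltxx.
  rewrite [W 0](_ : _ = 0)%E ?mul0e ?mule0//.
  rewrite /potential integral0_eq// => y _.
  by rewrite dotp0l rpow0 ?mulr0// gt_eqF.
have nx : 0 < enorm x by rewrite enorm_gt0.
have -> : W x = ((rpow p (enorm x))%:E * W (normalize x))%E.
  rewrite -[in LHS](enormK x); apply: potentialZ nx; first exact: measurable_sphere_weight.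
  by move=> y; exact: sphere_weight_ge0.
rewrite /F.
have -> : (\1_(A `&` @sphere R n) (normalize x) : R) = \1_A (normalize x).
  have [Ax|Ax] := pselect (A (normalize x)).
    by rewrite !indic_in//; split => //; exact: enorm_normalize.
  by rewrite !indic_out// => -[].
have -> : (\1_[set x1 | 0 < enorm x1 <= radial0 K x1] x : R) = \1_K x.
  have h := radial0P cK clK K0 KR x0.
  have [Kx|Kx] := pselect (K x); first by rewrite !indic_in//= nx; exact/h.
  by rewrite !indic_out//= => /andP[_ /h].
have -> : enorm x `^ (n%:R - p - n%:R) = rpow p (enorm x).
  by rewrite /rpow gtr0_norm// addrAC subrr add0r.
by rewrite muleACA (muleC (W _)) (muleC (\1_A _)%:E) !muleA.
Qed.

End polar_potential.

(** To be read with [a = n - p], [k = mu(K)], [C] the mass of the cone part and [c] the constant in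
    the curvature measure. The strict inequality forces [k > 0], hence a nonzero denominator. *)
Lemma ratio_lt {R : realType} (a c N D C k m : R) : 0 < c -> 0 < a -> 0 <= C -> 0 <= m ->
  N <= a * C -> D = a * k -> a * C < m * k -> c * N / (c * D) < m / a.
Proof.
move=> c0 a0 C0 m0 NC -> h.
have k0 : 0 < k.
  rewrite ltNge; apply/negP => k0; move: h; apply/negP; rewrite -leNgt.
  by rewrite (@le_trans _ _ 0) ?mulr_ge0 ?(ltW a0)// mulr_ge0_le0.
rewrite -mulf_div divff ?gt_eqF// mul1r ltr_pdivrMr ?mulr_gt0// mulrA divfK ?gt_eqF//.
exact: le_lt_trans NC h.
Qed.

Section curvature.
Context {R : realType} {n : nat}.
Local Notation lam := (@lebrow R n).
Variables (K : set 'rV[R]_n) (rho0 R0 : R).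
Hypotheses (coK : compact K) (cK : vconvex K) (clK : closed K) (K0 : K 0).
Hypotheses (rho0_gt0 : 0 < rho0) (Kr : eball rho0 `<=` K) (KR : K `<=` eball R0).
Variables (p : R) (g : 'rV[R]_n -> R) (G : R).
Hypotheses (p01 : 0 < p < 1) (mg : measurable_fun setT g) (g0 : forall w, 0 <= g w).
Hypotheses (gG : forall w, enorm w = 1 -> g w <= G) (n0 : (0 < n)%N).
Local Notation W := (potential p (sphere_weight g)).
Local Notation phi := (fun v => radial_fun K v `^ (n%:R - p) * fine (W v)).

Let W_ge0 x : (0 <= W x)%E.
Proof. by apply: potential_ge0; exact: sphere_weight_ge0. Qed.

Let mK : measurable K. Proof. exact: row_closed_measurable. Qed.
Let mW : measurable_fun setT W. Proof. exact: measurable_W. Qed.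

Let np_gt0 : 0 < n%:R - p.
Proof. by have /andP[_ p1] := p01; rewrite subr_gt0 (lt_le_trans p1)// ler1n. Qed.

Lemma sphere_curvature :
  (\int[@sphere_measure R n]_(v in reverse_radial_gauss_image K sphere) (phi v)%:E =
   (n%:R - p)%:E * \int[lam]_(x in K) W x)%E.
Proof.
rewrite (gauss_image_sphere cK clK K0 rho0_gt0 Kr KR coK) -[X in integral _ X](setTI sphere).
rewrite (sphere_integral_potential cK clK K0 rho0_gt0 Kr KR p01 mg g0 gG n0 measurableT).
rewrite [in RHS]integral_indicE; congr (_ * _)%E; apply: eq_integral => x _.
by rewrite [\1_setT _]indic_in// mule1.
Qed.

(** The Gauss image is enlarged to the Borel set [A] of directions whose boundary point is in the
    cone part. *)
Lemma subspace_curvature_le (xi : {vspace 'rV[R]_n}) :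
  (\int[@sphere_measure R n]_(v in
      reverse_radial_gauss_image K ([set` xi] `&` sphere)) (phi v)%:E <=
   (n%:R - p)%:E * \int[lam]_(x in cone_part K xi) W x)%E.
Proof.
pose A := [set u | cone_part K xi (radial0 K u *: u)].
have mA : measurable A.
  apply: (@measurable_preimage _ _ _ _ (fun u => radial0 K u *: u)) => //.
    apply: measurable_rowP => i; rewrite (_ : (fun t => _) = fun t => radial0 K t * t 0 i).
      apply: measurable_funM; last exact: measurable_coord.
      exact: measurable_radial0 cK clK K0 rho0_gt0 Kr KR.
    by apply/funext => t; rewrite mxE.
  exact: measurable_cone_part.
apply: (@le_trans _ _ (\int[@sphere_measure R n]_(v in A `&` sphere) (phi v)%:E)%E).
  apply: ge0_integral_subset_any.
    by move=> v; rewrite lee_fin mulr_ge0 ?powR_ge0// fine_ge0.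
  move=> u /(gauss_image_sub cK clK K0 rho0_gt0 Kr KR)[u1 hu]; split => //.
  by rewrite /A/= /radial0 normalize_sphere.
rewrite (sphere_integral_potential cK clK K0 rho0_gt0 Kr KR p01 mg g0 gG n0 mA).
apply: lee_wpmul2l; first by rewrite lee_fin ltW.
rewrite [leRHS]integral_indicE.
have mC : measurable (cone_part K xi) by exact: measurable_cone_part.
apply: ge0_le_integral => //.
- by move=> x _; rewrite !mule_ge0 ?eindic_ge0.
- apply: emeasurable_funM; first by apply: emeasurable_funM => //; exact: measurable_eindic.
  exact: (measurableT_comp (measurable_eindic mA) (@measurable_normalize R n)).
- by apply: emeasurable_funM => //; exact: measurable_eindic.
move=> x _; rewrite -muleA; apply: lee_wpmul2l => //; rewrite -EFinM lee_fin.
have [Cx|Cx] := pselect (cone_part K xi x).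
  by rewrite (indic_in Cx) !indicE; case: (_ \in _); case: (_ \in _); rewrite ?mulr1 ?mulr0.
rewrite (indic_out Cx); have [Kx|Kx] := pselect (K x); last by rewrite indic_out// mul0r.
have [Ax|Ax] := pselect (A (normalize x)); last by rewrite (indic_out Ax) mulr0.
exfalso; apply: Cx; have [x0|x0] := eqVneq x 0.
  by move: Ax; rewrite /A/= x0 /normalize !scaler0.
have r0 : 0 < radial0 K x by exact: radial0_gt0 cK clK K0 rho0_gt0 Kr KR _ x0.
have nx : 0 < enorm x by rewrite enorm_gt0.
(* [x] lies between the origin and the boundary point in its direction, so [cone_part_star]
   applies. *)
have -> : x = (enorm x / radial0 K x) *: (radial0 K (normalize x) *: normalize x).
  by rewrite scalerA /radial0 normalize_idem divfK ?gt_eqF// enormK.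
apply: cone_part_star => //; rewrite divr_gt0//= ler_pdivrMr// mul1r.
exact/(radial0P cK clK K0 KR x0).
Qed.

End curvature.

Theorem theorem2 (R : realType) (n : nat) (p : R) (K : set 'rV[R]_n) :
  (2 <= n)%N ->
  0 < p < 1 ->
  convex_body K ->
  origin_symmetric K ->
  forall xi : {vspace 'rV[R]_n}, (0 < \dim xi < n)%N ->
    affine_dual_curvature_measure p K ([set` xi] `&` sphere) /
    affine_dual_curvature_measure p K sphere
    < (\dim xi)%:R / (n%:R - p).
Proof.
move=> n2 p01 [coK /convex_set_vconvex cK intK] symK xi /andP[xi0 _].
have n0 : (0 < n)%N by exact: leq_trans n2.
have clK : closed K by apply: compact_closed => //; exact: norm_hausdorff.
have mK : measurable K by exact: row_closed_measurable.
have [rho0 rho0_gt0 Kr] := convex_body_eball cK symK intK.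
have [R0 R0_gt0 KR] := compact_eball coK.
have enorm0 : enorm (0 : 'rV[R]_n) = 0 by apply/eqP; rewrite enorm_eq0.
have K0 : K 0 by apply: Kr; rewrite /eball/= enorm0 ltW.
have lamK := body_measure_gt0 mK rho0_gt0 Kr.
have [F F0 fF] := Lp_intersection_radial_bounded p01 mK KR lamK.
have f0 := Lp_intersection_radial_gt0 p01 mK KR lamK.
have /andP[p0 p1] := p01.
have np : 0 < n%:R - p by rewrite subr_gt0 (lt_le_trans p1)// ler1n.
(* From here on the intersection body is represented by [g], measurable and, on the sphere, positive
   and bounded. *)
pose g w := Lp_intersection_radial p K w `^ (n%:R - p).
have mg : measurable_fun setT g.
  exact: (measurableT_comp (measurable_powR _) (measurable_Lp_intersection_radial p mK)).
have g0 w : 0 <= g w by exact: powR_ge0.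
have g_gt0 w : enorm w = 1 -> 0 < g w by move=> w1; apply: powR_gt0; exact: f0.
have gG w : enorm w = 1 -> g w <= F `^ (n%:R - p).
  move=> w1; apply: ge0_ler_powR; rewrite ?nnegrE ?(ltW np)//; last exact: fF.
  exact/ltW/f0.
have radial_g w : enorm w = 1 ->
    radial_fun (Lp_intersection_body p K) w `^ (n%:R - p) = g w.
  by move=> w1; rewrite radial_star_body//; exact/ltW/f0.
have [E [B [r [q [dual [ur uq rq sr] full span]]]]] := dual_basis xi.
have ineq := body_ineq mK cK clK p01 mg g0 g_gt0 gG n0 symK rho0_gt0 R0_gt0 Kr KR
  dual ur uq rq sr full span xi0.
have Kfin := potential_body_fin mK p01 mg g0 gG KR.
have W0 x : (0 <= potential p (sphere_weight g) x)%E.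
  by apply: potential_ge0; exact: sphere_weight_ge0.
have curvatureE eta : affine_dual_curvature_measure p K eta =
    (1 - p) / (2 * `|p|) *
    fine (\int[@sphere_measure R n]_(v in reverse_radial_gauss_image K eta)
      (radial_fun K v `^ (n%:R - p) * fine (potential p (sphere_weight g) v))%:E)%E.
  rewrite /affine_dual_curvature_measure /Rintegral; congr (_ * fine _).
  by apply: eq_integral => v _; rewrite (cosine_transformE p mg g0 v radial_g).
rewrite !curvatureE.
have Cfin : (\int[@lebrow R n]_(x in cone_part K xi) potential p (sphere_weight g) x < +oo)%E.
  apply: le_lt_trans Kfin; apply: ge0_integral_subset_any => //.
  by move=> x [].
have C0 : (0 <= \int[@lebrow R n]_(x in cone_part K xi) potential p (sphere_weight g) x)%E.
  by apply: integral_ge0.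
apply: ratio_lt ineq => //.
- by rewrite divr_gt0 ?subr_gt0// mulr_gt0// normr_gt0 gt_eqF.
- exact: fine_ge0.
(* [fine] is monotone between finite values; finiteness of the smaller integral follows from the
   bound itself. *)
- have := subspace_curvature_le cK clK K0 rho0_gt0 Kr KR p01 mg g0 gG n0 xi.
  rewrite -[X in (_ <= _ * X)%E]fineK ?ge0_fin_numE// -EFinM => h.
  rewrite -lee_fin fineK//; rewrite ge0_fin_numE; first by rewrite (le_lt_trans h)// ltry.
  apply: integral_ge0 => v _.
  by rewrite lee_fin mulr_ge0 ?powR_ge0// fine_ge0.
- rewrite (sphere_curvature coK cK clK K0 rho0_gt0 Kr KR p01 mg g0 gG n0) fineM//.
  by rewrite ge0_fin_numE//; exact: integral_ge0.
Qed.
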